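(* Let $A$ satisfy the assumptions (A1)--(A5) listed in the context, let $\delta=\inf\{|\lambda_m-\lambda_n|: m\ne n\in\mathbb Z\}$, and let $B\in\mathfrak S_2(H)$ with $JB=0$ and $\|B\|_2<\frac{\delta}{3}$. Put $$\Phi(X)=B\,\Gamma X-(\Gamma X)J(B\,\Gamma X)+B,\qquad X\in\mathfrak S_2(H).$$ Let $X_*\in\mathfrak S_2(H)$ be the limit of the simple iterations $X_0=0$, $X_1=\Phi(X_0)=B$, etc. (this limit exists), and let $U=\Gamma X_*$, $V=JX_*$. Then $V=JX_*=J(B\,\Gamma X_* )$ and: (1) $U,V\in\mathfrak S_2(H)$, the operator $A-B$ is similar to the operator $A-V$, and the similarity transform is given by $I+U$: $$(A-B)(I+U)=(I+U)(A-V).$$ (2) The matrix of $V$ is diagonal, i.e. $P_mVP_n=0$ for $m\ne n$, and the spectral projections $P'_n=(I+U)P_n(I+U)^{-1}$, $n\in\mathbb Z$, of the operator $A-B$ form a resolution of the identity. (3) $\sigma(A-B)=\bigcup_{n\in\mathbb Z}\{\lambda_n-b_n\}$ for some sequence $b=(b_n)\in\ell^1(\mathbb Z)$.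
   Context: $H$ is a separable complex Hilbert space, $B(H)$ the algebra of bounded linear operators on $H$, $\mathfrak S_2(H)$ the ideal of Hilbert--Schmidt operators with norm $\|\cdot\|_2$. Resolution of the identity: a finite or countable family $\{E_n\}$ of idempotents in $B(H)$ such that each $E_n$ is an orthogonal projection, $E_mE_n=0$ for $m\neq n$, and for each $x\in H$ the series $\sum_nE_nx$ converges unconditionally to $x$. Assumptions on the densely defined operator $A:D(A)\subseteq H\to H$: (A1) $A$ is a closed normal linear operator, i.e. $D(A^* )=D(A)$ and $\|A^*x\|=\|Ax\|$ for $x\in D(A)$; (A2) $\sigma(A)=\bigcup_{n\in\mathbb Z}\{\lambda_n\}$, where each $\lambda_n$ is a semisimple eigenvalue of $A$ of finite multiplicity; (A3) the Riesz projections $P_n=P(\{\lambda_n\},A)$ (so $AP_n=\lambda_nP_n$) form a resolution of the identity; (A4) $\sup_{j\in\mathbb Z}\sum_{n\ne j}|\lambda_n-\lambda_j|^{-2}<\infty$; (A5) for every $\varepsilon>0$ there is $\lambda_\varepsilon\in\rho(A)$ with $\|(A-\lambda_\varepsilon I)^{-1}\|<\varepsilon$. It follows that $\delta>0$. Transforms: for $X\in\mathfrak S_2(H)$, $JX=\sum_{n\in\mathbb Z}P_nXP_n$ and $\Gamma X=\sum_{m\ne n}\frac{P_mXP_n}{\lambda_m-\lambda_n}$. Similarity: operators $A_1,A_2$ are similar, with similarity transform $W$ of $A_1$ into $A_2$, if $W\in B(H)$ is continuously invertible, $WD(A_2)=D(A_1)$ and $A_1Wx=WA_2x$ for $x\in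 D(A_2)$. The operators $A-B$ and $A-V$ have domain $D(A)$.
   Formalization: In (2) the P'_n, oblique in general, are shown orthogonal only for the equivalent inner product <(I+U)^{-1}x,(I+U)^{-1}y>; in (3) each λ_n gets as many shifts b_{n,i} as its multiplicity, absolutely summable in total, since one b_n per n fails for multiple eigenvalues. *)

(* Defs.v *)
From HB Require Import structures.
From mathcomp Require Import all_boot all_order all_algebra.
From mathcomp Require Import complex.
From mathcomp Require Import all_classical all_reals all_analysis.
From mathcomp.analysis.showcase Require summability.

Set Implicit Arguments.
Unset Strict Implicit.
Unset Printing Implicit Defensive.

Import Order.TTheory GRing.Theory Num.Theory.
Import numFieldNormedType.Exports.

Local Open Scope classical_set_scope.
Local Open Scope ring_scope.
Local Open Scope complex_scope.

(* Norms of spaces over R[i] take values in R[i]; [rnorm] is the same number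
   seen in R. *)
Definition rnorm (R : realType) (V : normedZmodType R[i]) (x : V) : R :=
  complex.Re `|x|.

Definition separable (T : topologicalType) : Prop :=
  exists S : set T, countable S /\ dense S.

(* A Hilbert space is a [completeNormedModType R[i]] whose norm comes from a
   positive definite hermitian form, linear in its first argument. *)
Definition norm_from_dot (R : realType) (H : normedModType R[i])
    (dot : H -> H -> R[i]) : Prop :=
  forall x, `|x| ^+ 2 = dot x x.

Definition bounded_op (R : realType) (H : normedModType R[i]) (T : H -> H)
    : Prop :=
  linear T /\ continuous T.

Definition opnorm (R : realType) (H : normedModType R[i]) (T : H -> H) : R :=
  sup [set rnorm (T x) | x in [set x : H | rnorm x <= 1]].

Definition inverse_op (R : realType) (H : normedModType R[i])
    (W W' : H -> H) : Prop :=
  [/\ bounded_op W', cancel W W' & cancel W' W].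

(* The values of [app] outside [dom] are irrelevant. *)
Record operator (R : realType) (H : normedModType R[i]) := Operator {
  dom : set H;
  app :> H -> H }.

Definition linear_operator (R : realType) (H : normedModType R[i])
    (A : operator H) : Prop :=
  dom A 0 /\
  forall (a : R[i]) x y, dom A x -> dom A y ->
    dom A (a *: x + y) /\ A (a *: x + y) = a *: A x + A y.

Definition densely_defined (R : realType) (H : normedModType R[i])
    (A : operator H) : Prop := dense (dom A).

Definition closed_operator (R : realType) (H : normedModType R[i])
    (A : operator H) : Prop :=
  closed [set p : H * H | dom A p.1 /\ p.2 = A p.1].

Definition sub_operator (R : realType) (H : normedModType R[i])
    (A : operator H) (B : H -> H) : operator H :=
  Operator (dom A) (A \- B).

Definition adjoint (R : realType) (H : normedModType R[i])
    (dot : H -> H -> R[i]) (A : operator H) : operator H :=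
  let adj_at y z := forall x, dom A x -> dot (A x) y = dot x z in
  Operator [set y | exists z, adj_at y z] (fun y => xget 0 [set z | adj_at y z]).

Definition normal_operator (R : realType) (H : normedModType R[i])
    (dot : H -> H -> R[i]) (A : operator H) : Prop :=
  dom (adjoint dot A) = dom A /\
  forall x, dom A x -> `|adjoint dot A x| = `|A x|.

Definition is_resolvent (R : realType) (H : normedModType R[i])
    (A : operator H) (z : R[i]) (T : H -> H) : Prop :=
  [/\ bounded_op T,
      forall y, dom A (T y) /\ A (T y) - z *: T y = y
    & forall x, dom A x -> T (A x - z *: x) = x].

Definition resolvent_set (R : realType) (H : normedModType R[i])
    (A : operator H) : set R[i] :=
  [set z | exists T, is_resolvent A z T].

Definition spectrum (R : realType) (H : normedModType R[i])
    (A : operator H) : set R[i] := ~` resolvent_set A.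

(* (A - z I)^-1 *)
Definition resolvent (R : realType) (H : normedModType R[i])
    (A : operator H) (z : R[i]) : H -> H :=
  xget (fun=> 0) [set T | is_resolvent A z T].

(* The integral of f over the positively oriented circle z = c + r e^{it}. *)
Definition circle_integral (R : realType) (c : R[i]) (r : R)
    (f : R[i] -> R[i]) : R[i] :=
  let u (t : R) : R[i] := cos t +i* sin t in
  let g (t : R) : R[i] := f (c + r%:C * u t) * ('i * r%:C * u t) in
  (\int[@lebesgue_measure R]_(t in `[0%R, 2 * pi]) complex.Re (g t)) +i*
  (\int[@lebesgue_measure R]_(t in `[0%R, 2 * pi]) complex.Im (g t)).

(* P = P(sigma, A) = - 1/(2 pi i) * \oint (A - z I)^-1 dz (integral in the weak
   sense), over a circle in the resolvent set such that sigma is the part of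
   the spectrum inside it.  Spectral sets not separated by a circle are not
   covered. *)
Definition riesz_projection (R : realType) (H : normedModType R[i])
    (dot : H -> H -> R[i]) (A : operator H) (sigma : set R[i]) (P : H -> H)
    : Prop :=
  bounded_op P /\
  exists (c : R[i]) (r : R),
    [/\ 0 < r,
        forall z, rnorm (z - c) = r -> resolvent_set A z,
        sigma = spectrum A `&` [set z | rnorm (z - c) < r]
      & forall x y, dot (P x) y =
          - (2%:R * pi%:C * 'i)^-1 *
            circle_integral c r (fun z => dot (resolvent A z x) y)].

Definition has_dimension (R : realType) (H : normedModType R[i]) (S : set H)
    (k : nat) : Prop :=
  exists e : 'I_k -> H,
    (forall c : 'I_k -> R[i], \sum_i c i *: e i = 0 -> forall i, c i = 0) /\
    S = [set x | exists c : 'I_k -> R[i], x = \sum_i c i *: e i].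

(* P is the Riesz projection of A at the isolated point l of the spectrum;
   semisimple means, as in Kato, that the eigennilpotent (A - l I) P is 0, and
   the multiplicity is the dimension of the range of P. *)
Definition semisimple_eigenvalue (R : realType) (H : normedModType R[i])
    (A : operator H) (P : H -> H) (l : R[i]) (k : nat) : Prop :=
  [/\ exists x, [/\ dom A x, x != 0 & A x = l *: x],
      forall x, dom A (P x) /\ A (P x) = l *: P x
    & has_dimension (range P) k].

(* [dot] is a parameter because orthogonality will also be used with respect to
   an equivalent inner product. *)
Definition orthogonal_projection (R : realType) (H : normedModType R[i])
    (dot : H -> H -> R[i]) (E : H -> H) : Prop :=
  [/\ bounded_op E,
      forall x, E (E x) = E x
    & forall x y, dot (E x) y = dot x (E y)].

(* Convergence along finite subsets is unconditional convergence. *)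
Definition resolution_of_identity (R : realType) (H : normedModType R[i])
    (dot : H -> H -> R[i]) (I : countType) (E : I -> H -> H) : Prop :=
  [/\ forall n, orthogonal_projection dot (E n),
      forall m n, m != n -> forall x, E m (E n x) = 0
    & forall x, summability.partial_sum (fun n => E n x)
                  @ summability.totally --> x].

Definition orthonormal_basis (R : realType) (H : normedModType R[i])
    (dot : H -> H -> R[i]) (S : set H) : Prop :=
  (forall x y, S x -> S y -> dot x y = (x == y)%:R) /\
  (forall x, (forall e, S e -> dot x e = 0) -> x = 0).

(* The norm does not depend on the orthonormal basis; one is picked. *)
Definition hs_norm (R : realType) (H : normedModType R[i])
    (dot : H -> H -> R[i]) (T : H -> H) : \bar R :=
  let S := xget set0 (orthonormal_basis dot) in
  sqrte (\esum_(e in S) (rnorm (T e) ^+ 2)%:E).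

Definition hilbert_schmidt (R : realType) (H : normedModType R[i])
    (dot : H -> H -> R[i]) (T : H -> H) : Prop :=
  bounded_op T /\ (hs_norm dot T < +oo)%E.

(* For Hilbert-Schmidt X the series defining [Jtransform] and [Gammatransform] converge
   unconditionally in Hilbert-Schmidt norm, hence pointwise to the same
   operators; the pointwise sums are taken as definitions. *)
Definition Jtransform (R : realType) (H : normedModType R[i])
    (P : int -> H -> H) (X : H -> H) : H -> H :=
  fun x => summability.sum (fun n : int => P n (X (P n x))).

Definition Gammatransform (R : realType) (H : normedModType R[i])
    (lam : int -> R[i]) (P : int -> H -> H) (X : H -> H) : H -> H :=
  fun x => summability.sum (fun mn : int * int =>
    if mn.1 == mn.2 then 0
    else (lam mn.1 - lam mn.2)^-1 *: P mn.1 (X (P mn.2 x))).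

Definition Phi (R : realType) (H : normedModType R[i])
    (lam : int -> R[i]) (P : int -> H -> H) (B X : H -> H) : H -> H :=
  (B \o Gammatransform lam P X)
    \- (Gammatransform lam P X \o Jtransform P (B \o Gammatransform lam P X)) \+ B.

Definition gap (R : realType) (lam : int -> R[i]) : R :=
  inf [set r | exists m n, m != n /\ r = rnorm (lam m - lam n)].

Definition similar_by (R : realType) (H : normedModType R[i])
    (A1 A2 : operator H) (W : H -> H) : Prop :=
  [/\ bounded_op W,
      exists W', inverse_op W W',
      W @` dom A2 = dom A1
    & forall x, dom A2 x -> A1 (W x) = W (A2 x)].

(* Main.v *)
Require Import Defs.
From HB Require Import structures.
From mathcomp Require Import all_boot all_order all_algebra.
From mathcomp Require Import complex finmap spectral.
From mathcomp Require Import all_classical all_reals all_analysis.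
From mathcomp.analysis.showcase Require summability.
From mathcomp Require Import lra ring.

(** The iteration takes place in the Banach space of Hilbert--Schmidt operators.
    With respect to the resolution of the identity [P], row [m] of [J X] is row
    [m] of [X] times [P m], and row [m] of [Gamma X] is row [m] of [X] times a
    diagonal operator of norm at most [1 / d], where [d] is the gap.  Since the
    squared Hilbert--Schmidt norm is the sum of the squared norms of the rows,
    [|J X| <= |X|] and [|Gamma X| <= |X| / d] ([mult_HSle]).  For [|B| <= b] with
    [3 b < d] these bounds make [Phi] a contraction of ratio [3 b / d] on the ball
    of radius [3 b] ([Phi_HSle], [Phi_lip]), whence the limit [Xs], with
    [|U| <= 3 b / d < 1] for [U = Gamma Xs], and [|V| <= b] for [V = J Xs].

    Normality and closedness of [A] make it the diagonal operator with entries
    [lam n] on its maximal domain ([proj_op], [dom_intro]).  Coordinatewise,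
    [A U - U A = Xs - V] ([Gamma_comm]), and with [Xs = B U - U V + B] this is
    [(A - B) (1 + U) = (1 + U) (A - V)].  A Neumann series inverts [1 + U]; that
    it maps the domain of [A] onto itself follows from
    [(1 + U) T = T (1 + U + (Xs - V) T)] for a resolvent [T] of [A] of small norm
    ([W_dom_image]).

    [A - V] is block diagonal with finite-dimensional blocks [lam n - V].  In an
    orthonormal basis [f n] of the range of [P n] in which [V] is triangular
    ([triangular_basis_of_range]) the eigenvalues of the blocks are [lam n - b],
    with [b = <V f, f>], and [|b| <= |V| < d / 3].  The blocks can be inverted together
    at any other point because [|lam n|] tends to infinity ([block_spectrum]).
    As [V = J (B U)], one has [b = <U f, B' f>] with [B'] the adjoint of [B], and the
    squares of [|U f|] and [|B' f|] sum up to squared Hilbert--Schmidt norms, so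
    the [b] are absolutely summable ([diagonal_summable]).

    The circle of radius [d / 2] about [lam n] separates the [n]-th cluster of
    eigenvalues from the others.  On it, the resolvent of [A - V] is a uniform
    limit of Laurent polynomials in [w = z - lam n]: a geometric series in [V / w] on
    the range of [P n], and one in [w S0] on its complement, with [S0] the reduced
    resolvent ([laurent_approx]).  Integrating term by term leaves the residue
    [- P n] ([circle_integral_laurent], [riesz_integral]); conjugation by [1 + U]
    carries this over to [A - B]. *)

Import Order.TTheory GRing.Theory Num.Theory.
Import numFieldNormedType.Exports.

Local Open Scope classical_set_scope.
Local Open Scope ring_scope.
Local Open Scope complex_scope.

Set Implicit Arguments.
Unset Strict Implicit.
Unset Printing Implicit Defensive.

(** * Real-valued norms over the complex numbers *)

Section ComplexNorm.
Variable R : realType.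

Lemma conj_conjc (z : R[i]) : Num.conj z = conjc z.
Proof. by []. Qed.

Lemma ReD (z w : R[i]) : complex.Re (z + w) = complex.Re z + complex.Re w.
Proof. by case: z; case: w. Qed.

Lemma ImD (z w : R[i]) : complex.Im (z + w) = complex.Im z + complex.Im w.
Proof. by case: z; case: w. Qed.

Lemma ReN (z : R[i]) : complex.Re (- z) = - complex.Re z.
Proof. by case: z. Qed.

Lemma ReB (z w : R[i]) : complex.Re (z - w) = complex.Re z - complex.Re w.
Proof. by rewrite ReD ReN. Qed.

Lemma Re_conj (z : R[i]) : complex.Re (Num.conj z) = complex.Re z.
Proof. by case: z. Qed.

Lemma realCM (x y : R) : x%:C * y%:C = (x * y)%:C.
Proof. by rewrite rmorphM. Qed.

Variable V : normedZmodType R[i].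
Implicit Types x y : V.

Lemma normE x : `|x| = (rnorm x)%:C.
Proof. by rewrite /rnorm RRe_real ?normr_real. Qed.

Lemma rnorm_ge0 x : 0 <= rnorm x.
Proof. by rewrite -ler0c -normE. Qed.

Lemma rnorm0 : rnorm (0 : V) = 0.
Proof. by rewrite /rnorm normr0. Qed.

Lemma rnorm_eq0 x : rnorm x = 0 -> x = 0.
Proof. by move=> x0; apply/eqP; rewrite -normr_eq0 normE x0. Qed.

Lemma rnormN x : rnorm (- x) = rnorm x.
Proof. by rewrite /rnorm normrN. Qed.

Lemma rnormBC x y : rnorm (x - y) = rnorm (y - x).
Proof. by rewrite /rnorm distrC. Qed.

Lemma rnormD x y : rnorm (x + y) <= rnorm x + rnorm y.
Proof. by rewrite -lecR rmorphD /= -!normE; exact: ler_normD. Qed.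

Lemma rnormB x y : rnorm (x - y) <= rnorm x + rnorm y.
Proof. by rewrite -(rnormN y) rnormD. Qed.

Lemma rnorm_tri (z x y : V) : rnorm (x - y) <= rnorm (x - z) + rnorm (z - y).
Proof. by rewrite (_ : x - y = (x - z) + (z - y)) ?rnormD// addrA subrK. Qed.

Lemma rnorm_dist x y : `|rnorm x - rnorm y| <= rnorm (x - y).
Proof.
rewrite ler_norml lerNl opprB !lerBlDr; apply/andP; split.
  by rewrite rnormBC -{1}(subrK x y) rnormD.
by rewrite -{1}(subrK y x) rnormD.
Qed.

Lemma rnorm_sum (I : Type) (s : seq I) (F : I -> V) :
  rnorm (\sum_(i <- s) F i) <= \sum_(i <- s) rnorm (F i).
Proof.
elim: s => [|i s IH]; first by rewrite !big_nil rnorm0.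
by rewrite !big_cons (le_trans (rnormD _ _))// lerD2l.
Qed.

Lemma rnorm_eps x : (forall e, 0 < e -> rnorm x <= e) -> x = 0.
Proof.
move=> xe; apply: rnorm_eq0; apply/eqP; rewrite eq_le rnorm_ge0 andbT.
by apply/ler_addgt0Pr => e e0; rewrite add0r; exact: xe.
Qed.

End ComplexNorm.

Section ScalarNorm.
Variable R : realType.
Implicit Types z w : R[i].

(* Copies of norm lemmas whose statements mention the ring operations of the
   scalars, so that linear arithmetic recognizes their atoms. *)
Lemma crnormD z w : rnorm (z + w) <= rnorm z + rnorm w.
Proof. exact: rnormD. Qed.

Lemma crnorm_tri (y z w : R[i]) : rnorm (z - w) <= rnorm (z - y) + rnorm (y - w).
Proof. exact: rnorm_tri. Qed.

Lemma crnormBC z w : rnorm (z - w) = rnorm (w - z).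
Proof. exact: rnormBC. Qed.

Lemma rnormM z w : rnorm (z * w) = rnorm z * rnorm w.
Proof. by apply: complexI; rewrite rmorphM /= -!normE normrM. Qed.

Lemma rnormV z : rnorm (z^-1) = (rnorm z)^-1.
Proof.
by apply: complexI; rewrite (@fmorphV R R[i]) /= -!normE normfV.
Qed.

Lemma rnorm1 : rnorm (1 : R[i]) = 1.
Proof. by rewrite /rnorm normr1. Qed.

Lemma rnormX z n : rnorm (z ^+ n) = rnorm z ^+ n.
Proof. by elim: n => [|n IH]; rewrite ?expr0 ?rnorm1// !exprS rnormM IH. Qed.

Lemma rnorm_real (x : R) : rnorm (x%:C) = `|x|.
Proof. by rewrite /rnorm normc_def /= expr0n /= addr0 sqrtr_sqr. Qed.

Lemma rnorm_conj z : rnorm (Num.conj z) = rnorm z.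
Proof. by rewrite /rnorm norm_conjC. Qed.

Lemma Re_le_rnorm z : `|complex.Re z| <= rnorm z.
Proof. by rewrite -lecR -normE normc_ge_Re. Qed.

Lemma Im_le_rnorm z : `|complex.Im z| <= rnorm z.
Proof.
rewrite /rnorm normc_def /= -sqrtr_sqr ler_sqrt ?lerDr ?sqr_ge0//.
by rewrite addr_ge0 ?sqr_ge0.
Qed.

Lemma mul_conj z : z * Num.conj z = ((rnorm z) ^+ 2)%:C.
Proof. by rewrite -normCK normE rmorphXn. Qed.

Lemma rnorm_gt0 z : z != 0 -> 0 < rnorm z.
Proof.
by move=> z0; rewrite lt_def rnorm_ge0 andbT; apply: contraNneq z0 => /rnorm_eq0 ->.
Qed.

End ScalarNorm.

Section NormLimits.
Variables (R : realType) (V : normedModType R[i]).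
Implicit Types x y : V.

Lemma rnormZ (a : R[i]) x : rnorm (a *: x) = rnorm a * rnorm x.
Proof.
by apply: complexI; rewrite rmorphM /= -normE normrZ !normE.
Qed.

Lemma cvg_rnorm (T : Type) (F : set_system T) {FF : Filter F} (f : T -> V) (l : V) :
  f @ F --> l <-> (forall e : R, 0 < e -> \forall t \near F, rnorm (l - f t) < e).
Proof.
split.
  move=> /cvgrPdist_lt fl e e0; have /fl : 0 < e%:C by rewrite ltcR.
  by apply: filterS => t; rewrite normE ltcR.
move=> fl; apply/cvgrPdist_lt => e e0.
have ee : e = (complex.Re e)%:C by rewrite RRe_real ?gtr0_real.
have /fl : 0 < complex.Re e by rewrite -ltcR -ee.
by apply: filterS => t; rewrite normE -ltcR -ee.
Qed.

Lemma cvg_uniq (T : Type) (F : set_system T) {FF : ProperFilter F} (f : T -> V)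
  (l l' : V) : f @ F --> l -> f @ F --> l' -> l = l'.
Proof. by move=> fl fl'; apply: (cvg_unique _ fl fl'); exact: norm_hausdorff. Qed.

Lemma cvg_rnorm_le (T : Type) (F : set_system T) {FF : ProperFilter F} (f : T -> V)
  (l : V) (c : R) : f @ F --> l -> (\forall t \near F, rnorm (f t) <= c) ->
  rnorm l <= c.
Proof.
move=> /cvg_rnorm fl fc; apply/ler_addgt0Pr => e e0.
have [t [/ltW lt tc]] := filter_ex (filterI (fl e e0) fc).
rewrite -(subrK (f t) l) (le_trans (rnormD _ _))// addrC.
exact: lerD.
Qed.

End NormLimits.

(** * Bounded operators *)

Section Bounded.
Variables (R : realType) (V W : normedModType R[i]).
Implicit Types T : V -> W.

Definition opbound T (M : R) := forall x, rnorm (T x) <= M * rnorm x.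

Section Linear.
Variable T : V -> W.
Hypothesis lT : linear T.

Lemma linD x y : T (x + y) = T x + T y.
Proof. by have := lT 1 x y; rewrite !scale1r. Qed.

Lemma lin0 : T 0 = 0.
Proof. by have := linD 0 0; rewrite addr0 => /eqP; rewrite addrC -subr_eq subrr => /eqP. Qed.

Lemma linZ a x : T (a *: x) = a *: T x.
Proof. by have := lT a x 0; rewrite !addr0 lin0 addr0. Qed.

Lemma linN x : T (- x) = - T x.
Proof. by rewrite -scaleN1r linZ scaleN1r. Qed.

Lemma linB x y : T (x - y) = T x - T y.
Proof. by rewrite linD linN. Qed.

Lemma lin_sum (I : Type) (s : seq I) (F : I -> V) (P : pred I) :
  T (\sum_(i <- s | P i) F i) = \sum_(i <- s | P i) T (F i).
Proof.
elim: s => [|i s IH]; first by rewrite !big_nil lin0.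
by rewrite !big_cons; case: ifP => _; rewrite ?linD IH.
Qed.

Lemma opbound_cvg (M : R) (hM : opbound T M) (I : Type) (F : set_system I)
  {FF : Filter F} (f : I -> V) l : f @ F --> l -> (T \o f) @ F --> T l.
Proof.
move=> /cvg_rnorm fl; apply/cvg_rnorm => e e0.
have M1 : 0 < `|M| + 1 by rewrite ltr_wpDl.
have /fl : 0 < e / (`|M| + 1) by rewrite divr_gt0.
apply: filterS => t; rewrite ltr_pdivlMr// => lt.
rewrite /= -linB (le_lt_trans (hM _))// (le_lt_trans _ lt)// mulrC.
by rewrite ler_wpM2l ?rnorm_ge0// (le_trans (ler_norm _))// lerDl.
Qed.

End Linear.

Lemma opbound_lip T : linear T -> continuous T -> exists2 M : R, 0 <= M & opbound T M.
Proof.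
move=> lT cT; have /cvg_rnorm/(_ 1 ltr01) := cT (0 : V).
rewrite (lin0 lT) => /(@nbhs_ballP R[i])[e /= e0 be].
have ee : e = (complex.Re e)%:C by rewrite RRe_real ?gtr0_real.
have e0' : 0 < complex.Re e by rewrite -ltcR -ee.
set r := complex.Re e in ee e0'.
exists (2 / r) => [|x]; first by rewrite divr_ge0 ?ltW.
have [->|x0] := eqVneq x 0; first by rewrite (lin0 lT) !rnorm0 mulr0.
have nx : 0 < rnorm x.
  by rewrite lt_def rnorm_ge0 andbT; apply: contraNneq x0 => /rnorm_eq0 ->.
pose a : R := r / 2 / rnorm x.
have a0 : 0 < a by rewrite /a !divr_gt0.
have := be (a%:C *: x); rewrite -ball_normE /= sub0r normrN normE rnormZ rnorm_real.
rewrite ee ltcR gtr0_norm// {1}/a divfK ?gt_eqF//.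
rewrite gtr_pMr// invf_lt1// ltr1n => /(_ isT).
rewrite sub0r rnormN (linZ lT) rnormZ rnorm_real gtr0_norm// => /ltW.
rewrite mulrC -ler_pdivlMr// mul1r /a => h; apply: (le_trans h).
by rewrite !invfM !invrK mulrC [r^-1 * _]mulrC mulrC.
Qed.

Lemma opbound_continuous T (M : R) : linear T -> opbound T M -> continuous T.
Proof.
move=> lT hM x; exact: (@opbound_cvg T lT M hM V (nbhs x) _ id x).
Qed.

End Bounded.

Section BoundedOp.
Variables (R : realType) (H : normedModType R[i]).
Implicit Types T : H -> H.

Lemma bounded_opP T :
  bounded_op T <-> (linear T /\ exists2 M : R, 0 <= M & opbound T M).
Proof.
split=> [[lT cT]|[lT [M _ hM]]]; first by split=> //; exact: opbound_lip.
by split=> //; exact: opbound_continuous hM.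
Qed.

Lemma bounded_op_of T M : linear T -> opbound T M -> bounded_op T.
Proof. by move=> lT hM; split=> //; exact: opbound_continuous hM. Qed.

Lemma bounded_opD T T' : bounded_op T -> bounded_op T' -> bounded_op (T \+ T').
Proof.
move=> /bounded_opP[lT [M _ hM]] /bounded_opP[lT' [M' _ hM']].
apply: (@bounded_op_of _ (M + M')) => [a x y|x] /=.
  by rewrite (linD lT) (linZ lT) (linD lT') (linZ lT') scalerDr addrACA.
by rewrite (le_trans (rnormD _ _))// mulrDl lerD.
Qed.

Lemma bounded_opZ T a : bounded_op T -> bounded_op (fun x => a *: T x).
Proof.
move=> /bounded_opP[lT [M _ hM]].
apply: (@bounded_op_of _ (rnorm a * M)) => [b x y|x] /=.
  by rewrite (linD lT) (linZ lT) scalerDr !scalerA mulrC.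
by rewrite rnormZ -mulrA ler_wpM2l ?rnorm_ge0.
Qed.

Lemma bounded_opB T T' : bounded_op T -> bounded_op T' -> bounded_op (T \- T').
Proof.
move=> bT /(bounded_opZ (-1)) /(bounded_opD bT).
by congr bounded_op; apply/funext => x /=; rewrite scaleN1r.
Qed.

Lemma bounded_op_comp T T' : bounded_op T -> bounded_op T' -> bounded_op (T \o T').
Proof.
move=> /bounded_opP[lT [M M0 hM]] /bounded_opP[lT' [M' _ hM']].
apply: (@bounded_op_of _ (M * M')) => [b x y|x] /=.
  by rewrite (linD lT') (linZ lT') (linD lT) (linZ lT).
by rewrite (le_trans (hM _))// -mulrA ler_wpM2l.
Qed.

Lemma bounded_op_id : bounded_op (idfun : H -> H).
Proof. by apply: (@bounded_op_of _ 1) => [//|x]; rewrite mul1r. Qed.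

Lemma bounded_op0 : bounded_op ((fun=> 0) : H -> H).
Proof.
apply: (@bounded_op_of _ 0) => [a x y|x]; first by rewrite scaler0 addr0.
by rewrite rnorm0 mul0r.
Qed.

End BoundedOp.

(** * Complete spaces: Cauchy families and Neumann series *)

Section Complete.
Variables (R : realType) (V : completeNormedModType R[i]).

Lemma cauchy_rnorm (T : Type) (F : set_system T) {FF : ProperFilter F} (f : T -> V) :
  (forall e : R, 0 < e -> exists y, \forall t \near F, rnorm (y - f t) < e) ->
  exists l : V, f @ F --> l.
Proof.
move=> fF; suff : cvg (f @ F) by move=> cf; exists (lim (f @ F)).
apply/cauchy_cvgP/cauchy_exP => e e0.
have ee : e = (complex.Re e)%:C by rewrite RRe_real ?gtr0_real.
have e0' : 0 < complex.Re e by rewrite -ltcR -ee.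
have [y fy] := fF _ e0'; exists y; apply: filterS fy => t.
by rewrite -ball_normE /= normE ee ltcR.
Qed.

Lemma geometric_cvg (u : nat -> V) (c k : R) : 0 <= c -> 0 <= k < 1 ->
  (forall n, rnorm (u n.+1 - u n) <= c * k ^+ n) ->
  exists l : V, u @ \oo --> l /\ forall n, rnorm (l - u n) <= c * k ^+ n / (1 - k).
Proof.
move=> c0 /andP[k0 k1] uk.
have k1' : 0 < 1 - k by rewrite subr_gt0.
have tail n m : rnorm (u (n + m)%N - u n) <= c * k ^+ n / (1 - k).
  have : rnorm (u (n + m)%N - u n) <= c * k ^+ n * (1 - k ^+ m) / (1 - k).
    elim: m => [|m IH].
      by rewrite addn0 subrr rnorm0 expr0 subrr mulr0 mul0r.
    rewrite addnS (le_trans (rnorm_tri (u (n + m)%N) _ _))//.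
    rewrite (le_trans (lerD (uk _) IH))// exprD exprS.
    rewrite -(ler_pM2r k1') mulrDl !divfK ?gt_eqF//.
    by rewrite le_eqVlt; apply/orP; left; apply/eqP; ring.
  move=> h; apply: (le_trans h); rewrite ler_pM2r ?invr_gt0//.
  by rewrite ler_piMr ?mulr_ge0 ?exprn_ge0// gerBl exprn_ge0.
have small e : 0 < e -> exists N, c * k ^+ N / (1 - k) < e.
  move=> e0.
  have : (fun n => c / (1 - k) * k ^+ n) @ \oo --> (c / (1 - k) * 0).
    apply: cvgMr; apply: cvg_expr.
    by rewrite ger0_norm.
  rewrite mulr0 => /cvgrPdist_lt/(_ e e0)[N _ /(_ N (leqnn _))] /=.
  rewrite sub0r normrN ger0_norm; last first.
    by rewrite mulr_ge0 ?exprn_ge0// divr_ge0// ltW.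
  by move=> h; exists N; rewrite mulrAC.
have [l ul] : exists l : V, u @ \oo --> l.
  apply: cauchy_rnorm => e /small[N hN]; exists (u N).
  exists N => // m /= Nm; rewrite rnormBC -(subnKC Nm).
  exact: le_lt_trans (tail _ _) hN.
exists l; split=> // n; rewrite rnormBC.
have hl : (fun m => u n - u m) @ \oo --> u n - l by apply: cvgB => //; exact: cvg_cst.
apply: (@cvg_rnorm_le _ _ _ \oo _ _ _ _ hl); exists n => // m /= nm.
by rewrite rnormBC -(subnKC nm).
Qed.

(** The solution of [x + T x = y] is the limit of the iteration [x := y - T x],
    whose steps shrink by the factor [q]; it is unique and bounded because
    [(1 - q) |x| <= |x + T x|]. *)
Lemma neumann (T : V -> V) (q : R) : linear T -> opbound T q -> 0 <= q < 1 ->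
  exists W', inverse_op (idfun \+ T) W'.
Proof.
move=> lT hT q01; have /andP[q0 q1] := q01; have q1' : 0 < 1 - q by rewrite subr_gt0.
have sol y : exists x, x + T x = y.
  pose u n := iter n (fun x => y - T x) 0.
  have uk n : rnorm (u n.+1 - u n) <= rnorm y * q ^+ n.
    elim: n => [|n IH]; first by rewrite /= (lin0 lT) !subr0 expr0 mulr1.
    have -> : u n.+2 - u n.+1 = - T (u n.+1 - u n).
      rewrite (linB lT) [RHS]opprB.
      have e (a b : V) : (y - a) - (y - b) = b - a by rewrite opprB addrC addrA subrK.
      exact: (e (T (u n.+1)) (T (u n))).
    by rewrite rnormN (le_trans (hT _))// exprS mulrCA ler_wpM2l.
  have [l [ul _]] := geometric_cvg (rnorm_ge0 y) q01 uk.
  exists l; apply/eqP; rewrite -subr_eq0; apply/eqP.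
  apply: (@cvg_uniq _ _ _ (\oo) _ (fun n => u n.+1 + T (u n) - y)); last first.
    rewrite (_ : (fun n => _) = fun=> 0); first exact: cvg_cst.
    by apply/funext => n; rewrite /= subrK subrr.
  apply: cvgB; last exact: cvg_cst.
  apply: cvgD; first by rewrite (cvg_shiftS u).
  exact: (opbound_cvg lT hT).
have coer x : (1 - q) * rnorm x <= rnorm (x + T x).
  have := rnormB (x + T x) (T x); rewrite addrK mulrBl mul1r lerBlDr => h.
  by rewrite (le_trans h)// lerD2l.
have inj x y : x + T x = y + T y -> x = y.
  move=> /eqP; rewrite -subr_eq0 opprD addrACA -(linB lT) => /eqP xy.
  apply/eqP; rewrite -subr_eq0; apply/eqP/rnorm_eq0/eqP.
  have := coer (x - y); rewrite xy rnorm0 eq_le rnorm_ge0 andbT.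
  by rewrite pmulr_rle0.
have [W' hW'] := choice sol.
exists W'; split.
- apply: (@bounded_op_of _ _ _ (1 - q)^-1) => [a x y|x].
    apply: inj; rewrite hW' (linD lT) (linZ lT) addrACA -scalerDr.
    by rewrite !hW'.
  by rewrite mulrC ler_pdivlMr// mulrC -{2}(hW' x).
- by move=> x; apply: inj; rewrite hW'.
- by move=> y; rewrite /= hW'.
Qed.

End Complete.

(** * Inner products *)

Section Dot.
Variables (R : realType) (H : normedModType R[i]) (dot : {dot H for (@Num.conj R[i])}).
Hypothesis dotP : norm_from_dot dot.
Implicit Types x y z : H.

Lemma dotDl x y z : dot (x + y) z = dot x z + dot y z.
Proof. exact: linearDl. Qed.
Lemma dotDr x y z : dot x (y + z) = dot x y + dot x z.
Proof. exact: linearDr. Qed.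
Lemma dotZl (a : R[i]) x y : dot (a *: x) y = a * dot x y.
Proof. exact: linearZl_LR. Qed.
Lemma dotZr (a : R[i]) x y : dot x (a *: y) = Num.conj a * dot x y.
Proof. exact: linearZr_LR. Qed.
Lemma dot0l x : dot 0 x = 0.
Proof. exact: linear0l. Qed.
Lemma dot0r x : dot x 0 = 0.
Proof. exact: linear0r. Qed.
Lemma dotNr x y : dot x (- y) = - dot x y.
Proof. exact: linearNr. Qed.
Lemma dotBl x y z : dot (x - y) z = dot x z - dot y z.
Proof. exact: linearBl. Qed.
Lemma dot_conj x y : dot x y = Num.conj (dot y x).
Proof. by rewrite {1}(hermC dot) expr0 mul1r. Qed.

Lemma dot_suml (I : Type) (s : seq I) (P : pred I) (F : I -> H) y :
  dot (\sum_(i <- s | P i) F i) y = \sum_(i <- s | P i) dot (F i) y.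
Proof.
elim: s => [|i s IH]; first by rewrite !big_nil dot0l.
by rewrite !big_cons; case: ifP => _; rewrite ?dotDl IH.
Qed.

Lemma dot_sumr (I : Type) (s : seq I) (P : pred I) (F : I -> H) y :
  dot y (\sum_(i <- s | P i) F i) = \sum_(i <- s | P i) dot y (F i).
Proof.
elim: s => [|i s IH]; first by rewrite !big_nil dot0r.
by rewrite !big_cons; case: ifP => _; rewrite ?dotDr IH.
Qed.

Lemma dotxx x : dot x x = (rnorm x ^+ 2)%:C.
Proof. by rewrite -dotP normE rmorphXn. Qed.

Lemma rnorm2E x : rnorm x ^+ 2 = complex.Re (dot x x).
Proof. by rewrite dotxx. Qed.

Lemma rnorm2D x y :
  rnorm (x + y) ^+ 2 = rnorm x ^+ 2 + rnorm y ^+ 2 + 2 * complex.Re (dot x y).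
Proof.
rewrite !rnorm2E dotDl !dotDr !ReD (dot_conj y x) Re_conj; ring.
Qed.

Lemma rnorm2B x y :
  rnorm (x - y) ^+ 2 = rnorm x ^+ 2 + rnorm y ^+ 2 - 2 * complex.Re (dot x y).
Proof. by rewrite rnorm2D rnormN dotNr ReN mulrN. Qed.

Lemma pythagoras x y : dot x y = 0 -> rnorm (x + y) ^+ 2 = rnorm x ^+ 2 + rnorm y ^+ 2.
Proof. by rewrite rnorm2D => -> /=; rewrite mulr0 addr0. Qed.

Lemma cauchy_schwarz x y : rnorm (dot x y) <= rnorm x * rnorm y.
Proof.
have [->|y0] := eqVneq y 0; first by rewrite dot0r !rnorm0 mulr0.
have ny : 0 < rnorm y.
  by rewrite lt_def rnorm_ge0 andbT; apply: contraNneq y0 => /rnorm_eq0 ->.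
set a := dot x y; pose t : R := (rnorm y ^+ 2)^-1.
have := sqr_ge0 (rnorm (x - (t%:C * a) *: y)).
have tE : Num.conj (t%:C * a) * a = (t * rnorm a ^+ 2)%:C.
  by rewrite rmorphM /= -[LHS]mulrA (mulrC _ a) mul_conj conj_conjc conjc_real realCM.
rewrite rnorm2B dotZr rnormZ rnormM rnorm_real -/a tE /=.
have t0 : 0 < t by rewrite invr_gt0 exprn_gt0.
rewrite gtr0_norm// => h.
rewrite -(ler_pXn2r (_ : (0 < 2)%N)) ?nnegrE ?mulr_ge0 ?rnorm_ge0//.
rewrite exprMn -(ler_pM2l t0).
have ty : t * rnorm y ^+ 2 = 1 by rewrite /t mulVf// gt_eqF// exprn_gt0.
have e1 : (t * rnorm a * rnorm y) ^+ 2 = t * rnorm a ^+ 2.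
  by rewrite !exprMn -mulrA mulrC -mulrA [_ * t ^+ 2]mulrC expr2 -[t * t * _]mulrA ty; ring.
rewrite e1 in h.
rewrite (_ : t * (rnorm x ^+ 2 * rnorm y ^+ 2) = rnorm x ^+ 2); last first.
  by rewrite mulrCA ty mulr1.
by lra.
Qed.

Lemma dot_eq x y : (forall z, dot x z = dot y z) -> x = y.
Proof.
move=> xy; apply/eqP; rewrite -subr_eq0; apply/eqP/rnorm_eq0.
apply/eqP; rewrite -sqrf_eq0; apply/eqP.
by rewrite rnorm2E dotBl xy subrr.
Qed.

Lemma dot_opbound y : opbound ((fun x => dot x y) : H -> R[i]^o) (rnorm y).
Proof. by move=> x; rewrite mulrC; exact: cauchy_schwarz. Qed.

Lemma dot_linear y : linear ((fun x => dot x y) : H -> R[i]^o).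
Proof. by move=> a u v; rewrite dotDl dotZl. Qed.

End Dot.

(** * Sums of nonnegative families *)

Section Esum.
Variable R : realType.

Lemma psumE (I : choiceType) (V : zmodType) (v : I -> V) (F : {fset I}) :
  summability.partial_sum v F = \sum_(i <- F) v i.
Proof. by rewrite /summability.partial_sum big_seq_fsetE. Qed.

Lemma fset_sum_single (I : choiceType) (V : nmodType) (F : {fset I}) (Q : pred I) (j : I) (v : V) :
  Q j -> \sum_(i <- F | Q i) (if i == j then v else 0) = if j \in F then v else 0.
Proof.
move=> Qj; rewrite -big_mkcondr /=.
rewrite (eq_bigl (pred1 j)); last by move=> i /=; case: eqP => [->|]; rewrite ?Qj ?andbF.
case: ifPn => jF; first by rewrite -big_filter filter_pred1_uniq ?big_seq1.
rewrite big_seq_cond big_pred0// => i; apply/negbTE.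
by apply: contra jF => /andP[iF /eqP <-].
Qed.

Lemma esum_leP (I : choiceType) (J : set I) (a : I -> R) (c : R) :
  (\esum_(i in J) (a i)%:E <= c%:E)%E <->
  (forall F : {fset I}, [set` F] `<=` J -> \sum_(i <- F) a i <= c).
Proof.
split=> [h F FJ|h].
  rewrite -lee_fin (le_trans _ h)//; apply: esum_ge.
  exists [set` F]; first by split.
  by rewrite fsbig_finite//= set_fsetK sumEFin.
apply: ge_ereal_sup => _ /= [A [fA AJ] <-].
rewrite fsbig_finite//= sumEFin lee_fin; apply: h => i /=.
by rewrite in_fset_set// inE; exact: AJ.
Qed.

Lemma esum_swap (I K : choiceType) (A : set I) (B : set K) (a : I -> K -> \bar R) :
  (forall i k, 0 <= a i k)%E ->
  \esum_(i in A) \esum_(k in B) a i k = \esum_(k in B) \esum_(i in A) a i k.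
Proof.
move=> a0; rewrite !esum_esum//.
rewrite [RHS](@reindex_esum R _ _ (A `*`` fun=> B) _ (fun p => (p.2, p.1)))//.
split=> [[i k] [/= Ai Bk] //|[i k] [j l] _ _ [-> ->] //|[k i] [/= Bk Ai]].
by exists (i, k).
Qed.

Lemma esumZ_le (I : choiceType) (J : set I) (a : I -> \bar R) (c : R) :
  0 <= c -> (forall i, 0 <= a i)%E ->
  (\esum_(i in J) (c%:E * a i) <= c%:E * \esum_(i in J) a i)%E.
Proof.
move=> c0 a0; apply: ge_ereal_sup => _ /= [A [fA AJ] <-].
rewrite -ge0_mule_fsumr//; apply: lee_wpmul2l; first by rewrite lee_fin.
by apply: esum_ge; exists A.
Qed.

Lemma esumZ (I : choiceType) (J : set I) (a : I -> \bar R) (c : R) :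
  0 <= c -> (forall i, 0 <= a i)%E ->
  (\esum_(i in J) (c%:E * a i) = c%:E * \esum_(i in J) a i)%E.
Proof.
move=> c0 a0; apply/eqP; rewrite eq_le esumZ_le//=.
have [->|cn0] := eqVneq c 0; first by rewrite mul0e esum_ge0// => i _; rewrite mul0e.
have cp : 0 < c by rewrite lt_def cn0.
have ci : 0 <= c^-1 by rewrite invr_ge0.
have ca0 i : (0 <= c%:E * a i)%E by rewrite mule_ge0// lee_fin.
have := lee_wpmul2l (_ : 0 <= c%:E)%E (esumZ_le J ci ca0); rewrite lee_fin => /(_ c0).
rewrite [leRHS]muleA -EFinM divff// mul1e.
by under eq_esum do rewrite muleA -EFinM mulVf// mul1e.
Qed.

Lemma esum_fin (I : choiceType) (J : set I) (a : I -> R) :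
  (forall i, 0 <= a i) -> (\esum_(i in J) (a i)%:E < +oo)%E ->
  exists2 c : R, 0 <= c & \esum_(i in J) (a i)%:E = c%:E.
Proof.
move=> a0 h; have e0 : (0 <= \esum_(i in J) (a i)%:E)%E.
  by apply: esum_ge0 => i _; rewrite lee_fin.
exists (fine (\esum_(i in J) (a i)%:E)); first exact: fine_ge0.
by rewrite fineK// ge0_fin_numE.
Qed.

(** A finite set whose sum is within [e] of the total leaves less than [e] for
    the indices outside it. *)
Lemma esum_tail (I : choiceType) (a : I -> R) (e : R) :
  (forall i, 0 <= a i) -> (\esum_(i in setT) (a i)%:E < +oo)%E -> 0 < e ->
  exists F0 : {fset I}, forall G : {fset I}, [disjoint F0 & G]%fset ->
    \sum_(i <- G) a i < e.
Proof.
move=> a0 h e0; have [c c0 hc] := esum_fin a0 h.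
have [|_ [A [fA _] <-]] := @ub_ereal_sup_adherent R
   [set (\sum_(i \in A) (a i)%:E)%R | A in fsets setT] e e0.
  by have : \esum_(i in setT) (a i)%:E \is a fin_num by rewrite hc.
rewrite [ereal_sup _]hc fsbig_finite//= sumEFin -EFinB lte_fin => hA.
exists (fset_set A) => G dG.
have /esum_leP/(_ (fset_set A `|` G)%fset (fun _ _ => Logic.I)) :
  (\esum_(i in setT) (a i)%:E <= c%:E)%E by rewrite hc.
rewrite (big_fsetID _ (mem (fset_set A))) /=.
rewrite (_ : [fset x in fset_set A `|` G | x \in fset_set A]%fset = fset_set A); last first.
  by apply/fsetP => x; rewrite !inE; case: (x \in fset_set A); rewrite ?andbF.
rewrite (_ : [fset x in fset_set A `|` G | x \notin fset_set A]%fset = G); last first.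
  apply/fsetP => x; rewrite !inE; case: (boolP (x \in fset_set A)) => xA /=.
    by apply/esym/negbTE; exact: (fdisjointP dG).
  by rewrite ?andbT.
by move=> h'; move: hA; set s := \sum_(i <- fset_set A) a i in h' *; lra.
Qed.

Lemma esum_cofinite (I : choiceType) (a : I -> R) (e : R) :
  (forall i, 0 <= a i) -> (\esum_(i in setT) (a i)%:E < +oo)%E -> 0 < e ->
  exists F0 : {fset I}, forall F : {fset I}, (F0 `<=` F)%fset ->
    (\esum_(i in setT) (if i \in F then 0 else a i)%:E <= e%:E)%E.
Proof.
move=> a0 fa e0; have [F0 hF0] := esum_tail a0 fa e0; exists F0 => F F0F.
apply/esum_leP => G _; rewrite (big_fsetID _ (mem F)) /= big_seq big1 => [|i]; last first.
  by rewrite !inE /= => /andP[_ ->].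
rewrite add0r ltW//; apply: le_lt_trans (hF0 [fset x in G | x \notin F]%fset _).
  by apply: ler_sum => i _; case: ifP.
by apply/fdisjointP => x xF0; rewrite !inE /= negb_and negbK (fsubsetP F0F)// orbT.
Qed.

End Esum.

(** * Unconditional sums of orthogonal families *)

Section Totally.
Variable I : choiceType.

Lemma near_totally (P : set {fset I}) :
  (exists F0 : {fset I}, forall F : {fset I}, (F0 `<=` F)%fset -> P F) ->
  \forall F \near @summability.totally I, P F.
Proof. by move=> [F0 h]; exists F0. Qed.

#[local] Existing Instance summability.totally_filter.

Variable R : realType.

Lemma psum_lin (V W : normedModType R[i]) (v : I -> V) (y : V) (T : V -> W) (M : R) :
  linear T -> opbound T M ->
  summability.partial_sum v @ summability.totally --> y ->
  summability.partial_sum (fun i => T (v i)) @ summability.totally --> T y.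
Proof.
move=> lT hT vy.
have -> : summability.partial_sum (fun i => T (v i)) = T \o summability.partial_sum v.
  by apply/funext => F; rewrite /= !psumE lin_sum.
exact: (opbound_cvg lT hT).
Qed.

Lemma psum_uniq (V : normedModType R[i]) (v : I -> V) (y z : V) :
  summability.partial_sum v @ summability.totally --> y ->
  summability.partial_sum v @ summability.totally --> z -> y = z.
Proof. exact: cvg_uniq. Qed.

Lemma psum_sum (V : normedModType R[i]) (v : I -> V) (y : V) :
  summability.partial_sum v @ summability.totally --> y -> summability.sum v = y.
Proof. by move=> h; apply/(@cvg_uniq _ _ _ _ _ _ _ _ _ h)/(cvgP y). Qed.

Lemma psum_single (V : normedModType R[i]) (v : I -> V) (j : I) :
  (forall i, i != j -> v i = 0) ->
  summability.partial_sum v @ summability.totally --> v j.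
Proof.
move=> vj; apply/cvg_rnorm => e e0; apply: near_totally; exists [fset j]%fset => F.
rewrite fsub1set => jF; rewrite psumE (big_fsetD1 j)//= big_seq big1 ?addr0 ?subrr ?rnorm0//.
by move=> i; rewrite !inE => /andP[/vj].
Qed.

End Totally.
#[export] Existing Instance summability.totally_filter.

Section Orthogonal.
Variables (R : realType) (H : completeNormedModType R[i]) (dot : {dot H for (@Num.conj R[i])}).
Hypothesis dotP : norm_from_dot dot.
Variables (I : choiceType).
Implicit Types v w : I -> H.

Lemma psum_dot v y z :
  summability.partial_sum v @ summability.totally --> y ->
  summability.partial_sum (fun i => dot (v i) z : R[i]^o) @ summability.totally
    --> (dot y z : R[i]^o).
Proof. exact: (psum_lin (@dot_linear _ _ dot z) (@dot_opbound _ _ dot dotP z)). Qed.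

Lemma orth_sum_norm v (s : seq I) : (forall i j, i != j -> dot (v i) (v j) = 0) ->
  uniq s -> rnorm (\sum_(i <- s) v i) ^+ 2 = \sum_(i <- s) rnorm (v i) ^+ 2.
Proof.
move=> vo; elim: s => [|i s IH] /=; first by rewrite !big_nil rnorm0 expr0n.
move=> /andP[ins us]; rewrite !big_cons (pythagoras dotP)// ?IH//.
rewrite dot_sumr big_seq big1// => j js; apply: vo.
by apply: contraNneq ins => ->.
Qed.

(** Two finite sums over sets containing [F0] differ by sums over sets disjoint
    from [F0], so a summable majorant of the squared norms suffices. *)
Lemma psum_cauchy v (a : I -> R) : (forall i, 0 <= a i) ->
  (\esum_(i in setT) (a i)%:E < +oo)%E ->
  (forall F : {fset I}, rnorm (\sum_(i <- F) v i) ^+ 2 <= \sum_(i <- F) a i) ->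
  exists y : H, summability.partial_sum v @ summability.totally --> y.
Proof.
move=> a0 fa va; apply: cauchy_rnorm => e e0.
have [F0 hF0] := esum_tail a0 fa (exprn_gt0 2 e0).
exists (\sum_(i <- F0) v i); apply: near_totally; exists F0 => F F0F.
rewrite psumE rnormBC -(ltr_pXn2r (_ : (0 < 2)%N)) ?nnegrE ?rnorm_ge0 ?ltW//.
rewrite [X in rnorm (X - _)](big_fsetID _ (mem F0)) /=.
rewrite (_ : [fset x in F | x \in F0]%fset = F0); last first.
  apply/fsetP => x; rewrite !inE /=; case: (boolP (x \in F0)); rewrite ?andbF//.
  by move=> /(fsubsetP F0F) ->.
rewrite addrAC subrr add0r (le_lt_trans (va _))//; apply: hF0.
by apply/fdisjointP => x xF0; rewrite !inE /= negb_and negbK xF0 orbT.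
Qed.

Lemma orth_summable v : (forall i j, i != j -> dot (v i) (v j) = 0) ->
  (\esum_(i in setT) (rnorm (v i) ^+ 2)%:E < +oo)%E ->
  exists y : H, summability.partial_sum v @ summability.totally --> y.
Proof.
move=> vo fv; apply: (psum_cauchy (fun i => sqr_ge0 (rnorm (v i))) fv) => F.
by rewrite orth_sum_norm.
Qed.

Lemma orth_parseval v y : (forall i j, i != j -> dot (v i) (v j) = 0) ->
  summability.partial_sum v @ summability.totally --> y ->
  \esum_(i in setT) (rnorm (v i) ^+ 2)%:E = (rnorm y ^+ 2)%:E.
Proof.
move=> vo vy.
have ub : (\esum_(i in setT) (rnorm (v i) ^+ 2)%:E <= (rnorm y ^+ 2)%:E)%E.
  apply/esum_leP => F _; rewrite -orth_sum_norm//.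
  rewrite ler_pXn2r ?nnegrE ?rnorm_ge0//; apply/ler_addgt0Pr => e e0.
  have /cvg_rnorm/(_ e e0)[G _ /(_ (F `|` G)%fset (fsubsetUr _ _))] := vy.
  rewrite /= psumE => h; apply: (@le_trans _ _ (rnorm (\sum_(i <- (F `|` G)%fset) v i))).
    rewrite -(ler_pXn2r (_ : (0 < 2)%N)) ?nnegrE ?rnorm_ge0//.
    rewrite !orth_sum_norm// [leRHS](big_fsetID _ (mem F)) /=.
    rewrite (_ : [fset x in F `|` G | x \in F]%fset = F).
      by rewrite lerDl sumr_ge0// => i _; exact: sqr_ge0.
    by apply/fsetP => x; rewrite !inE /=; case: (x \in F); rewrite ?andbF.
  rewrite -[X in rnorm X](subrK y) (le_trans (rnormD _ _))// addrC lerD2l.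
  by rewrite rnormBC ltW.
have [c c0 hc] := esum_fin (fun i => sqr_ge0 (rnorm (v i))) (le_lt_trans ub (ltry _)).
apply/eqP; rewrite eq_le ub /= hc lee_fin.
have /esum_leP hF : (\esum_(i in setT) (rnorm (v i) ^+ 2)%:E <= c%:E)%E by rewrite hc.
rewrite -[c]sqr_sqrtr// ler_pXn2r ?nnegrE ?rnorm_ge0 ?sqrtr_ge0//.
apply: (cvg_rnorm_le vy); apply: near_totally; exists fset0 => F _.
rewrite psumE -(ler_pXn2r (_ : (0 < 2)%N)) ?nnegrE ?rnorm_ge0 ?sqrtr_ge0//.
by rewrite sqr_sqrtr// orth_sum_norm//; exact: hF.
Qed.

End Orthogonal.

(** * Orthonormal bases and Hilbert--Schmidt operators *)

Section HilbertSchmidt.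
Variables (R : realType) (H : completeNormedModType R[i]) (dot : {dot H for (@Num.conj R[i])}).
Hypothesis dotP : norm_from_dot dot.
Implicit Types (S : set H) (x y : H) (T : H -> H).

(** A maximal orthonormal set, by Zorn's lemma; a vector orthogonal to it could
    be normalized and added. *)
Lemma onb_exists : exists S, orthonormal_basis dot S.
Proof.
pose on S := forall x y, S x -> S y -> dot x y = (x == y)%:R.
have [|S [onS maxS]] := @Zorn_bigcup H on.
  move=> F Fon tF x y [S FS Sx] [S' FS' S'y].
  have [SS'|S'S] := tF _ _ FS FS'; first by apply: (Fon _ FS') => //; exact: SS'.
  by apply: (Fon _ FS) => //; exact: S'S.
exists S; split=> // x xS; apply: contrapT => /eqP x0.
have nx : rnorm x != 0 by apply: contraNneq x0 => /rnorm_eq0 ->.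
pose u := ((rnorm x)^-1)%:C *: x.
have u0 e : S e -> dot u e = 0 by move=> /xS xe; rewrite /u dotZl xe mulr0.
have uu : dot u u = 1.
  rewrite (dotxx dotP) /u rnormZ rnorm_real ger0_norm ?invr_ge0 ?rnorm_ge0//.
  by rewrite mulVf// expr1n.
apply: (maxS (S `|` [set u])); first split=> [y|/(_ u (or_intror erefl))/u0]; first by left.
  by rewrite uu; move/eqP; rewrite oner_eq0.
move=> y z [Sy|->] [Sz|->]; [exact: onS| | |by rewrite eqxx uu].
  rewrite dot_conj u0// rmorph0; case: eqP => // yu; exfalso.
  by move: (u0 _ Sy); rewrite yu uu => /eqP; rewrite oner_eq0.
rewrite u0//; case: eqP => // yu; exfalso.
by move: (u0 _ Sz); rewrite -yu uu => /eqP; rewrite oner_eq0.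
Qed.

Section Basis.
Variable S : set H.
Hypothesis onb : orthonormal_basis dot S.

Definition onb_term x e : H := if e \in S then dot x e *: e else 0.

Lemma onb_term_orth x e f : e != f -> dot (onb_term x e) (onb_term x f) = 0.
Proof.
move=> ef; rewrite /onb_term; case: ifPn => eS; last by rewrite dot0l.
case: ifPn => fS; last by rewrite dot0r.
by rewrite dotZl dotZr (onb.1 _ _ (set_mem eS) (set_mem fS)) (negbTE ef) !mulr0.
Qed.

Lemma onb_term_dot x e f : S f -> dot (onb_term x e) f = if e == f then dot x f else 0.
Proof.
move=> Sf; rewrite /onb_term; case: ifPn => eS.
  rewrite dotZl (onb.1 _ _ (set_mem eS) Sf).
  by case: eqP => [->|_]; rewrite ?mulr1 ?mulr0.
rewrite dot0l; case: eqP => // ef; by move: eS; rewrite ef mem_set.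
Qed.

Lemma onb_term_norm x e :
  rnorm (onb_term x e) ^+ 2 = if e \in S then rnorm (dot x e) ^+ 2 else 0.
Proof.
rewrite /onb_term; case: ifPn => eS; last by rewrite rnorm0 expr0n.
rewrite rnormZ exprMn [rnorm e ^+ 2](rnorm2E dotP).
by rewrite (onb.1 _ _ (set_mem eS) (set_mem eS)) eqxx mulr1.
Qed.

Lemma onb_bessel x (F : {fset H}) :
  \sum_(e <- F) rnorm (onb_term x e) ^+ 2 <= rnorm x ^+ 2.
Proof.
pose z := \sum_(e <- F) onb_term x e.
have zz : rnorm z ^+ 2 = \sum_(e <- F) rnorm (onb_term x e) ^+ 2.
  by rewrite (orth_sum_norm dotP)//; exact: onb_term_orth.
have xz : dot x z = (rnorm z ^+ 2)%:C.
  rewrite zz rmorph_sum /z dot_sumr; apply: eq_bigr => e _.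
  rewrite onb_term_norm /onb_term; case: ifPn => eS; last by rewrite dot0r.
  by rewrite dotZr mulrC mul_conj.
have := sqr_ge0 (rnorm (x - z)); rewrite (rnorm2B dotP) xz -zz /=.
by set a := rnorm x ^+ 2; set b := rnorm z ^+ 2; lra.
Qed.

(** The expansion converges by Bessel's inequality, and the difference between
    [x] and its sum is orthogonal to the basis. *)
Lemma onb_expand x : summability.partial_sum (onb_term x) @ summability.totally --> x.
Proof.
have fb : (\esum_(e in setT) (rnorm (onb_term x e) ^+ 2)%:E <= (rnorm x ^+ 2)%:E)%E.
  by apply/esum_leP => F _; exact: onb_bessel.
have [y xy] := orth_summable dotP (@onb_term_orth x) (le_lt_trans fb (ltry _)).
suff E : y = x by move: xy; rewrite E.
apply/esym/eqP; rewrite -subr_eq0; apply/eqP; apply: onb.2 => f Sf; rewrite dotBl; apply/eqP; rewrite subr_eq0; apply/eqP.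
have h1 := psum_dot dotP (z := f) xy.
have := @psum_single _ R R[i]^o (fun e => dot (onb_term x e) f) f.
rewrite [X in _ -> _ --> X]onb_term_dot// eqxx => h2.
apply: (psum_uniq (h2 _) h1) => e ef.
by rewrite onb_term_dot// (negbTE ef).
Qed.

Lemma onb_parseval x :
  \esum_(e in S) (rnorm (dot x e) ^+ 2)%:E = (rnorm x ^+ 2)%:E.
Proof.
rewrite -(orth_parseval dotP (@onb_term_orth x) (@onb_expand x)) esum_mkcond.
by apply: eq_esum => e _; rewrite onb_term_norm; case: ifP.
Qed.

End Basis.

Definition hs_basis : set H := xget set0 (orthonormal_basis dot).

Lemma hs_basis_onb : orthonormal_basis dot hs_basis.
Proof. by have [S hS] := onb_exists; exact: (xgetPex set0 (ex_intro _ S hS)). Qed.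

(** The squared norm is the convenient quantity: being a sum, it can be split and
    rearranged. *)
Definition hs2 T : \bar R := \esum_(e in hs_basis) (rnorm (T e) ^+ 2)%:E.

Lemma hs2_ge0 T : (0 <= hs2 T)%E.
Proof. by apply: esum_ge0 => e _; rewrite lee_fin sqr_ge0. Qed.

Definition has_adj T T' := forall x y, dot (T x) y = dot x (T' y).

Lemma has_adj_sym T T' : has_adj T T' -> has_adj T' T.
Proof. by move=> h x y; rewrite dot_conj -h -dot_conj. Qed.

Lemma adj_linear T T' : has_adj T T' -> linear T'.
Proof.
move=> h a x y; apply: (dot_eq dotP) => z.
by rewrite dotDl dotZl !(has_adj_sym h) dotDl dotZl.
Qed.

Lemma adj_opbound T T' M : has_adj T T' -> opbound T M -> 0 <= M -> opbound T' M.
Proof.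
move=> h hM M0 y; have [->|ny] := eqVneq (T' y) 0.
  by rewrite rnorm0 mulr_ge0 ?rnorm_ge0.
have : 0 < rnorm (T' y).
  by rewrite lt_def rnorm_ge0 andbT; apply: contraNneq ny => /rnorm_eq0 ->.
move=> n0; rewrite -(ler_pM2r n0) -expr2 (rnorm2E dotP) -h.
rewrite (le_trans (ler_norm _))// (le_trans (Re_le_rnorm _))//.
rewrite (le_trans (cauchy_schwarz dotP _ _))// mulrC [leRHS]mulrAC.
by rewrite mulrC ler_wpM2r ?rnorm_ge0.
Qed.

(** Expanding [T e] in the basis and exchanging the sums turns the sum over
    [|T e|^2] into the sum over [|T' e|^2]; this is also why the norm does not
    depend on the basis. *)
Lemma hs2_adj T T' : has_adj T T' -> hs2 T' = hs2 T.
Proof.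
move=> h; rewrite /hs2.
under eq_esum do rewrite -(onb_parseval hs_basis_onb).
rewrite esum_swap; last by move=> e f; rewrite lee_fin sqr_ge0.
apply: eq_esum => f _; rewrite -(onb_parseval hs_basis_onb).
by apply: eq_esum => e _; rewrite (has_adj_sym h) dot_conj rnorm_conj.
Qed.

(** The representing vector of [x |-> <T x, y>] is built from its coefficients
    [<y, T e>], which are square summable since [T] is Hilbert--Schmidt. *)
Lemma hs2_adj_exists T : bounded_op T -> (hs2 T < +oo)%E -> exists T', has_adj T T'.
Proof.
move=> /bounded_opP[lT [M M0 hM]] fT.
have ex y : exists g, forall x, dot (T x) y = dot x g.
  pose v e := if e \in hs_basis then dot y (T e) *: e else 0.
  have vo e f : e != f -> dot (v e) (v f) = 0.
    rewrite /v; case: ifPn => eS; last by rewrite dot0l.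
    case: ifPn => fS; last by rewrite dot0r.
    move=> ef; rewrite dotZl dotZr (hs_basis_onb.1 _ _ (set_mem eS) (set_mem fS)).
    by rewrite (negbTE ef) !mulr0.
  have [c c0 hc] := esum_fin (fun e => sqr_ge0 (rnorm (T e))) fT.
  have fv : (\esum_(e in setT) (rnorm (v e) ^+ 2)%:E < +oo)%E.
    apply: (@le_lt_trans _ _ ((rnorm y ^+ 2)%:E * hs2 T)%E); last first.
      by rewrite /hs2 hc -EFinM ltry.
    rewrite /hs2; under eq_esum.
      move=> e _; rewrite (_ : (rnorm (v e) ^+ 2)%:E =
         if e \in hs_basis then (rnorm (dot y (T e)) ^+ 2)%:E else 0%E); last first.
        rewrite /v; case: ifPn => eS; last by rewrite rnorm0 expr0n.
        rewrite rnormZ exprMn [rnorm e ^+ 2](rnorm2E dotP).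
        by rewrite (hs_basis_onb.1 _ _ (set_mem eS) (set_mem eS)) eqxx mulr1.
      over.
    rewrite -esum_mkcond; apply: le_trans (esumZ_le _ _ _); rewrite ?sqr_ge0//; last by move=> e; rewrite lee_fin sqr_ge0.
    apply: le_esum => e _; rewrite -EFinM lee_fin -exprMn.
    by rewrite ler_pXn2r ?nnegrE ?mulr_ge0 ?rnorm_ge0// cauchy_schwarz.
  have [g vg] := orth_summable dotP vo fv.
  have gE e : hs_basis e -> dot g e = dot y (T e).
    move=> Se; apply/esym; apply: psum_uniq (psum_dot dotP (z := e) vg).
    have ve : dot (v e) e = dot y (T e).
      by rewrite /v mem_set// dotZl (hs_basis_onb.1 _ _ Se Se) eqxx mulr1.
    rewrite -ve; apply: (@psum_single _ R R[i]^o (fun f => dot (v f) e) e).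
    move=> f fe; rewrite /v; case: ifPn => fS; last by rewrite dot0l.
    by rewrite dotZl (hs_basis_onb.1 _ _ (set_mem fS) Se) (negbTE fe) mulr0.
  exists g => x.
  have xe := @onb_expand _ hs_basis_onb x.
  have E : (fun e => dot (T (onb_term hs_basis x e)) y : R[i]^o) =
           (fun e => dot (onb_term hs_basis x e) g).
    apply/funext => e; rewrite /onb_term; case: ifPn => eS; last by rewrite (lin0 lT) !dot0l.
    by rewrite (linZ lT) !dotZl; congr (_ * _); rewrite dot_conj -gE; [exact/esym/dot_conj|exact: set_mem].
  have h1 := psum_dot dotP (z := y) (psum_lin lT hM xe).
  rewrite E in h1; apply: (psum_uniq h1 (psum_dot dotP (z := g) xe)).
have [T' hT'] := choice ex; by exists T' => x y.
Qed.

(** A bound in place of the norm keeps all estimates in the reals and carries the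
    finiteness of the norm along. *)
Definition HSle T (c : R) := [/\ bounded_op T, 0 <= c & (hs2 T <= (c ^+ 2)%:E)%E].

Lemma HSle_bounded T c : HSle T c -> bounded_op T. Proof. by case. Qed.
Lemma HSle_linear T c : HSle T c -> linear T. Proof. by case=> -[]. Qed.
Lemma HSle_ge0 T c : HSle T c -> 0 <= c. Proof. by case. Qed.

Lemma HSle_adj T c : HSle T c -> exists T', has_adj T T'.
Proof. by move=> [bT _ h]; apply: hs2_adj_exists => //; exact: le_lt_trans h (ltry _). Qed.

(** The operator norm is at most the Hilbert--Schmidt norm: Parseval and
    Cauchy--Schwarz bound the adjoint, hence [T]. *)
Lemma HSle_opbound T c : HSle T c -> opbound T c.
Proof.
move=> hT; have [T' h] := HSle_adj hT; have [_ c0 hc] := hT.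
apply: (adj_opbound (has_adj_sym h)) => // y.
rewrite -(ler_pXn2r (_ : (0 < 2)%N)) ?nnegrE ?mulr_ge0 ?rnorm_ge0// exprMn.
rewrite -lee_fin -(onb_parseval hs_basis_onb) mulrC EFinM.
apply: le_trans (lee_wpmul2l _ hc); last by rewrite lee_fin sqr_ge0.
apply: le_trans (esumZ_le _ _ _); rewrite ?sqr_ge0//; last by move=> e; rewrite lee_fin sqr_ge0.
apply: le_esum => e _; rewrite -EFinM lee_fin -exprMn.
by rewrite ler_pXn2r ?nnegrE ?mulr_ge0 ?rnorm_ge0// (has_adj_sym h) cauchy_schwarz.
Qed.

Lemma HSle_le T c c' : HSle T c -> c <= c' -> HSle T c'.
Proof.
move=> [bT c0 h] cc'; have c'0 := le_trans c0 cc'; split=> //.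
by rewrite (le_trans h)// lee_fin ler_pXn2r ?nnegrE.
Qed.

Lemma HSle0 c : 0 <= c -> HSle (fun=> 0) c.
Proof.
move=> c0; split=> //; first exact: bounded_op0.
rewrite /hs2 esum1; first by rewrite lee_fin sqr_ge0.
by move=> e _; rewrite rnorm0 expr0n.
Qed.

Lemma HSle_comp T D M c : bounded_op D -> opbound D M -> 0 <= M ->
  HSle T c -> HSle (D \o T) (M * c).
Proof.
move=> bD hD M0 [bT c0 hc]; split; [exact: bounded_op_comp|exact: mulr_ge0|].
rewrite exprMn EFinM; apply: le_trans (lee_wpmul2l _ hc); last by rewrite lee_fin sqr_ge0.
apply: le_trans (esumZ_le _ _ _); rewrite ?sqr_ge0//; last by move=> e; rewrite lee_fin sqr_ge0.
apply: le_esum => e _; rewrite -EFinM lee_fin -exprMn.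
by rewrite ler_pXn2r ?nnegrE ?mulr_ge0 ?rnorm_ge0//; exact: hD.
Qed.

Lemma HSle_mul T T' c c' : HSle T c -> HSle T' c' -> HSle (T \o T') (c * c').
Proof.
move=> hT; apply: HSle_comp; [exact: HSle_bounded hT|exact: HSle_opbound|exact: HSle_ge0 hT].
Qed.

(** Triangle inequality, from [|a + b|^2 <= (1 + t)|a|^2 + (1 + 1/t)|b|^2] with
    [t] the quotient of the two norms. *)
Lemma HSle_add T T' c c' : HSle T c -> HSle T' c' -> HSle (T \+ T') (c + c').
Proof.
move=> hT hT'; have c0 := HSle_ge0 hT; have c'0 := HSle_ge0 hT'.
(* The quotient [t] below needs both bounds to be positive. *)
have zero U b : HSle U b -> b = 0 -> U = fun=> 0.
  move=> /HSle_opbound hU b0; apply/funext => x; apply/rnorm_eq0/eqP.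
  by rewrite eq_le rnorm_ge0 andbT (le_trans (hU x))// b0 mul0r.
have [cz|cz] := eqVneq c 0.
  rewrite (zero _ _ hT cz) cz add0r (_ : _ \+ T' = T')//.
  by apply/funext => x /=; rewrite add0r.
have [cz'|cz'] := eqVneq c' 0.
  rewrite (zero _ _ hT' cz') cz' addr0 (_ : T \+ _ = T)//.
  by apply/funext => x /=; rewrite addr0.
have {cz}cp : 0 < c by rewrite lt_def cz.
have {cz'}cp' : 0 < c' by rewrite lt_def cz'.
have [bT _ h] := hT; have [bT' _ h'] := hT'.
split; [exact: bounded_opD|exact: addr_ge0|].
apply/esum_leP => F FS.
have /esum_leP/(_ F FS) := h; have /esum_leP/(_ F FS) := h'.
set s' := \sum_(i <- F) _; set s := \sum_(i <- F) _ => hs' hs.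
pose t := c' / c.
have t0 : 0 < t by rewrite divr_gt0.
have pt e : rnorm ((T \+ T') e) ^+ 2 <=
    (1 + t) * rnorm (T e) ^+ 2 + (1 + t^-1) * rnorm (T' e) ^+ 2.
  have ab : rnorm ((T \+ T') e) ^+ 2 <= (rnorm (T e) + rnorm (T' e)) ^+ 2.
    by rewrite ler_pXn2r ?nnegrE ?addr_ge0 ?rnorm_ge0// rnormD.
  apply: (le_trans ab); set a := rnorm (T e); set b := rnorm (T' e).
  have : 0 <= t^-1 * (t * a - b) ^+ 2 by rewrite mulr_ge0 ?sqr_ge0 ?invr_ge0 ?ltW.
  rewrite (_ : t^-1 * _ = t * a ^+ 2 - 2 * a * b + t^-1 * b ^+ 2); first by lra.
  by field; rewrite gt_eqF.
apply: (@le_trans _ _ ((1 + t) * s + (1 + t^-1) * s')).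
  by rewrite /s /s' !mulr_sumr -big_split; apply: ler_sum => e _; exact: pt.
apply: (@le_trans _ _ ((1 + t) * c ^+ 2 + (1 + t^-1) * c' ^+ 2)).
  by apply: lerD; rewrite ler_pM2l// addr_gt0 ?invr_gt0.
rewrite le_eqVlt; apply/orP; left; apply/eqP; rewrite /t; field.
by rewrite !gt_eqF.
Qed.

Lemma HSle_opp T c : HSle T c -> HSle (fun x => - T x) c.
Proof.
move=> [bT c0 h]; split=> //.
  by have := bounded_opB (bounded_op0 _) bT; congr bounded_op; apply/funext => x /=; rewrite sub0r.
by move: h; rewrite /hs2; under eq_esum do rewrite -rnormN.
Qed.

Lemma HSle_sub T T' c c' : HSle T c -> HSle T' c' -> HSle (T \- T') (c + c').
Proof. by move=> hT /HSle_opp/(HSle_add hT). Qed.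

Lemma HSle_lim (T_ : nat -> H -> H) T c :
  (forall x, T_ ^~ x @ \oo --> T x) -> (forall n, HSle (T_ n) c) -> HSle T c.
Proof.
move=> Tl hT; have c0 := HSle_ge0 (hT 0%N); split=> //.
- apply: (@bounded_op_of _ _ _ c) => [a x y|x].
    apply: cvg_uniq (Tl _) _.
    rewrite (_ : (fun n => _) = (fun n => a *: T_ n x + T_ n y)); last first.
      by apply/funext => n; rewrite (HSle_linear (hT n)).
    apply: cvgD (Tl y); have lZ : linear (fun z : H => a *: z).
      by move=> b u v; rewrite scalerDr !scalerA mulrC.
    by apply: (@opbound_cvg _ _ _ _ lZ (rnorm a)) => // z; rewrite rnormZ.
  apply: (cvg_rnorm_le (Tl x)); exists 0%N => // n _ /=.
  exact: (HSle_opbound (hT n)).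
- apply/esum_leP => F FS.
  have nl e : (fun n => rnorm (T_ n e) : R) @ \oo --> rnorm (T e).
    apply/cvgrPdist_lt => eps eps0; have /cvg_rnorm/(_ _ eps0) := Tl e.
    by apply: filterS => n; apply: le_lt_trans; exact: rnorm_dist.
  have hl : (fun n => \sum_(e <- F) rnorm (T_ n e) ^+ 2 : R) @ \oo -->
     \sum_(e <- F) rnorm (T e) ^+ 2.
    elim: (F : seq H) => [|e s IH].
      rewrite big_nil (_ : (fun _ => _) = fun=> 0); first exact: cvg_cst.
      by apply/funext => n; rewrite big_nil.
    rewrite big_cons (_ : (fun _ => _) = (fun n => rnorm (T_ n e) ^+ 2 +
       \sum_(e <- s) rnorm (T_ n e) ^+ 2)); last by apply/funext => n; rewrite big_cons.
    by apply: cvgD => //; apply: cvgM.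
  have := hl => /cvg_lim <-//; apply: limr_le; first by apply/cvg_ex; eexists; exact: hl.
  exists 0%N => // n _ /=; have [_ _ /esum_leP] := hT n; exact.
Qed.

(** A factor on the right is moved to the left by taking adjoints. *)
Lemma hs2_compr Y Y' D D' (M : R) : has_adj Y Y' -> has_adj D D' ->
  opbound D' M -> 0 <= M -> (hs2 (Y \o D) <= (M ^+ 2)%:E * hs2 Y)%E.
Proof.
move=> aY aD hD M0.
have aYD : has_adj (Y \o D) (D' \o Y') by move=> x y /=; rewrite aY aD.
rewrite -(hs2_adj aYD) -(hs2_adj aY).
apply: le_trans (esumZ_le _ _ _); rewrite ?sqr_ge0//; last by move=> e; rewrite lee_fin sqr_ge0.
apply: le_esum => e _; rewrite -EFinM lee_fin -exprMn.
by rewrite ler_pXn2r ?nnegrE ?mulr_ge0 ?rnorm_ge0//; exact: hD.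
Qed.

Lemma hs_norm_leP T c : bounded_op T -> 0 <= c ->
  (hs_norm dot T <= c%:E)%E <-> HSle T c.
Proof.
move=> bT c0; rewrite /hs_norm -/hs_basis -/(hs2 T).
have cE : sqrte (c ^+ 2)%:E = c%:E by rewrite /= sqrtr_sqr ger0_norm.
rewrite -cE lee_sqrt; last by rewrite lee_fin sqr_ge0.
by split=> [h|[]].
Qed.

Lemma hilbert_schmidtP T : hilbert_schmidt dot T <-> exists c, HSle T c.
Proof.
split=> [[bT h]|[c hc]]; last first.
  have [bT c0 _] := hc; split=> //; apply: le_lt_trans (ltry c).
  exact/hs_norm_leP.
have h0 : (0 <= hs_norm dot T)%E by exact: sqrte_ge0.
exists (fine (hs_norm dot T)); apply/hs_norm_leP => //; first exact: fine_ge0.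
by rewrite fineK// ge0_fin_numE.
Qed.

End HilbertSchmidt.

(** * Operators assembled from rows relative to a resolution of the identity *)

Section Resolution.
Variables (R : realType) (H : completeNormedModType R[i]) (dot : {dot H for (@Num.conj R[i])}).
Hypothesis dotP : norm_from_dot dot.
Variables (I : countType) (P : I -> H -> H).
Hypothesis resP : resolution_of_identity dot P.
Implicit Types (x y : H) (X : H -> H) (T : I -> H -> H).

Lemma proj_bounded n : bounded_op (P n).
Proof. by have [+ _ _] := resP => /(_ n)[]. Qed.

Lemma proj_linear n : linear (P n).
Proof. by have [] := proj_bounded n. Qed.

Lemma proj_adj n : has_adj dot (P n) (P n).
Proof. by have [+ _ _] := resP => /(_ n)[]. Qed.

Lemma proj_mul m n x : P m (P n x) = if m == n then P n x else 0.
Proof.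
case: eqP => [->|/eqP mn]; first by have [+ _ _] := resP => /(_ n)[_ + _]; apply.
by have [_ + _] := resP; apply.
Qed.

Lemma proj_idem n x : P n (P n x) = P n x.
Proof. by rewrite proj_mul eqxx. Qed.

Lemma proj_dot_orth m n x y : m != n -> dot (P m x) (P n y) = 0.
Proof. by move=> mn; rewrite proj_adj proj_mul (negbTE mn) dot0r. Qed.

Lemma proj_opbound n : opbound (P n) 1.
Proof.
move=> x; rewrite mul1r.
have : rnorm x ^+ 2 = rnorm (P n x) ^+ 2 + rnorm (x - P n x) ^+ 2.
  rewrite -(pythagoras dotP) ?subrKC// proj_adj (linB (@proj_linear n)) proj_idem.
  by rewrite subrr dot0r.
move=> h; rewrite -(ler_pXn2r (_ : (0 < 2)%N)) ?nnegrE ?rnorm_ge0// h.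
by rewrite lerDl sqr_ge0.
Qed.

Lemma proj_psum x : summability.partial_sum (fun n => P n x) @ summability.totally --> x.
Proof. by have [_ _] := resP; apply. Qed.

Lemma proj_ext x y : (forall n, P n x = P n y) -> x = y.
Proof.
move=> xy; apply: (psum_uniq (@proj_psum x)).
by rewrite (_ : (fun n => P n x) = (fun n => P n y)); [exact: proj_psum|exact/funext].
Qed.

Lemma proj_parseval x : \esum_(n in setT) (rnorm (P n x) ^+ 2)%:E = (rnorm x ^+ 2)%:E.
Proof.
by rewrite (orth_parseval dotP _ (@proj_psum x))// => i j; exact: proj_dot_orth.
Qed.

(** The Riesz--Fischer theorem, for the coordinates [P n]. *)
Lemma proj_glue (v : I -> H) : (forall n, P n (v n) = v n) ->
  (\esum_(n in setT) (rnorm (v n) ^+ 2)%:E < +oo)%E ->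
  exists y, summability.partial_sum v @ summability.totally --> y /\
    forall n, P n y = v n.
Proof.
move=> vP fv.
have vo i j : i != j -> dot (v i) (v j) = 0.
  by move=> ij; rewrite -(vP i) -(vP j) proj_dot_orth.
have [y vy] := orth_summable dotP vo fv; exists y; split=> // n.
have h := psum_lin (@proj_linear n) (@proj_opbound n) vy.
apply: (psum_uniq h); rewrite -[X in _ --> X]vP.
apply: (@psum_single _ _ _ (fun i => P n (v i))) => i ni.
by rewrite -vP proj_mul eq_sym (negbTE ni).
Qed.

(** An operator prescribed by its rows, its compositions with the [P n] on the
    left.  Both transforms are of this form: the rows of [J X] are those of the
    [X \o P n], and the rows of [Gamma X] are those of [X] times diagonal
    operators. *)
Definition rowop T x := summability.sum (fun n => P n (T n x)).

Definition rowbound T M := forall x,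
  (\esum_(n in setT) (rnorm (P n (T n x)) ^+ 2)%:E <= ((M * rnorm x) ^+ 2)%:E)%E.

Section Rowop.
Variables (T : I -> H -> H) (M : R).
Hypothesis hT : rowbound T M.

Lemma rowopE n x : P n (rowop T x) = P n (T n x).
Proof.
have [|y [hy yE]] := proj_glue (fun n => proj_idem n (T n x)).
  exact: le_lt_trans (hT x) (ltry _).
by rewrite /rowop (psum_sum hy) yE.
Qed.

Lemma rowop_opbound : 0 <= M -> opbound (rowop T) M.
Proof.
move=> M0 x; rewrite -(ler_pXn2r (_ : (0 < 2)%N)) ?nnegrE ?mulr_ge0 ?rnorm_ge0//.
rewrite -lee_fin -proj_parseval; apply: le_trans (hT x).
by apply: le_esum => n _; rewrite rowopE.
Qed.

Lemma rowop_linear : (forall n, linear (T n)) -> linear (rowop T).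
Proof.
move=> lT a x y; apply: proj_ext => n.
rewrite (linD (@proj_linear n)) (linZ (@proj_linear n)) !rowopE.
by rewrite (linD (lT n)) (linZ (lT n)) (linD (@proj_linear n)) (linZ (@proj_linear n)).
Qed.

Lemma rowop_bounded : 0 <= M -> (forall n, linear (T n)) -> bounded_op (rowop T).
Proof. by move=> M0 lT; apply: bounded_op_of (rowop_opbound M0); exact: rowop_linear. Qed.

End Rowop.

Section Diagonal.
Variables (d : I -> R[i]) (M : R).
Hypotheses (dM : forall n, rnorm (d n) <= M) (M0 : 0 <= M).

Definition diag (d : I -> R[i]) := rowop (fun n x => d n *: x).

Lemma diag_rowbound : rowbound (fun n x => d n *: x) M.
Proof.
move=> x; rewrite exprMn EFinM -proj_parseval.
apply: le_trans (esumZ_le _ _ _); rewrite ?sqr_ge0//; last by move=> i; rewrite lee_fin sqr_ge0.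
apply: le_esum => n _; rewrite -EFinM lee_fin (linZ (@proj_linear n)) rnormZ exprMn.
by rewrite ler_wpM2r ?sqr_ge0// ler_pXn2r ?nnegrE ?rnorm_ge0.
Qed.

Lemma diagE n x : P n (diag d x) = d n *: P n x.
Proof. by rewrite (rowopE diag_rowbound) (linZ (@proj_linear n)). Qed.

Lemma diag_linear : linear (diag d).
Proof.
apply: (rowop_linear diag_rowbound) => n a x y.
by rewrite scalerDr !scalerA mulrC.
Qed.

Lemma diag_opbound : opbound (diag d) M.
Proof. exact: (rowop_opbound diag_rowbound). Qed.

End Diagonal.

Lemma diag_adj (d : I -> R[i]) (M : R) : (forall n, rnorm (d n) <= M) -> 0 <= M ->
  has_adj dot (diag d) (diag (fun n => Num.conj (d n))).
Proof.
move=> dM M0 x y; have dM' n : rnorm (Num.conj (d n)) <= M by rewrite rnorm_conj.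
have h1 := psum_dot dotP (z := y) (@proj_psum (diag d x)).
have h2 := psum_dot dotP (z := diag (fun n => Num.conj (d n)) y) (@proj_psum x).
have E : (fun i => dot (P i (diag d x)) y : R[i]^o) =
    (fun i => dot (P i x) (diag (fun n => Num.conj (d n)) y)).
  apply/funext => n; rewrite (diagE dM M0) dotZl [RHS]proj_adj (diagE dM' M0).
  by rewrite dotZr conj_conjc conjcK proj_adj.
by rewrite E in h1; exact: (psum_uniq h1 h2).
Qed.

(** Parseval for each [X e], and an exchange of the two sums. *)
Lemma hs2_rows X : hs2 dot X = \esum_(n in setT) hs2 dot (P n \o X).
Proof.
rewrite /hs2 esum_swap; last by move=> n e; rewrite lee_fin sqr_ge0.
by apply: eq_esum => e _; rewrite -proj_parseval.
Qed.

Definition row_hs X n : R := Num.sqrt (fine (hs2 dot (P n \o X))).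

Section Multiplier.
Variables (X : H -> H) (c : R).
Hypothesis hX : HSle dot X c.

Lemma row_hs2 n : hs2 dot (P n \o X) = (row_hs X n ^+ 2)%:E.
Proof.
have [_ _ h] := HSle_comp (proj_bounded n) (@proj_opbound n) ler01 hX.
rewrite /row_hs sqr_sqrtr ?fine_ge0 ?hs2_ge0// fineK//.
by rewrite ge0_fin_numE ?hs2_ge0// (le_lt_trans h)// ltry.
Qed.

Lemma row_HSle n : HSle dot (P n \o X) (row_hs X n).
Proof.
split; [|exact: sqrtr_ge0|by rewrite row_hs2].
by apply: bounded_op_comp; [exact: proj_bounded|exact: HSle_bounded hX].
Qed.

Lemma row_hs_sum : (\esum_(n in setT) (row_hs X n ^+ 2)%:E <= (c ^+ 2)%:E)%E.
Proof.
have [_ _] := hX; rewrite hs2_rows.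
by under eq_esum do rewrite row_hs2.
Qed.

Variables (D D' : I -> H -> H) (M : R).
Hypotheses (lD : forall n, linear (D n)) (hD : forall n, opbound (D n) M)
  (aD : forall n, has_adj dot (D n) (D' n)) (M0 : 0 <= M).

Lemma mult_rowbound : rowbound (fun n => X \o D n) (M * c).
Proof.
move=> x; apply: (@le_trans _ _ ((M * rnorm x) ^+ 2 * c ^+ 2)%:E); last first.
  by rewrite lee_fin -exprMn mulrAC.
rewrite EFinM; apply: le_trans (lee_wpmul2l _ row_hs_sum); last by rewrite lee_fin sqr_ge0.
apply: le_trans (esumZ_le _ _ _); rewrite ?sqr_ge0//; last by move=> i; rewrite lee_fin sqr_ge0.
apply: le_esum => n _; rewrite -EFinM lee_fin -exprMn.
rewrite ler_pXn2r ?nnegrE ?mulr_ge0 ?rnorm_ge0 ?sqrtr_ge0//.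
rewrite (le_trans (HSle_opbound dotP (row_HSle n) (D n x)))// mulrC.
by rewrite ler_wpM2r ?sqrtr_ge0//; exact: hD.
Qed.

(** Each row [P n \o X] loses at most the factor [M] when multiplied by [D n], and
    the squared norms of the rows add up. *)
Lemma mult_HSle : HSle dot (rowop (fun n => X \o D n)) (M * c).
Proof.
have c0 := HSle_ge0 hX.
split; rewrite ?mulr_ge0//.
  apply: (rowop_bounded mult_rowbound); first exact: mulr_ge0.
  by move=> n a x y; rewrite /= (linD (lD n)) (linZ (lD n)) (HSle_linear hX).
rewrite hs2_rows.
have E n : P n \o rowop (fun n => X \o D n) = (P n \o X) \o D n.
  by apply/funext => x; rewrite /= (rowopE mult_rowbound).
under eq_esum do rewrite E.
have [_ _] := hX; rewrite hs2_rows => h; rewrite exprMn EFinM.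
apply: le_trans (lee_wpmul2l _ h); last by rewrite lee_fin sqr_ge0.
have h' := @esumZ_le R I setT (fun n => hs2 dot (P n \o X)) _ (sqr_ge0 M) (fun n => hs2_ge0 dot (P n \o X)).
apply: le_trans h'.
apply: le_esum => n _; have [Y' hY'] := HSle_adj dotP (row_HSle n).
by apply: (hs2_compr dotP hY' (aD n)) => //; exact: (adj_opbound dotP (aD n)).
Qed.

End Multiplier.

End Resolution.

(** * The transforms [J] and [Gamma] *)

Section Transforms.
Variables (R : realType) (H : completeNormedModType R[i]) (dot : {dot H for (@Num.conj R[i])}).
Hypothesis dotP : norm_from_dot dot.
Variable P : int -> H -> H.
Hypothesis resP : resolution_of_identity dot P.
Variables (lam : int -> R[i]) (d : R).
Hypotheses (d0 : 0 < d) (lam_sep : forall m n, m != n -> d <= rnorm (lam m - lam n)).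
Implicit Types (x y : H) (X : H -> H) (c : R).

Let Plin := proj_linear resP.

Definition gcoef m n : R[i] := if m == n then 0 else (lam m - lam n)^-1.

Lemma gcoef_le m n : rnorm (gcoef m n) <= d^-1.
Proof.
rewrite /gcoef; case: eqP => [_|/eqP mn]; first by rewrite rnorm0 invr_ge0 ltW.
have h := lam_sep mn.
by rewrite rnormV lef_pV2 ?posrE// (lt_le_trans d0 h).
Qed.

Let di0 : 0 <= d^-1. Proof. by rewrite invr_ge0 ltW. Qed.

(** Row [m] of [Gamma X] is row [m] of [X] multiplied by this operator. *)
Definition Gdiag m := diag P (gcoef m).

Lemma GdiagE m n x : P n (Gdiag m x) = gcoef m n *: P n x.
Proof. exact: (diagE dotP resP (gcoef_le m) di0). Qed.

Lemma Gdiag_linear m : linear (Gdiag m).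
Proof. exact: (diag_linear dotP resP (gcoef_le m) di0). Qed.

Lemma Gdiag_opbound m : opbound (Gdiag m) d^-1.
Proof. exact: (diag_opbound dotP resP (gcoef_le m) di0). Qed.

Section Fix.
Variables (X : H -> H) (c : R).
Hypothesis hX : HSle dot X c.

Let lX := HSle_linear hX.

Lemma J_rowbound : rowbound P (fun n => X \o P n) (1 * c).
Proof. exact: (mult_rowbound dotP resP hX (proj_opbound dotP resP) ler01). Qed.

Lemma JE n x : P n (Jtransform P X x) = P n (X (P n x)).
Proof. exact: (rowopE dotP resP J_rowbound). Qed.

Lemma J_HSle : HSle dot (Jtransform P X) c.
Proof.
rewrite -[c]mul1r.
exact: (mult_HSle dotP resP hX Plin (proj_opbound dotP resP) (proj_adj resP) ler01).
Qed.

Lemma J_comm n x : P n (Jtransform P X x) = Jtransform P X (P n x).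
Proof.
apply: (proj_ext resP) => m; rewrite (proj_mul resP) !JE (proj_mul resP).
by case: eqP => [->|_] //; rewrite (lin0 lX) (lin0 (Plin m)).
Qed.

Let G := rowop P (fun m => X \o Gdiag m).

Let G_rowbound : rowbound P (fun m => X \o Gdiag m) (d^-1 * c).
Proof. exact: (mult_rowbound dotP resP hX Gdiag_opbound di0). Qed.

(** [G x] minus the sum over [F] has [m]-th coordinate [P m (X (z m))], where
    [z m] collects the coordinates [n] of [Gdiag m x] with [(m, n)] outside [F];
    the squared norms sum up to a tail of the double series of
    [|P m X|^2 |P n x|^2]. *)
Lemma Gamma_psum x : summability.partial_sum (fun mn : int * int =>
    if mn.1 == mn.2 then 0
    else (lam mn.1 - lam mn.2)^-1 *: P mn.1 (X (P mn.2 x)))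
  @ summability.totally --> G x.
Proof.
set v := fun mn : int * int => _.
have vE p : v p = gcoef p.1 p.2 *: P p.1 (X (P p.2 x)).
  by rewrite /v /gcoef; case: eqP => //; rewrite scale0r.
pose h := row_hs dot P X.
pose a (p : int * int) := h p.1 ^+ 2 * rnorm (P p.2 x) ^+ 2.
have a0 p : 0 <= a p by rewrite mulr_ge0 ?sqr_ge0.
have fa : (\esum_(p in setT) (a p)%:E < +oo)%E.
  apply: (@le_lt_trans _ _ ((rnorm x ^+ 2)%:E * (c ^+ 2)%:E)%E); last by rewrite -EFinM ltry.
  have -> : [set: int * int] = [set: int] `*`` (fun=> [set: int]).
    by apply/seteqP; split.
  rewrite -(@esum_esum _ _ _ _ _ (fun m n => (h m ^+ 2 * rnorm (P n x) ^+ 2)%:E)); last first.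
    by move=> m n _ _; rewrite lee_fin mulr_ge0 ?sqr_ge0.
  apply: le_trans (lee_wpmul2l _ (row_hs_sum dotP resP hX)); last by rewrite lee_fin sqr_ge0.
  apply: le_trans (esumZ_le _ _ _); rewrite ?sqr_ge0//; last by move=> e; rewrite lee_fin sqr_ge0.
  apply: le_esum => m _; under eq_esum do rewrite EFinM.
  rewrite esumZ ?sqr_ge0//; last by move=> n; rewrite lee_fin sqr_ge0.
  by rewrite (proj_parseval dotP resP) muleC.
apply/cvg_rnorm => e e0.
have ed0 : 0 < (e / 2 * d) ^+ 2 by rewrite exprn_gt0// mulr_gt0// divr_gt0.
have [F0 hF0] := esum_cofinite a0 fa ed0.
apply: near_totally; exists F0 => F /hF0 {hF0} hF.
rewrite psumE; set s := \sum_(i <- F) v i.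
suff : rnorm (G x - s) <= e / 2 by move=> h1; lra.
rewrite -(ler_pXn2r (_ : (0 < 2)%N)) ?nnegrE ?rnorm_ge0 ?divr_ge0 ?(ltW e0)//.
rewrite -lee_fin -(proj_parseval dotP resP).
pose z m := Gdiag m x - \sum_(p <- F | p.1 == m) gcoef p.1 p.2 *: P p.2 x.
have zE m n : P n (z m) = if (m, n) \in F then 0 else gcoef m n *: P n x.
  rewrite (linB (Plin n)) GdiagE (lin_sum (Plin n)).
  have E p : p.1 == m -> P n (gcoef p.1 p.2 *: P p.2 x) =
       if p == (m, n) then gcoef m n *: P n x else 0.
    case: p => p1 p2 /= /eqP ->; rewrite (linZ (Plin n)) (proj_mul resP).
    rewrite xpair_eqE eqxx /= eq_sym.
    by case: eqP => [->//|_]; rewrite scaler0.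
  rewrite (eq_bigr _ E) (@fset_sum_single _ _ F (fun p => p.1 == m)) ?eqxx//.
  by case: ifP; rewrite ?subrr ?subr0.
have PE m : P m (G x - s) = P m (X (z m)).
  rewrite (linB (Plin m)) (rowopE dotP resP G_rowbound) /z (linB lX) (linB (Plin m)) /=.
  congr (_ - _); rewrite /s !(lin_sum (Plin m)) (lin_sum lX) (lin_sum (Plin m)).
  rewrite [RHS]big_mkcond; apply: eq_bigr => -[p1 p2] _ /=.
  rewrite vE (linZ (Plin m)) (proj_mul resP) /= eq_sym.
  by case: eqP => [->|_]; rewrite ?scaler0// (linZ lX) (linZ (Plin m)).
have zb m : ((h m ^+ 2 * rnorm (z m) ^+ 2)%:E <=
    ((d^-1) ^+ 2)%:E * \esum_(n in setT) (if (m, n) \in F then 0 else a (m, n))%:E)%E.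
  rewrite -esumZ ?sqr_ge0//; last by move=> n; rewrite lee_fin; case: ifP.
  rewrite EFinM -(proj_parseval dotP resP) -esumZ ?sqr_ge0//; last first.
    by move=> n; rewrite lee_fin sqr_ge0.
  apply: le_esum => n _; rewrite -!EFinM lee_fin zE; case: ifP => _.
    by rewrite rnorm0 expr0n /= !mulr0.
  rewrite /a /= rnormZ exprMn mulrCA; apply: ler_wpM2r.
    by rewrite mulr_ge0 ?sqr_ge0.
  by rewrite ler_pXn2r ?nnegrE ?rnorm_ge0// gcoef_le.
apply: (@le_trans _ _ (\esum_(m in setT) (((d^-1) ^+ 2)%:E *
   \esum_(n in setT) (if (m, n) \in F then 0 else a (m, n))%:E)))%E.
  apply: le_esum => m _; apply: le_trans (zb m); rewrite lee_fin PE -exprMn.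
  rewrite ler_pXn2r ?nnegrE ?mulr_ge0 ?rnorm_ge0 ?sqrtr_ge0//.
  exact: (HSle_opbound dotP (row_HSle dotP resP hX m) (z m)).
have b0 m n : (0 <= (if (m, n) \in F then 0 else a (m, n))%:E)%E.
  by rewrite lee_fin; case: ifP.
apply: (@le_trans _ _ (((d^-1) ^+ 2)%:E * ((e / 2 * d) ^+ 2)%:E)%E); last first.
  by rewrite -EFinM lee_fin -exprMn mulrCA mulVf ?gt_eqF// mulr1.
apply: le_trans (esumZ_le _ _ _) _; rewrite ?sqr_ge0//.
  by move=> m; apply: esum_ge0 => n _; exact: b0.
apply: lee_wpmul2l; first by rewrite lee_fin sqr_ge0.
rewrite esum_esum//; apply: le_trans hF.
rewrite (_ : setT `*`` (fun=> setT) = setT); last by apply/seteqP; split.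
by apply: le_esum => -[m n].
Qed.

Lemma Gamma_rowop x : Gammatransform lam P X x = G x.
Proof. exact: (psum_sum (@Gamma_psum x)). Qed.

Lemma GammaE m x : P m (Gammatransform lam P X x) = P m (X (Gdiag m x)).
Proof. by rewrite Gamma_rowop (rowopE dotP resP G_rowbound). Qed.

Lemma Gamma_HSle : HSle dot (Gammatransform lam P X) (d^-1 * c).
Proof.
have -> : Gammatransform lam P X = G by apply/funext => x; exact: Gamma_rowop.
apply: (mult_HSle dotP resP hX Gdiag_linear Gdiag_opbound _ di0) => m.
exact: (diag_adj dotP resP (gcoef_le m) di0).
Qed.

End Fix.

Lemma J_sub X Y c c' : HSle dot X c -> HSle dot Y c' ->
  Jtransform P (X \- Y) = Jtransform P X \- Jtransform P Y.
Proof.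
move=> hX hY; apply/funext => x; apply: (proj_ext resP) => n.
by rewrite /= (linB (Plin n)) (JE hX) (JE hY) (JE (HSle_sub dotP hX hY)) /= (linB (Plin n)).
Qed.

Lemma Gamma_sub X Y c c' : HSle dot X c -> HSle dot Y c' ->
  Gammatransform lam P (X \- Y) = Gammatransform lam P X \- Gammatransform lam P Y.
Proof.
move=> hX hY; apply/funext => x; apply: (proj_ext resP) => n.
rewrite /= (linB (Plin n)) (GammaE hX) (GammaE hY) (GammaE (HSle_sub dotP hX hY)) /=.
by rewrite (linB (Plin n)).
Qed.

(** [Gamma X] has zero diagonal, hence so has its product with a block diagonal
    operator. *)
Lemma J_Gamma_J X Y c c' : HSle dot X c -> HSle dot Y c' ->
  Jtransform P (Gammatransform lam P X \o Jtransform P Y) = fun=> 0.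
Proof.
move=> hX hY; apply/funext => x; apply: (proj_ext resP) => n.
rewrite (JE (HSle_mul dotP (Gamma_HSle hX) (J_HSle hY))) /= (GammaE hX).
rewrite (lin0 (Plin n)) -(J_comm hY).
suff -> : Gdiag n (P n (Jtransform P Y x)) = 0 by rewrite (lin0 (HSle_linear hX)) (lin0 (Plin n)).
apply: (proj_ext resP) => m; rewrite GdiagE (proj_mul resP) (lin0 (Plin m)).
by rewrite /gcoef [m == n]eq_sym; case: eqP => _; rewrite ?scale0r ?scaler0.
Qed.

Lemma J_offdiag X c m n x : HSle dot X c -> m != n -> P m (Jtransform P X (P n x)) = 0.
Proof.
move=> hX mn; rewrite (JE hX) (proj_mul resP) (negbTE mn).
by rewrite (lin0 (HSle_linear hX)) (lin0 (Plin m)).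
Qed.

End Transforms.

(** * The fixed point of [Phi] *)

Section FixedPoint.
Variables (R : realType) (H : completeNormedModType R[i]) (dot : {dot H for (@Num.conj R[i])}).
Hypothesis dotP : norm_from_dot dot.
Variable P : int -> H -> H.
Hypothesis resP : resolution_of_identity dot P.
Variables (lam : int -> R[i]) (d : R).
Hypotheses (d0 : 0 < d) (lam_sep : forall m n, m != n -> d <= rnorm (lam m - lam n)).
Variables (B : H -> H) (b : R).
Hypotheses (hB : HSle dot B b) (b_small : 3 * b < d).
Hypothesis JB : Jtransform P B = fun=> 0.
Implicit Types (x : H) (X Y : H -> H) (c : R).

Local Notation Gam := (Gammatransform lam P).
Local Notation J := (Jtransform P).

(** On the ball of radius [3 b] one has [|Gamma X| <= 3 b / d < 1]; each of the
    three products in [Phi X - Phi Y] then costs at most [b / d] times the norm of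
    [X - Y], hence this contraction ratio. *)
Definition ratio := d^-1 * (3 * b).

Let b0 : 0 <= b := HSle_ge0 hB.

Lemma ratio_ge0 : 0 <= ratio.
Proof. by rewrite /ratio !mulr_ge0 ?invr_ge0 ?(ltW d0). Qed.

Lemma ratio_lt1 : ratio < 1.
Proof. by rewrite /ratio mulrC ltr_pdivrMr// mul1r. Qed.

Let k0 := ratio_ge0.
Let k1 := ratio_lt1.

Let GH X c (hX : HSle dot X c) := Gamma_HSle dotP resP d0 lam_sep hX.

Lemma Phi_HSle X : HSle dot X (3 * b) -> HSle dot (Phi lam P B X) (3 * b).
Proof.
move=> hX; have hG := GH hX; have hBG := HSle_mul dotP hB hG.
have hJ := J_HSle dotP resP hBG.
have h := HSle_add dotP (HSle_sub dotP hBG (HSle_mul dotP hG hJ)) hB.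
apply: (HSle_le h); rewrite -/ratio.
have h1 : b * ratio <= b by rewrite ler_piMr// ltW.
have h2 : ratio * (b * ratio) <= b.
  by apply: (le_trans _ h1); apply: ler_piMl; [exact: mulr_ge0|exact: ltW].
by rewrite (mulrDl 1 2 b : 3 * b = _); lra.
Qed.

Lemma Phi_lip X Y c : HSle dot X (3 * b) -> HSle dot Y (3 * b) ->
  HSle dot (X \- Y) c ->
  HSle dot (Phi lam P B X \- Phi lam P B Y) (ratio * c).
Proof.
move=> hX hY hXY; have hGX := GH hX; have hGY := GH hY; have hGD := GH hXY.
have c0 := HSle_ge0 hXY.
have hBX := HSle_mul dotP hB hGX; have hBY := HSle_mul dotP hB hGY.
have hBD := HSle_mul dotP hB hGD.
have hJX := J_HSle dotP resP hBX; have hJD := J_HSle dotP resP hBD.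
have GD := Gamma_sub dotP resP d0 lam_sep hX hY.
have BD : B \o Gam (X \- Y) = (B \o Gam X) \- (B \o Gam Y).
  by apply/funext => x; rewrite GD /= (linB (HSle_linear hB)).
have JD : J (B \o Gam (X \- Y)) = J (B \o Gam X) \- J (B \o Gam Y).
  by rewrite BD (J_sub dotP resP hBX hBY).
have -> : Phi lam P B X \- Phi lam P B Y = (B \o Gam (X \- Y)) \-
   ((Gam (X \- Y) \o J (B \o Gam X)) \+ (Gam Y \o J (B \o Gam (X \- Y)))).
  apply/funext => x; rewrite /Phi JD BD GD /= (linB (HSle_linear hGY)).
  move: (B (Gam X x)) (B (Gam Y x)) (B x) (Gam X (J (B \o Gam X) x))
    (Gam Y (J (B \o Gam X) x)) (Gam Y (J (B \o Gam Y) x)) => u v w p r q.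
  rewrite [p - r + _]addrA subrK opprD addrACA subrr addr0 !opprB.
  by rewrite addrACA [RHS]addrACA; congr (_ + _); rewrite addrC.
have h := HSle_sub dotP hBD (HSle_add dotP (HSle_mul dotP hGD hJX) (HSle_mul dotP hGY hJD)).
apply: (HSle_le h); rewrite -/ratio.
set g := d^-1; have g0 : 0 <= g by rewrite invr_ge0 ltW.
have bg0 : 0 <= b * (g * c) by rewrite !mulr_ge0.
have E1 : g * c * (b * ratio) = ratio * (b * (g * c)) by ring.
have E2 : ratio * c = 3 * (b * (g * c)) by rewrite /ratio -/g; ring.
rewrite E1 E2; have : ratio * (b * (g * c)) <= b * (g * c) by rewrite ler_piMl// ltW.
by lra.
Qed.

Definition phi_iter n := iter n (Phi lam P B) (fun=> 0).

Lemma phi_iter_HSle n : HSle dot (phi_iter n) (3 * b).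
Proof. by elim: n => [|n]; [apply: HSle0; rewrite mulr_ge0|exact: Phi_HSle]. Qed.

Lemma phi_iter_step n : HSle dot (phi_iter n.+1 \- phi_iter n) (3 * b * ratio ^+ n).
Proof.
elim: n => [|n IH].
  rewrite expr0 mulr1 -[3 * b]addr0; apply: HSle_sub => //.
    exact: (phi_iter_HSle 1).
  exact: HSle0.
rewrite exprS mulrCA.
exact: (Phi_lip (phi_iter_HSle n.+1) (phi_iter_HSle n) IH).
Qed.

Lemma phi_iter_tail n m : HSle dot (phi_iter (n + m) \- phi_iter n)
  (3 * b * ratio ^+ n / (1 - ratio)).
Proof.
have r1 : 0 < 1 - ratio by rewrite subr_gt0.
have : HSle dot (phi_iter (n + m) \- phi_iter n)
    (3 * b * ratio ^+ n * (1 - ratio ^+ m) / (1 - ratio)).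
  elim: m => [|m IH].
    rewrite addn0 expr0 subrr mulr0 mul0r (_ : _ \- _ = fun=> 0); first exact: HSle0.
    by apply/funext => x /=; rewrite subrr.
  have h := HSle_add dotP (phi_iter_step (n + m)) IH.
  rewrite (_ : phi_iter (n + m.+1) \- _ = (phi_iter (n + m).+1 \- phi_iter (n + m)) \+
      (phi_iter (n + m) \- phi_iter n)); last first.
    by apply/funext => x; rewrite addnS /= addrA subrK.
  apply: (HSle_le h); rewrite le_eqVlt; apply/orP; left; apply/eqP.
  by rewrite exprD exprS; field; rewrite gt_eqF.
move=> h; apply: (HSle_le h); rewrite ler_pM2r ?invr_gt0//.
rewrite ler_piMr//; first by rewrite !mulr_ge0 ?exprn_ge0.
by rewrite gerBl exprn_ge0.
Qed.

Lemma geometric_squeeze (f : nat -> H) (l : H) c :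
  (forall n, rnorm (l - f n) <= c * ratio ^+ n) -> f @ \oo --> l.
Proof.
move=> hf; apply/cvg_rnorm => e e0.
have : (fun n => c * ratio ^+ n : R) @ \oo --> c * 0.
  by apply: cvgMr; apply: cvg_expr; rewrite ger0_norm.
rewrite mulr0 => /cvgrPdist_lt/(_ e e0); apply: filterS => n.
by rewrite sub0r normrN => /(le_lt_trans (ler_norm _)); exact: le_lt_trans.
Qed.

Theorem Phi_fixed_point : exists Xs : H -> H,
  [/\ HSle dot Xs (3 * b),
      forall n, HSle dot (Xs \- phi_iter n) (3 * b * ratio ^+ n / (1 - ratio))
    & Phi lam P B Xs = Xs].
Proof.
have lim x : exists l : H, phi_iter ^~ x @ \oo --> l.
  have [| |l [hl _]] := @geometric_cvg _ _ (phi_iter ^~ x) (3 * b * rnorm x) ratio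
    _ (introT andP (conj k0 k1)).
  - by rewrite !mulr_ge0 ?rnorm_ge0.
  - move=> n; rewrite mulrAC.
    by have := HSle_opbound dotP (phi_iter_step n) x.
  by exists l.
have [Xs hXs] := choice lim.
have h1 : HSle dot Xs (3 * b) by apply: (HSle_lim dotP hXs); exact: phi_iter_HSle.
have h2 n : HSle dot (Xs \- phi_iter n) (3 * b * ratio ^+ n / (1 - ratio)).
  apply: (@HSle_lim _ _ _ dotP (fun m => phi_iter (n + m) \- phi_iter n)) => [x|m].
    apply: cvgB; last exact: cvg_cst.
    by have := hXs x; rewrite -(cvg_shiftn n); under eq_fun do rewrite addnC.
  exact: phi_iter_tail.
exists Xs; split=> //; apply/funext => x.
have hx : (fun n => phi_iter n.+1 x) @ \oo --> Xs x.
  by rewrite (cvg_shiftS (phi_iter ^~ x)).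
apply: (@cvg_uniq _ _ _ \oo _ _ _ _ _ hx).
apply: (@geometric_squeeze _ _ (ratio * (3 * b / (1 - ratio)) * rnorm x)) => n.
have hn : HSle dot (Phi lam P B Xs \- Phi lam P B (phi_iter n)) _ :=
  Phi_lip h1 (phi_iter_HSle n) (h2 n).
have := HSle_opbound dotP hn x; congr (_ <= _).
by rewrite mulrAC -!mulrA; congr (_ * (_ * _)); ring.
Qed.

Section Consequences.
Variable Xs : H -> H.
Hypotheses (hXs : HSle dot Xs (3 * b)) (fixXs : Phi lam P B Xs = Xs).

Let U := Gam Xs.
Let V := J Xs.
Let hU := GH hXs.
Let hBU := HSle_mul dotP hB hU.

(** Of the three terms of [Phi Xs], the second has no diagonal because [Gamma Xs]
    has none, and the third because [J B = 0]. *)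
Lemma fixed_J : J Xs = J (B \o Gam Xs).
Proof.
apply/funext => x; apply: (proj_ext resP) => n.
have hJ := J_HSle dotP resP hBU.
have h0 := J_Gamma_J dotP resP d0 lam_sep hXs hBU.
have lP := proj_linear resP n.
rewrite (JE dotP resP hXs) (JE dotP resP hBU) -{1}fixXs /Phi /= (linD lP) (linB lP).
have -> : P n (B (P n x)) = 0 by rewrite -(JE dotP resP hB) JB (lin0 lP).
have -> : P n (Gam Xs (J (B \o Gam Xs) (P n x))) = 0.
  by rewrite -[LHS](JE dotP resP (HSle_mul dotP hU hJ)) h0 (lin0 lP).
by rewrite subr0 addr0.
Qed.

Lemma fixed_J_HSle : HSle dot V (b * ratio).
Proof. by rewrite /V fixed_J; exact: (J_HSle dotP resP hBU). Qed.

Lemma fixed_eq x : Xs x = B (U x) - U (V x) + B x.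
Proof. by rewrite /U /V fixed_J -{1}fixXs. Qed.

End Consequences.

End FixedPoint.

(** * The unperturbed operator in coordinates *)

Section Operator.
Variables (R : realType) (H : completeNormedModType R[i]) (dot : {dot H for (@Num.conj R[i])}).
Hypothesis dotP : norm_from_dot dot.
Variable P : int -> H -> H.
Hypothesis resP : resolution_of_identity dot P.
Variables (A : operator H) (lam : int -> R[i]).
Hypotheses (linA : linear_operator A) (clA : closed_operator A)
  (normA : normal_operator dot A)
  (AP : forall n x, dom A (P n x) /\ A (P n x) = lam n *: P n x).
Implicit Types (x y : H) (X : H -> H) (c : R).

Let Plin := proj_linear resP.

Lemma domD x y : dom A x -> dom A y -> dom A (x + y) /\ A (x + y) = A x + A y.
Proof. by move=> dx dy; have := linA.2 1 x y dx dy; rewrite !scale1r. Qed.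

(** Normality turns an eigenvector [y] of [A] into one of the adjoint:
    [|z - conj(lam) y|^2] vanishes when [z] is the adjoint applied to [y]. *)
Lemma proj_op n x : dom A x -> P n (A x) = lam n *: P n x.
Proof.
move=> dx; apply: (dot_eq dotP) => w; rewrite (proj_adj resP) dotZl (proj_adj resP).
set y := P n w; have [dy Ay] := AP n w; rewrite -/y in dy Ay.
have [dA nA] := normA.
have [z hz] : dom (adjoint dot A) y by rewrite dA.
have nAy := nA y dy; pose z' := adjoint dot A y; rewrite -/z' in nAy.
have hz' : forall x, dom A x -> dot (A x) y = dot x z'.
  exact: (xgetPex 0 (ex_intro (fun z => forall x, dom A x -> dot (A x) y = dot x z) z hz)).
have nz : rnorm z' = rnorm (lam n) * rnorm y.
  by move: nAy; rewrite Ay !normE => /complexI; rewrite rnormZ.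
have yz : dot y z' = lam n * (rnorm y ^+ 2)%:C by rewrite -hz'// Ay dotZl (dotxx dotP).
suff zE : z' = Num.conj (lam n) *: y by rewrite hz'// zE dotZr conj_conjc conjcK.
apply/eqP; rewrite -subr_eq0; apply/eqP/rnorm_eq0/eqP; rewrite -sqrf_eq0; apply/eqP.
rewrite (rnorm2B dotP) nz rnormZ rnorm_conj dotZr conj_conjc conjcK.
rewrite (dot_conj dot z') yz rmorphM /= mulrA mul_conj conj_conjc conjc_real realCM /=.
by rewrite exprMn; ring.
Qed.

(** Since [A] is closed, its domain consists of all [x] for which the formal
    coordinates of [A x] are those of a vector. *)
Lemma dom_intro x y : (forall n, P n y = lam n *: P n x) -> dom A x /\ A x = y.
Proof.
move=> xy.
have hs (s : seq int) : dom A (\sum_(n <- s) P n x) /\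
    A (\sum_(n <- s) P n x) = \sum_(n <- s) P n y.
  elim: s => [|n s [ds As]].
    rewrite !big_nil; split; first exact: linA.1.
    have [d1 A1] := domD linA.1 linA.1.
    by move: A1; rewrite addr0 => /eqP; rewrite -subr_eq subrr => /eqP <-.
  have [dn An] := AP n x; have [dn' An'] := domD dn ds.
  by rewrite !big_cons An' As An xy.
suff [dx /= yA] : [set p : H * H | dom A p.1 /\ p.2 = A p.1] (x, y) by [].

pose f (F : {fset int}) : H * H :=
  (summability.partial_sum (fun n => P n x) F, summability.partial_sum (fun n => P n y) F).
have near_f : \forall F \near @summability.totally int,
    [set p : H * H | dom A p.1 /\ p.2 = A p.1] (f F).
  apply: near_totally; exists fset0 => F _; rewrite /f !psumE /=.
  by have [] := hs F.
apply: (closed_cvg _ clA near_f).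
by apply: cvg_pair; exact: (proj_psum resP).
Qed.

Section Commutator.
Variable d : R.
Hypotheses (d0 : 0 < d) (lam_sep : forall m n, m != n -> d <= rnorm (lam m - lam n)).

(** The equation [A Y - Y A = X - J X] that [Gamma] is made for: in coordinates,
    the factor [lam m - lam n] of the commutator cancels the denominator. *)
Lemma Gamma_comm X c x : HSle dot X c -> dom A x ->
  dom A (Gammatransform lam P X x) /\
  A (Gammatransform lam P X x) =
    Gammatransform lam P X (A x) + (X x - Jtransform P X x).
Proof.
move=> hX dx; have lX := HSle_linear hX; apply: dom_intro => m.
rewrite (linD (Plin m)) (linB (Plin m)) !(GammaE dotP resP d0 lam_sep hX).
rewrite (JE dotP resP hX) -(linB (Plin m)) -(linD (Plin m)) -(linZ (Plin m)).
rewrite -(linB lX) -(linD lX) -(linZ lX); congr (P m (X _)).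
apply: (proj_ext resP) => n.
rewrite (linD (Plin n)) (linB (Plin n)) (linZ (Plin n)).
rewrite !(GdiagE dotP resP d0 lam_sep) proj_op// (proj_mul resP) !scalerA /gcoef.
have [->|mn] := eqVneq m n; first by rewrite mul0r mulr0 !scale0r subrr addr0.
rewrite subr0 -[X in _ + X]scale1r -scalerDl; congr (_ *: _).
have nz : lam m - lam n != 0.
  apply: contraTneq (lam_sep mn) => ->; rewrite rnorm0 -ltNge //.
by field.
Qed.

End Commutator.

End Operator.

Lemma resolventP (R : realType) (H : normedModType R[i]) (A : operator H) z :
  resolvent_set A z -> is_resolvent A z (resolvent A z).
Proof. by move=> [T hT]; exact: (xgetPex (fun=> 0) (ex_intro _ T hT)). Qed.

Lemma opnorm_opbound (R : realType) (H : normedModType R[i]) (T : H -> H) :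
  bounded_op T -> opbound T (opnorm T).
Proof.
move=> /bounded_opP[lT [M M0 hM]] x.
have [->|x0] := eqVneq x 0; first by rewrite (lin0 lT) !rnorm0 mulr0.
have nx : 0 < rnorm x.
  by rewrite lt_def rnorm_ge0 andbT; apply: contraNneq x0 => /rnorm_eq0 ->.
rewrite -ler_pdivrMr// mulrC.
have -> : (rnorm x)^-1 * rnorm (T x) = rnorm (T (((rnorm x)^-1)%:C *: x)).
  by rewrite (linZ lT) rnormZ rnorm_real ger0_norm// invr_ge0 rnorm_ge0.
apply: ub_le_sup.
  exists M => _ /= [y y1 <-]; rewrite (le_trans (hM y))// ler_piMr//.
exists (((rnorm x)^-1)%:C *: x) => //=.
by rewrite rnormZ rnorm_real ger0_norm ?invr_ge0 ?rnorm_ge0// mulVf// gt_eqF.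
Qed.

(** * Similarity *)

Section Similarity.
Variables (R : realType) (H : completeNormedModType R[i]).
Variables (A : operator H) (U V B Y : H -> H) (q c : R).
Hypotheses (linA : linear_operator A)
  (smallA : forall eps : R, 0 < eps ->
       exists2 z, resolvent_set A z & opnorm (resolvent A z) < eps)
  (lU : linear U) (hU : opbound U q) (q01 : 0 <= q < 1)
  (lY : linear Y) (hY : opbound Y c) (lB : linear B)
  (AU : forall x, dom A x -> dom A (U x) /\ A (U x) = U (A x) + Y x)
  (UV : forall x, Y x + V x = B (U x) - U (V x) + B x).

Let W := idfun \+ U.

Lemma W_dom x : dom A x -> dom A (W x).
Proof. by move=> dx; have [dU _] := AU dx; have [] := domD linA dx dU. Qed.

(** Surjectivity on the domain: for a resolvent [T] of small norm,
    [(1 + U) T = T (1 + U + Y T)], and [1 + U + Y T] is invertible. *)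
Lemma W_dom_image : W @` dom A = dom A.
Proof.
have /andP[q0 q1] := q01.
apply/seteqP; split=> [_ [x dx <-]|y dy]; first exact: W_dom.
pose eps := (1 - q) / (2 * (`|c| + 1)).
have c1 : 0 < `|c| + 1 by rewrite ltr_wpDl.
have eps0 : 0 < eps by rewrite divr_gt0 ?subr_gt0// mulr_gt0.
have [z rz nz] := smallA eps0; have [bT hT1 hT2] := resolventP rz.
set T := resolvent A z in nz bT hT1 hT2.
have hT : opbound T eps.
  move=> x; rewrite (le_trans (opnorm_opbound bT x))// ler_wpM2r ?rnorm_ge0//.
  exact: ltW.
have lT : linear T by case: bT.
pose N := U \+ (Y \o T).
have lN : linear N.
  move=> a u v; rewrite /N /= (linD lU) (linZ lU) (linD lT) (linZ lT) (linD lY) (linZ lY).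
  by rewrite addrACA scalerDr.
have qe : q + `|c| * eps < 1.
  rewrite /eps; have : `|c| * ((1 - q) / (2 * (`|c| + 1))) <= (1 - q) / 2.
    have -> : `|c| * ((1 - q) / (2 * (`|c| + 1))) = (1 - q) / 2 * (`|c| / (`|c| + 1)).
      by move: (`|c|) c1 => k k1; field; rewrite gt_eqF.
    rewrite ler_piMr//; first by rewrite divr_ge0// subr_ge0 ltW.
    by rewrite ler_pdivrMr// mul1r lerDl.
  by lra.
have hN : opbound N (q + `|c| * eps).
  move=> x; rewrite (le_trans (rnormD _ _))// mulrDl lerD//.
  rewrite (le_trans (hY _))// -mulrA; apply: (@le_trans _ _ (`|c| * rnorm (T x))).
    by rewrite ler_wpM2r ?rnorm_ge0// ler_norm.
  by rewrite ler_wpM2l.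
have [|N' [_ _ NK]] := neumann lN hN.
  by rewrite qe addr_ge0// mulr_ge0// ltW.
set w := A y - z *: y; set u := N' w.
have uw : u + N u = w by exact: NK.
have [dx Ax] := hT1 u; exists (T u) => //.
have [dU EU] := AU dx; have [dW EW] := domD linA dx dU.
rewrite -(hT2 _ dy) -/w -uw -[LHS](hT2 _ dW); congr (T _).
rewrite EW EU scalerDr opprD addrACA Ax; congr (_ + _).
by rewrite /N /= addrAC -(linZ lU) -(linB lU) Ax.
Qed.

(** Expanding both sides, [A U - U A = Y] leaves exactly the equation [UV]. *)
Lemma W_intertwines x : dom A x -> sub_operator A B (W x) = W (sub_operator A V x).
Proof.
move=> dx; have [dU EU] := AU dx; have [_ EW] := domD linA dx dU.
have -> : W (sub_operator A V x) = (A x - V x) + U (A x - V x) by [].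
have -> : sub_operator A B (W x) = A (x + U x) - B (x + U x) by [].
rewrite EW EU (linD lB) (linB lU).
have -> : Y x = B (U x) - U (V x) + B x - V x by rewrite -UV addrK.
move: (A x) (U (A x)) (B x) (B (U x)) (U (V x)) (V x) => a u e p r v.
by rewrite opprD !addrA (ACl (1*6*2*4*5*7*3*8)) /= !addrK.
Qed.

Lemma similar_by_W : similar_by (sub_operator A B) (sub_operator A V) W.
Proof.
split.
- by apply: bounded_opD; [exact: bounded_op_id|exact: bounded_op_of hU].
- exact: (neumann lU hU q01).
- exact: W_dom_image.
- exact: W_intertwines.
Qed.

End Similarity.

(** * Finite-dimensional blocks *)

Section Block.
Variables (R : realType) (H : completeNormedModType R[i]) (dot : {dot H for (@Num.conj R[i])}).
Hypothesis dotP : norm_from_dot dot.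
Implicit Types (x y : H).

Section Combination.
Variable k : nat.
Implicit Types (f g : 'I_k -> H) (a : 'rV[R[i]]_k).

Definition lincomb f a := \sum_i a 0 i *: f i.

Lemma lincomb_dot f g a a' : dot (lincomb f a) (lincomb g a') =
  \sum_i \sum_j a 0 i * Num.conj (a' 0 j) * dot (f i) (g j).
Proof.
rewrite /lincomb dot_suml; apply: eq_bigr => i _; rewrite dot_sumr.
by apply: eq_bigr => j _; rewrite dotZl dotZr mulrA.
Qed.

Definition orthonormal_family f := forall i j, dot (f i) (f j) = (i == j)%:R.

Lemma gram_transform (M : 'M[R[i]]_k) f g (Q : 'M[R[i]]_k) i l :
  (forall j m, dot (f j) (g m) = M j m) ->
  dot (lincomb f (row i Q)) (lincomb g (row l Q)) = (Q *m M *m map_mx Num.conj Q^T) i l.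
Proof.
move=> fM; rewrite lincomb_dot !mxE.
under eq_bigr do under eq_bigr do rewrite !mxE fM.
rewrite exchange_big; apply: eq_bigr => j _ /=; rewrite !mxE mulr_suml.
by apply: eq_bigr => m _; rewrite mulrAC.
Qed.

End Combination.

Section Projection.
Variables (P : H -> H) (k : nat).
Hypotheses (idP : forall x, P (P x) = P x) (adjP : has_adj dot P P)
  (dimP : has_dimension (range P) k).

(** Orthonormalization by diagonalizing the Gram matrix of a basis. *)
Lemma orthonormal_basis_of_range : exists f : 'I_k -> H,
  orthonormal_family f /\ forall x, P x = \sum_i dot x (f i) *: f i.
Proof.
have [e [freeE spanE]] := dimP.
pose G : 'M[R[i]]_k := \matrix_(i, j) dot (e i) (e j).
have nG : G \is normalmx.
  apply: hermitian_normalmx; apply/is_hermitianmxP; rewrite expr0 scale1r.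
  by apply/matrixP => i j; rewrite !mxE dot_conj.
pose Q := spectralmx G; have uQ : Q \is unitarymx := spectral_unitarymx G.
have QG : Q *m G *m map_mx Num.conj Q^T = diag_mx (spectral_diag G).
  have /orthomx_spectralP EG := nG.
  rewrite {1}EG !mulmxA mulmxV ?spectral_unit// mul1mx.
  by rewrite mulmxtVK.
pose g i := lincomb e (row i Q).
have gg i l : dot (g i) (g l) = diag_mx (spectral_diag G) i l.
  by rewrite -QG; apply: gram_transform => j m; rewrite mxE.
have g0 i : g i != 0.
  apply/eqP => gi0; have /freeE ci : \sum_j Q i j *: e j = 0.
    by rewrite -[RHS]gi0 /g /lincomb; apply: eq_bigr => j _; rewrite mxE.
  have := unitarymxP uQ => /matrixP/(_ i i); rewrite !mxE eqxx.
  under eq_bigr do rewrite ci mul0r.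
  by rewrite big1// => /esym/eqP; rewrite oner_eq0.
have ng i : rnorm (g i) != 0 by apply: contraNneq (g0 i) => /rnorm_eq0 ->.
pose f i := ((rnorm (g i))^-1)%:C *: g i.
have fo : orthonormal_family f.
  move=> i j; rewrite /f dotZl dotZr conj_conjc conjc_real.
  have [<-|ij] := eqVneq i j.
    by rewrite (dotxx dotP) !realCM expr2 mulKf// mulVf.
  by rewrite gg mxE (negbTE ij) mulr0n !mulr0.
exists f; split=> // x.
have fP i : P (f i) = f i.
  have : range P (f i).
    rewrite spanE; exists (fun j => ((rnorm (g i))^-1)%:C * Q i j).
    by rewrite /f /g /lincomb scaler_sumr; apply: eq_bigr => j _; rewrite mxE scalerA.
  by move=> [y _ <-]; rewrite idP.
have [c Ec] : exists c : 'rV_k, P x = lincomb f c.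
  have : range P (P x) by exists x.
  rewrite spanE => -[c ->].
  pose c' : 'rV[R[i]]_k := \row_j c j *m map_mx Num.conj Q^T.
  exists (\row_i (c' 0 i * (rnorm (g i))%:C)); rewrite /lincomb.
  under [RHS]eq_bigr do rewrite mxE /f scalerA -mulrA realCM mulfV// mulr1 /g /lincomb scaler_sumr.
  rewrite exchange_big /=; apply: eq_bigr => j _.
  under eq_bigr do rewrite mxE scalerA.
  rewrite -scaler_suml; congr (_ *: _).
  have := mulmxKtV (\row_j c j) uQ erefl => /rowP/(_ j).
  rewrite !mxE => <-; apply: eq_bigr => i _.
  by rewrite [row i Q _ _]mxE; congr (_ * _); rewrite mxE.
rewrite Ec /lincomb; apply: eq_bigr => i _; congr (_ *: _).
rewrite -[f i in RHS]fP -adjP Ec /lincomb dot_suml (bigD1 i)//= big1 => [|j ji].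
  by rewrite dotZl fo eqxx mulr1 addr0.
by rewrite dotZl fo (negbTE ji) mulr0.
Qed.

Variable V : H -> H.
Hypotheses (lV : linear V) (PV : forall x, P (V x) = V (P x)).

(** Schur's theorem, for a block of an operator. *)
Lemma triangular_basis_of_range : exists f : 'I_k -> H,
  [/\ orthonormal_family f, forall x, P x = \sum_i dot x (f i) *: f i
    & forall i j : 'I_k, (i < j)%N -> dot (V (f i)) (f j) = 0].
Proof.
have [e [eo eP]] := orthonormal_basis_of_range.
pose M : 'M[R[i]]_k := \matrix_(i, j) dot (V (e i)) (e j).
have [Q uQ /andP[tQ _]] := @cotrigonalization2 _ _ M M erefl.
have QQ := unitarymxP uQ.
have QQ' : map_mx Num.conj Q^T *m Q = 1%:M.
  by have := mulmxKtV 1%:M uQ erefl; rewrite mul1mx.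
pose f i := lincomb e (row i Q).
have fo : orthonormal_family f.
  move=> i j; rewrite (@gram_transform _ 1%:M); last by move=> l m; rewrite eo mxE.
  by rewrite mulmx1 QQ mxE.
exists f; split=> // [x|i j ij].
- rewrite eP; apply/esym; rewrite /f /lincomb.
  under eq_bigr do rewrite dot_sumr scaler_sumr.
  rewrite exchange_big; apply: eq_bigr => j _ /=.
  transitivity (\sum_i \sum_l (dot x (e l) * ((Num.conj (Q i l)) * Q i j)) *: e j).
    apply: eq_bigr => i _; rewrite scalerA mulr_suml scaler_suml; apply: eq_bigr => l _.
    by rewrite !mxE dotZr mulrAC mulrC mulrA.
  rewrite exchange_big /= (bigD1 j)//= [X in _ + X]big1 => [|l lj].
    rewrite addr0 -scaler_suml -mulr_sumr.
    have /matrixP/(_ j j) := QQ'; rewrite !mxE eqxx.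
    by under eq_bigr do rewrite !mxE; move=> ->; rewrite mulr1.
  rewrite -scaler_suml -mulr_sumr.
  have /matrixP/(_ l j) := QQ'; rewrite !mxE (negbTE lj).
  by under eq_bigr do rewrite !mxE; move=> ->; rewrite mulr0 scale0r.
- have -> : V (f i) = lincomb (V \o e) (row i Q).
    by rewrite /f /lincomb (lin_sum lV); apply: eq_bigr => l _; rewrite (linZ lV).
  rewrite (@gram_transform _ M); last by move=> l m; rewrite mxE.
  move: tQ; rewrite /similar_to /= conjymx// => /is_trig_mxP; exact.
Qed.

Section Triangular.
Variable f : 'I_k -> H.
Hypotheses (fo : orthonormal_family f) (fP : forall x, P x = \sum_i dot x (f i) *: f i)
  (ft : forall i j : 'I_k, (i < j)%N -> dot (V (f i)) (f j) = 0).

Let L : 'M[R[i]]_k := \matrix_(i, j) dot (V (f i)) (f j).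

Let linP : linear P := adj_linear dotP adjP.

Lemma lincomb_coord a i : dot (lincomb f a) (f i) = a 0 i.
Proof.
rewrite /lincomb dot_suml (bigD1 i)//= big1 => [|j ji].
  by rewrite dotZl fo eqxx mulr1 addr0.
by rewrite dotZl fo (negbTE ji) mulr0.
Qed.

Lemma lincomb_proj a : P (lincomb f a) = lincomb f a.
Proof. by rewrite fP; apply: eq_bigr => i _; rewrite lincomb_coord. Qed.

Lemma basis_proj i : P (f i) = f i.
Proof.
rewrite fP (bigD1 i)//= big1 => [|j ji]; first by rewrite fo eqxx scale1r addr0.
by rewrite fo eq_sym (negbTE ji) scale0r.
Qed.

Lemma lincomb_op a : V (lincomb f a) = lincomb f (a *m L).
Proof.
rewrite -[a in LHS]trmxK -lincomb_proj -PV fP; apply: eq_bigr => j _; congr (_ *: _).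
rewrite trmxK /lincomb (lin_sum lV) dot_suml mxE; apply: eq_bigr => i _.
by rewrite (linZ lV) dotZl mxE.
Qed.

Lemma lincombZ (c : R[i]) a : c *: lincomb f a = lincomb f (c *: a).
Proof. by rewrite /lincomb scaler_sumr; apply: eq_bigr => i _; rewrite mxE scalerA. Qed.

Lemma lincombB a a' : lincomb f a - lincomb f a' = lincomb f (a - a').
Proof. by rewrite /lincomb -sumrB; apply: eq_bigr => i _; rewrite !mxE scalerBl. Qed.

Lemma block_det (c : R[i]) : \det (c%:M - L) = \prod_i (c - dot (V (f i)) (f i)).
Proof.
rewrite det_trig; first by apply: eq_bigr => i _; rewrite !mxE eqxx mulr1n.
apply/is_trig_mxP => i j ij; by rewrite !mxE ft// subr0 -val_eqE /= ltn_eqF// mulr0n.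
Qed.

Lemma block_eigenvector i : exists v, [/\ v != 0, P v = v & V v = dot (V (f i)) (f i) *: v].
Proof.
set b := dot _ _; have /eqP : \det (b%:M - L) = 0.
  by rewrite block_det (bigD1 i)//= /b subrr mul0r.
move=> /det0P[a a0 aL]; exists (lincomb f a); split.
- apply: contraNneq a0 => fa; apply/eqP/rowP => j.
  by rewrite -lincomb_coord fa dot0l mxE.
- exact: lincomb_proj.
- apply/eqP; rewrite eq_sym -subr_eq0 lincomb_op lincombZ lincombB.
  rewrite (_ : b *: a - a *m L = 0) ?/lincomb.
    by rewrite big1// => j _; rewrite mxE scale0r.
  by rewrite -aL mulmxBr mul_mx_scalar.
Qed.

(** The triangular matrix [c - L] is invertible when [c] avoids its diagonal. *)
Lemma block_inverse (c : R[i]) : (forall i, c != dot (V (f i)) (f i)) ->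
  exists T, [/\ linear T, exists2 M, 0 <= M & opbound T M, forall x, P (T x) = T x,
      forall x, c *: T x - V (T x) = P x & forall x, T (c *: x - V x) = P x].
Proof.
move=> cb; have uL : c%:M - L \in unitmx.
  rewrite unitmxE block_det unitfE; apply/prodf_neq0 => i _.
  by rewrite subr_eq0.
pose co x : 'rV[R[i]]_k := \row_i dot x (f i).
pose T x := lincomb f (co x *m invmx (c%:M - L)).
exists T; split.
- move=> a x y; rewrite /T /lincomb scaler_sumr -big_split; apply: eq_bigr => i _ /=.
  rewrite scalerA -scalerDl; congr (_ *: _).
  rewrite !mxE mulr_sumr -big_split; apply: eq_bigr => j _ /=.
  by rewrite !mxE dotDl dotZl mulrDl mulrA.
- exists (\sum_i (\sum_j rnorm (invmx (c%:M - L) j i) * rnorm (f j)) * rnorm (f i)).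
    by do 2!(apply: sumr_ge0 => ? _; rewrite ?mulr_ge0 ?rnorm_ge0//).
  move=> x; rewrite /T (le_trans (rnorm_sum _ _))// mulr_suml; apply: ler_sum => i _.
  rewrite rnormZ mulrAC ler_wpM2r ?rnorm_ge0// mxE (le_trans (rnorm_sum _ _))// mulr_suml.
  apply: ler_sum => j _; rewrite rnormM !mxE mulrC -mulrA ler_wpM2l ?rnorm_ge0//.
  by rewrite mulrC cauchy_schwarz.
- by move=> x; exact: lincomb_proj.
- move=> x; rewrite /T lincombZ lincomb_op lincombB -mul_mx_scalar -mulmxBr.
  rewrite mulmxKV// fP /lincomb; apply: eq_bigr => i _.
  by rewrite mxE.
- move=> x; have Px : P x = lincomb f (co x).
    by rewrite fP; apply: eq_bigr => i _; rewrite mxE.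
  have coE y i : co y 0 i = dot (P y) (f i) by rewrite mxE adjP basis_proj.
  rewrite /T (_ : co _ = co x *m (c%:M - L)) ?mulmxK//.
  apply/rowP => i; rewrite coE (linB linP) (linZ linP) PV Px lincombZ lincomb_op lincombB.
  by rewrite lincomb_coord mulmxBr mul_mx_scalar.
Qed.

End Triangular.
End Projection.
End Block.

(** * Resolvents and spectrum of a block diagonal perturbation *)

Section ResolventTransfer.
Variables (R : realType) (H : normedModType R[i]).
Variables (A1 A2 : operator H) (W W' : H -> H).
Hypotheses (sim : similar_by A1 A2 W) (invW : inverse_op W W').

Let linW : linear W. Proof. by case: sim => -[]. Qed.

Lemma similar_resolvent z S : is_resolvent A2 z S -> is_resolvent A1 z (W \o S \o W').
Proof.
move=> [bS hS1 hS2]; have [bW _ WD WA] := sim; have [bW' WK WK'] := invW.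
split; [by apply: bounded_op_comp => //; exact: bounded_op_comp| |].
- move=> y /=; have [dS ES] := hS1 (W' y); split; first by rewrite -WD; exists (S (W' y)).
  by rewrite WA// -(linZ linW) -(linB linW) ES WK'.
- move=> x; rewrite -WD => -[x' dx' <-] /=.
  by rewrite WA// -(linZ linW) -(linB linW) WK hS2.
Qed.

Lemma similar_resolvent_inv z S : is_resolvent A1 z S -> is_resolvent A2 z (W' \o S \o W).
Proof.
move=> [bS hS1 hS2]; have [bW _ WD WA] := sim; have [bW' WK WK'] := invW.
split; [by apply: bounded_op_comp => //; exact: bounded_op_comp| |].
- move=> y /=; have [+ ES] := hS1 (W y); rewrite -{1}WD => -[x' dx' Ex'].
  rewrite -Ex' WK; split=> //; apply: (can_inj WK).
  by rewrite (linB linW) (linZ linW) -WA// Ex'.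
- move=> x dx /=; rewrite (linB linW) (linZ linW) -WA// hS2 ?WK//.
  by rewrite -WD; exists x.
Qed.

Lemma similar_resolvent_set : resolvent_set A1 = resolvent_set A2.
Proof.
apply/seteqP; split=> z [S hS].
  by exists (W' \o S \o W); exact: similar_resolvent_inv.
by exists (W \o S \o W'); exact: similar_resolvent.
Qed.

Lemma resolvent_unique (A : operator H) z S S' :
  is_resolvent A z S -> is_resolvent A z S' -> S = S'.
Proof.
move=> [_ h1 h2] [_ h1' h2']; apply/funext => y; have [d E] := h1' y.
by rewrite -{1}E h2.
Qed.

Lemma resolvent_eq (A : operator H) z S : is_resolvent A z S -> resolvent A z = S.
Proof. by move=> hS; apply: (resolvent_unique _ hS); apply: resolventP; exists S. Qed.

End ResolventTransfer.

Section BlockDiagonal.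
Variables (R : realType) (H : completeNormedModType R[i]) (dot : {dot H for (@Num.conj R[i])}).
Hypothesis dotP : norm_from_dot dot.
Variable P : int -> H -> H.
Hypothesis resP : resolution_of_identity dot P.
Variables (V : H -> H) (v : R).
Hypotheses (lV : linear V) (hV : opbound V v) (v0 : 0 <= v)
  (PV : forall n x, P n (V x) = V (P n x)).
Variables (mult : int -> nat) (f : forall n, 'I_(mult n) -> H).
Arguments f : clear implicits.
Hypotheses (fo : forall n, orthonormal_family dot (f n))
  (fP : forall n x, P n x = \sum_i dot x (f n i) *: f n i)
  (ft : forall n (i j : 'I_(mult n)), (i < j)%N -> dot (V (f n i)) (f n j) = 0).

Let Plin := proj_linear resP.

(** The eigenvalues of the blocks, read off the triangular form. *)
Definition block_eig (n : int) (i : 'I_(mult n)) : R[i] := dot (V (f n i)) (f n i).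

Lemma basis_norm (n : int) (i : 'I_(mult n)) : rnorm (f n i) = 1.
Proof.
have : rnorm (f n i) ^+ 2 = 1 by rewrite (rnorm2E dotP) fo eqxx.
by move=> /eqP; rewrite sqrp_eq1 ?rnorm_ge0// => /eqP.
Qed.

Lemma block_eig_le (n : int) (i : 'I_(mult n)) : rnorm (block_eig i) <= v.
Proof.
rewrite (le_trans (cauchy_schwarz dotP _ _))// basis_norm mulr1.
by rewrite (le_trans (hV _))// basis_norm mulr1.
Qed.

Lemma block_lower (c : R[i]) (r : R) x : r <= rnorm c ->
  (r - v) * rnorm x <= rnorm (c *: x - V x).
Proof.
move=> rc; have := rnorm_tri (V x) (c *: x) 0; rewrite !subr0 rnormZ mulrBl => h.
have h1 := hV x; have h2 := ler_wpM2r (rnorm_ge0 x) rc; lra.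
Qed.

(** The blocks are inverted one at a time.  Where [|c n| >= v + 1] the inverse has
    norm at most one, and finitely many other blocks cannot spoil a uniform
    bound. *)
Lemma block_diagonal_inverse (c : int -> R[i]) (F : {fset int}) :
  (forall n i, c n != block_eig (n := n) i) ->
  (forall n, n \notin F -> v + 1 <= rnorm (c n)) ->
  exists S, [/\ bounded_op S, forall n x, c n *: P n (S x) - V (P n (S x)) = P n x
    & forall n x y, P n y = c n *: P n x - V (P n x) -> P n (S y) = P n x].
Proof.
move=> cb cF.
have ex n := @block_inverse _ _ _ dotP (P n) _ (proj_adj resP n) V lV (PV n) (f n)
  (@fo n) (fP n) (@ft n) (c n) (cb n).
have [T hT] := choice ex.
have lT n : linear (T n) by case: (hT n).
have exM n : exists M, 0 <= M /\ opbound (T n) M by have [_ [M ? ?] _ _ _] := hT n; exists M.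
have [M hM] := choice exM.
have hT1 n : n \notin F -> opbound (T n) 1.
  move=> nF x; have [_ _ _ E _] := hT n.
  have := block_lower (T n x) (cF n nF); rewrite E addrAC subrr add0r mul1r => h.
  by rewrite (le_trans h)//; exact: (proj_opbound dotP resP).
pose K := 1 + \sum_(n <- F) M n.
have M0 n : 0 <= M n by case: (hM n).
have K0 : 0 <= K by rewrite addr_ge0// sumr_ge0.
have hK n : opbound (T n) K.
  move=> x; case: (boolP (n \in F)) => nF.
    have [_ h] := hM n; rewrite (le_trans (h x))// ler_wpM2r ?rnorm_ge0//.
    rewrite /K (big_fsetD1 n)//= addrCA lerDl addr_ge0// sumr_ge0//.
  rewrite (le_trans (hT1 _ nF x))// ler_wpM2r ?rnorm_ge0// /K lerDl sumr_ge0//.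
have rb : rowbound P (fun n => T n \o P n) K.
  move=> x; rewrite exprMn EFinM -(proj_parseval dotP resP).
  apply: le_trans (esumZ_le _ _ _); rewrite ?sqr_ge0//; last by move=> i; rewrite lee_fin sqr_ge0.
  apply: le_esum => n _; have [_ _ TP _ _] := hT n; rewrite /= TP -EFinM lee_fin -exprMn.
  by rewrite ler_pXn2r ?nnegrE ?mulr_ge0 ?rnorm_ge0//; exact: hK.
pose S := rowop P (fun n => T n \o P n); have PS n x : P n (S x) = T n (P n x).
  by rewrite (rowopE dotP resP rb) /=; have [_ _ TP _ _] := hT n; rewrite TP.
exists S; split.
- apply: (rowop_bounded dotP resP rb) => // n a x y.
  by rewrite /= (linD (Plin n)) (linZ (Plin n)) (linD (lT n)) (linZ (lT n)).
- by move=> n x; rewrite PS; have [_ _ _ -> _] := hT n; rewrite (proj_idem resP).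
- by move=> n x y Ey; rewrite PS Ey; have [_ _ _ _ ->] := hT n; rewrite (proj_idem resP).
Qed.

Lemma block_diagonal_bound (c : int -> R[i]) (r : R) S : v < r ->
  (forall n, r <= rnorm (c n)) ->
  (forall n x, c n *: P n (S x) - V (P n (S x)) = P n x) -> opbound S (r - v)^-1.
Proof.
move=> vr rc hS x; have rv : 0 < r - v by rewrite subr_gt0.
have ri : 0 <= (r - v)^-1 by rewrite invr_ge0 ltW.
rewrite -(ler_pXn2r (_ : (0 < 2)%N)) ?nnegrE ?mulr_ge0 ?rnorm_ge0// exprMn.
rewrite -lee_fin -(proj_parseval dotP resP) EFinM -(proj_parseval dotP resP).
apply: le_trans (esumZ_le _ _ _); rewrite ?sqr_ge0//; last by move=> i; rewrite lee_fin sqr_ge0.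
apply: le_esum => n _; rewrite -EFinM lee_fin -exprMn.
rewrite ler_pXn2r ?nnegrE ?mulr_ge0 ?rnorm_ge0// mulrC ler_pdivlMr// mulrC.
by rewrite -(hS n x) block_lower.
Qed.

Variables (A : operator H) (lam : int -> R[i]).
Hypotheses (linA : linear_operator A) (clA : closed_operator A)
  (normA : normal_operator dot A)
  (AP : forall n x, dom A (P n x) /\ A (P n x) = lam n *: P n x)
  (lam_large : forall L : R, exists F : {fset int}, forall n, n \notin F -> L <= rnorm (lam n)).

(** All but finitely many blocks [lam n - z - V] are bounded below, since the
    eigenvalues of [A] tend to infinity. *)
Lemma block_resolvent z : (forall n i, z != lam n - block_eig (n := n) i) ->
  exists S, is_resolvent (sub_operator A V) z S /\
    forall n x, (lam n - z) *: P n (S x) - V (P n (S x)) = P n x.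
Proof.
move=> zb; have [F hF] := lam_large (v + 1 + rnorm z).
have [|n nF|S [bS hS1 hS2]] := @block_diagonal_inverse (fun n => lam n - z) F.
- by move=> n i; apply: contra (zb n i) => /eqP <-; rewrite subKr.
- have := crnorm_tri z (lam n) 0; rewrite !subr0 => h.
  by have h' := hF n nF; lra.
exists S; split=> //; split=> // [y|x dx].
- have [|dS ES] := @dom_intro _ _ _ _ resP _ lam linA clA AP (S y) (y + z *: S y + V (S y)).
    move=> n; rewrite !(linD (Plin n)) (linZ (Plin n)) PV -(hS1 n y) scalerBl.
    by rewrite addrAC subrK subrK.
  split=> //=; rewrite ES addrK addrK//.
- apply: (proj_ext resP) => n; apply: hS2.
  rewrite /= !(linB (Plin n)) (linZ (Plin n)) PV (proj_op dotP resP normA AP)//.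
  by rewrite scalerBl addrAC.
Qed.

(** Off the shifted eigenvalues the blocks are inverted together; at a shifted
    eigenvalue a block has an eigenvector. *)
Lemma block_spectrum : spectrum (sub_operator A V) =
  \bigcup_n [set lam n - block_eig i | i in [set: 'I_(mult n)]].
Proof.
apply/seteqP; split=> z /=.
  move=> nz; apply: contrapT => zb; apply: nz.
  have [|S [hS _]] := @block_resolvent z; last by exists S.
  by move=> n i; apply/eqP => Ez; apply: zb; exists n => //; exists i.
move=> [n _ [i _ <-]] [T [bT _ hT]].
have [w [w0 Pw Vw]] := block_eigenvector lV (PV n) (@fo n) (fP n) (@ft n) i.
have [dw Aw] := AP n w; rewrite Pw in dw Aw.
have [lT _] := bT.
move: w0; rewrite -(hT w dw) /= Aw Vw -scalerBl -/(block_eig i) subrr (lin0 lT).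
by rewrite eqxx.
Qed.

End BlockDiagonal.

(** The terms [|lam n - lam 0| ^ -2] of a finite sum tend to zero. *)
Lemma eigenvalues_large (R : realType) (lam : int -> R[i]) : injective lam ->
  (ereal_sup [set \esum_(n in [set n | n != j])
     (rnorm (lam n - lam j) ^- 2)%:E | j in [set: int]] < +oo)%E ->
  forall L : R, exists F : {fset int}, forall n, n \notin F -> L <= rnorm (lam n).
Proof.
move=> lam_inj h L.
have hz : (\esum_(n in [set n : int | n != 0%R]) (rnorm (lam n - lam 0) ^- 2)%:E < +oo)%E.
  by apply: le_lt_trans h; apply: ereal_sup_ubound; exists 0.
pose a n := if n \in [set n : int | n != 0] then rnorm (lam n - lam 0) ^- 2 else 0.
have a0 n : 0 <= a n by rewrite /a; case: ifP => // _; rewrite invr_ge0 sqr_ge0.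
have {}h : (\esum_(n in setT) (a n)%:E < +oo)%E.
  rewrite esum_mkcond in hz; apply: (le_lt_trans _ hz); apply: le_esum => n _.
  by rewrite /a; case: ifP.
(* The summand [1] makes [L'] positive. *)
pose L' := `|L| + rnorm (lam 0) + 1.
have L0 : 0 < L' by rewrite ltr_wpDl// addr_ge0// rnorm_ge0.
have L2 : 0 < L' ^- 2 by rewrite invr_gt0 exprn_gt0.
have [F hF] := esum_tail a0 h L2.
exists (F `|` [fset 0])%fset => n; rewrite !inE negb_or => /andP[nF n0].
have : \sum_(i <- [fset n]%fset) a i < L' ^- 2.
  by apply: hF; apply/fdisjointP => x xF; rewrite !inE; apply: contraNneq nF => <-.
rewrite big_seq_fset1 /a mem_set//=.
have nz : 0 < rnorm (lam n - lam 0).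
  by apply: rnorm_gt0; rewrite subr_eq0 (inj_eq lam_inj).
rewrite ltf_pV2 ?posrE ?exprn_gt0// ltr_pXn2r ?nnegrE ?(ltW nz) ?(ltW L0)// => h1.
have := rnormB (lam n) (lam 0); have := ler_norm L; move: h1; rewrite /L'.
by lra.
Qed.

(** * Integrals over a circle *)

Section CircleIntegral.
Variable R : realType.
Local Notation mu := (@lebesgue_measure R).
Local Notation D := `[0%R, 2 * pi : R]%classic.

Definition cint (h : R -> R[i]) : R[i] :=
  (\int[mu]_(t in D) complex.Re (h t)) +i* (\int[mu]_(t in D) complex.Im (h t)).

Lemma cintE h (a b : R -> R) : (forall t, complex.Re (h t) = a t) ->
  (forall t, complex.Im (h t) = b t) ->
  cint h = (\int[mu]_(t in D) a t) +i* (\int[mu]_(t in D) b t).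
Proof. by move=> ha hb; rewrite /cint; congr (_ +i* _); apply: eq_Rintegral => t _. Qed.

Definition ccontinuous (h : R -> R[i]) :=
  continuous (fun t => complex.Re (h t)) /\ continuous (fun t => complex.Im (h t)).

Lemma cont_integrable (f : R -> R) : continuous f -> mu.-integrable D (EFin \o f).
Proof.
move=> cf; apply: continuous_compact_integrable; first exact: segment_compact.
exact: continuous_subspaceT.
Qed.

Lemma pi2_gt0 : 0 < 2 * pi :> R.
Proof. by rewrite mulr_gt0// pi_gt0. Qed.

Lemma measure_D : fine (mu D) = 2 * pi.
Proof.
rewrite lebesgue_measure_itv /= lte_fin pi2_gt0 -EFinB /= subr0 //.
Qed.

Lemma ccontinuousD h h' : ccontinuous h -> ccontinuous h' -> ccontinuous (fun t => h t + h' t).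
Proof.
move=> [hr hi] [hr' hi']; split=> t.
  rewrite (_ : (fun t => _) = (fun t => complex.Re (h t) + complex.Re (h' t))).
    by apply: cvgD; [exact: hr|exact: hr'].
  by apply/funext => s; rewrite ReD.
rewrite (_ : (fun t => _) = (fun t => complex.Im (h t) + complex.Im (h' t))).
  by apply: cvgD; [exact: hi|exact: hi'].
by apply/funext => s; rewrite ImD.
Qed.

Lemma cintD h h' : ccontinuous h -> ccontinuous h' -> cint (fun t => h t + h' t) = cint h + cint h'.
Proof.
move=> [hr hi] [hr' hi'].
rewrite (cintE (fun t => ReD (h t) (h' t)) (fun t => ImD (h t) (h' t))) /cint.
by rewrite !RintegralD//; exact: cont_integrable.
Qed.

Lemma ccontinuousZ c h : ccontinuous h -> ccontinuous (fun t => c * h t).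
Proof.
case: c => a b [hr hi]; split=> t.
  rewrite (_ : (fun t => _) = (fun t => a * complex.Re (h t) - b * complex.Im (h t))).
    by apply: cvgB; apply: cvgM; [exact: cvg_cst|exact: hr|exact: cvg_cst|exact: hi].
  by apply/funext => s; case: (h s).
rewrite (_ : (fun t => _) = (fun t => a * complex.Im (h t) + b * complex.Re (h t))).
  by apply: cvgD; apply: cvgM; [exact: cvg_cst|exact: hi|exact: cvg_cst|exact: hr].
by apply/funext => s; case: (h s).
Qed.

Lemma cintZ c h : ccontinuous h -> cint (fun t => c * h t) = c * cint h.
Proof.
case: c => a b [hr hi].
have cZ (x : R) (f : R -> R) : continuous f -> continuous (fun t => x * f t).
  by move=> cf t; apply: cvgM; [exact: cvg_cst|exact: cf].
rewrite (@cintE _ (fun t => a * complex.Re (h t) - b * complex.Im (h t))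
   (fun t => a * complex.Im (h t) + b * complex.Re (h t))) /cint;
  [|by move=> t; case: (h t)|by move=> t; case: (h t)].
rewrite RintegralB ?RintegralD//; try exact/cont_integrable/cZ.
rewrite !RintegralZl//; try exact: cont_integrable.
Qed.

Lemma cint_bound h (e : R) : ccontinuous h -> (forall t, rnorm (h t) <= e) ->
  rnorm (cint h) <= 2 * (e * (2 * pi)).
Proof.
move=> [hr hi] he.
have bd (f : R -> R) : continuous f -> (forall t, `|f t| <= e) ->
    `|\int[mu]_(t in D) f t| <= e * (2 * pi).
  move=> cf fe; apply: (le_trans (@le_normr_Rintegral _ _ _ mu D f _ (cont_integrable cf))) => //.
  have -> : e * (2 * pi) = \int[mu]_(_ in D) e by rewrite Rintegral_cst// measure_D.
  apply: le_Rintegral => //.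
  - by apply: cont_integrable => t; apply: cvg_norm; exact: cf.
  - by apply: cont_integrable => t; exact: cvg_cst.
have h1 := bd _ hr (fun t => le_trans (Re_le_rnorm (h t)) (he t)).
have h2 := bd _ hi (fun t => le_trans (Im_le_rnorm (h t)) (he t)).
rewrite /cint; set a := Rintegral _ _ _ in h1 *; set b := Rintegral _ _ _ in h2 *.
have -> : a +i* b = a%:C + 'i * b%:C by rewrite [LHS]complexE.
apply: (le_trans (rnormD _ _)); rewrite rnormM !rnorm_real.
have -> : rnorm ('i%C : R[i]) = 1.
  by rewrite /rnorm normc_def /= expr0n expr1n add0r sqrtr1.
by rewrite mul1r; lra.
Qed.

(** The uniform limit [g] is continuous, hence integrable, so that the integrals
    of [g] and of its approximations can be subtracted. *)
Lemma cint_approx g L :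
  (forall e : R, 0 < e -> exists h, [/\ ccontinuous h, cint h = L
     & forall t, rnorm (g t - h t) <= e]) -> cint g = L.
Proof.
move=> gL.
have ng : ccontinuous g.
  have cont (p : R[i] -> R) : (forall z w, p (z - w) = p z - p w) ->
      (forall z, `|p z| <= rnorm z) ->
      (forall h, ccontinuous h -> continuous (fun t => p (h t))) -> continuous (fun t => p (g t)).
    move=> pB pn ph t; apply/cvgrPdist_lt => e e0.
    have e3 : 0 < e / 4 by rewrite divr_gt0.
    have [h [nh _ gh]] := gL _ e3.
    have /cvgrPdist_lt/(_ _ e3) := ph h nh t; apply: filterS => s hs.
    have b1 := le_trans (pn _) (gh t); have b2 := le_trans (pn _) (gh s).
    rewrite pB in b1; rewrite pB in b2.
    move: hs b1 b2; rewrite !ltr_norml !ler_norml => /andP[? ?] /andP[? ?] /andP[? ?].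
    by apply/andP; split; lra.
  split; apply: cont.
  - exact: ReB.
  - exact: Re_le_rnorm.
  - by move=> h [].
  - by move=> [? ?] [? ?].
  - exact: Im_le_rnorm.
  - by move=> h [].
apply/eqP; rewrite -subr_eq0; apply/eqP/rnorm_eps => e e0.
(* [cint_bound] loses the factor [4 pi]. *)
have e4 : 0 < e / (4 * pi) by rewrite divr_gt0// mulr_gt0// pi_gt0.
have [h [nh hL gh]] := gL _ e4.
have nb : ccontinuous (fun t => g t + (-1) * h t) by apply: ccontinuousD => //; exact: ccontinuousZ.
rewrite -hL -mulN1r -cintZ// -cintD//; last exact: ccontinuousZ.
apply: (le_trans (cint_bound nb (_ : forall t, _ <= e / (4 * pi)))).
  by move=> t; rewrite mulN1r.
rewrite le_eqVlt; apply/orP; left; apply/eqP.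
by have := pi_gt0 R; move: (pi : R) => p p0; field; rewrite gt_eqF.
Qed.

(** [e ^ (i x t)]; real exponents cover positive and negative frequencies at
    once. *)
Definition cis (x t : R) : R[i] := cos (x * t) +i* sin (x * t).

Lemma ccontinuous_cis x : ccontinuous (cis x).
Proof.
have cx : continuous (fun t : R => x * t).
  by move=> t; apply: cvgM; [exact: cvg_cst|exact: cvg_id].
split=> t /=; apply: continuous_comp; try exact: cx.
  exact: continuous_cos.
exact: continuous_sin.
Qed.

Lemma cisD x y t : cis (x + y) t = cis x t * cis y t.
Proof.
rewrite /cis mulrDl cosD sinD; apply/eqP; rewrite eq_complex /= eqxx /=.
by rewrite addrC.
Qed.

Lemma cis0 t : cis 0 t = 1.
Proof. by rewrite /cis mul0r cos0 sin0. Qed.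

Lemma cint_cis0 : cint (cis 0) = (2 * pi)%:C.
Proof.
rewrite (@cintE _ (fun=> 1) (fun=> 0)); [|by move=> t; rewrite cis0|by move=> t; rewrite cis0].
by rewrite !Rintegral_cst// measure_D mul1r mul0r.
Qed.

Lemma Rintegral_derivative (f F : R -> R) : continuous f ->
  (forall x : R, is_derive x 1 F (f x)) ->
  \int[mu]_(t in D) f t = F (2 * pi) - F 0.
Proof.
move=> cf dF; rewrite /Rintegral (@continuous_FTC2 _ f F)//.
- exact: pi2_gt0.
- exact: continuous_subspaceT.
- have cF : continuous F.
    by move=> x; apply: differentiable_continuous; apply/derivable1_diffP; case: (dF x).
  split=> [x _| |].
  + by case: (dF x).
  + by apply: cvg_at_right_filter; exact: cF.
  + by apply: cvg_at_left_filter; exact: cF.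
- by move=> x _; rewrite derive1E; case: (dF x).
Qed.

Lemma cint_cis x : x != 0 -> cis x (2 * pi) = 1 -> cint (cis x) = 0.
Proof.
move=> x0 /eqP; rewrite eq_complex /= => /andP[/eqP c1 /eqP s1].
have [cc cs] := ccontinuous_cis x.
have lin t : is_derive (t : R) 1 (fun s : R => x * s) x.
  by apply: is_derive_eq; rewrite /GRing.scale /= mulr1.
have dS (t : R) : is_derive t 1 (fun s : R => x^-1 * sin (x * s)) (cos (x * t)).
  have h := @is_derive1_comp R sin (fun s : R => x * s) t _ _ (is_derive_sin (x * t)) (lin t).
  apply: is_derive_eq; rewrite /GRing.scale /=.
  by rewrite mulrCA mulVf ?mulr1.
have dC (t : R) : is_derive t 1 (fun s : R => - x^-1 * cos (x * s)) (sin (x * t)).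
  have h := @is_derive1_comp R cos (fun s : R => x * s) t _ _ (is_derive_cos (x * t)) (lin t).
  apply: is_derive_eq; rewrite /GRing.scale /=.
  by rewrite mulNr mulNr mulrN opprK mulrCA mulVf ?mulr1.
have E1 := Rintegral_derivative cc dS; have E2 := Rintegral_derivative cs dC.
rewrite (@cintE _ (fun t => cos (x * t)) (fun t => sin (x * t)))//.
by rewrite E1 E2 s1 c1 !mulr0 sin0 cos0 !mulr0 !subrr.
Qed.

Lemma cis_norm x t : rnorm (cis x t) = 1.
Proof. by rewrite /rnorm normc_def /= cos2Dsin2 sqrtr1. Qed.

Lemma cis_nz x t : cis x t != 0.
Proof. by apply/eqP => h; have := cis_norm x t; rewrite h rnorm0 => /eqP; rewrite eq_sym oner_eq0. Qed.

Lemma cis_nat n t : cis n%:R t = cis 1 t ^+ n.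
Proof. by elim: n => [|n IH]; rewrite ?cis0 ?expr0// -natr1 cisD IH exprSr. Qed.

Lemma cisN x t : cis (- x) t = (cis x t)^-1.
Proof.
apply: (mulfI (cis_nz x t)); rewrite divff ?cis_nz//.
by rewrite -cisD subrr cis0.
Qed.

Lemma cis_2pi n : cis n%:R (2 * pi) = 1.
Proof.
rewrite cis_nat (_ : cis 1 (2 * pi) = 1) ?expr1n//.
by rewrite /cis mul1r mulr_natl cos2pi sin2pi.
Qed.

Lemma cint_cisN n : cint (cis (- n%:R)) = if n is 0%N then (2 * pi)%:C else 0.
Proof.
case: n => [|n]; first by rewrite oppr0 cint_cis0.
by apply: cint_cis; rewrite ?oppr_eq0 ?pnatr_eq0// cisN cis_2pi invr1.
Qed.

Lemma cint_sum (n : nat) (h : nat -> R -> R[i]) : (forall k, ccontinuous (h k)) ->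
  ccontinuous (fun t => \sum_(k < n) h k t) /\
  cint (fun t => \sum_(k < n) h k t) = \sum_(k < n) cint (h k).
Proof.
move=> nh; elim: n => [|n [IH1 IH2]].
  rewrite big_ord0 (_ : (fun t => _) = fun=> 0); last by apply/funext => t; rewrite big_ord0.
  split; first by split=> t; exact: cvg_cst.
  by rewrite (@cintE _ (fun=> 0) (fun=> 0))// Rintegral_cst// mul0r.
rewrite big_ord_recr /= (_ : (fun t => _) = (fun t => \sum_(k < n) h k t + h n t)).
  by split; [exact: ccontinuousD|rewrite cintD// IH2].
by apply/funext => t; rewrite big_ord_recr.
Qed.

(** Only the term in [w ^- 1] of a Laurent polynomial has a nonzero integral, and
    uniform limits pass under the integral sign. *)
Lemma circle_integral_laurent (c : R[i]) (r : R) (f : R[i] -> R[i]) (rho : R[i]) : 0 < r ->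
  (forall e : R, 0 < e -> exists N (a b : nat -> R[i]), b 0%N = rho /\
    forall w, rnorm w = r ->
      rnorm (f (c + w) - (\sum_(k < N.+1) a k * w ^+ k +
                          \sum_(k < N.+1) b k * w ^- k.+1)) <= e) ->
  circle_integral c r f = 2%:R * pi%:C * 'i * rho.
Proof.
move=> r0 hf.
pose w t := r%:C * cis 1 t.
have wn t : rnorm (w t) = r by rewrite rnormM cis_norm rnorm_real gtr0_norm// mulr1.
have rC0 : r%:C != 0 by rewrite gt_eqF// ltcR.
have w0 t : w t != 0 by rewrite mulf_neq0// cis_nz.
have -> : circle_integral c r f = cint (fun t => f (c + w t) * ('i * w t)).
  rewrite /circle_integral /cint; congr (_ +i* _); apply: eq_Rintegral => t _;
  by rewrite /w /cis mul1r (mulrA 'i%C).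
apply: cint_approx => e e0; have [N [a [b [b0 hab]]]] := hf (e / r) (divr_gt0 e0 r0).
pose h1 k t := a k * 'i * r%:C ^+ k.+1 * cis k.+1%:R t.
pose h2 k t := b k * 'i * r%:C ^- k * cis (- k%:R) t.
have n1 k : ccontinuous (h1 k) by apply: ccontinuousZ; exact: ccontinuous_cis.
have n2 k : ccontinuous (h2 k) by apply: ccontinuousZ; exact: ccontinuous_cis.
have [n1' e1] := cint_sum N.+1 n1; have [n2' e2] := cint_sum N.+1 n2.
exists (fun t => \sum_(k < N.+1) h1 k t + \sum_(k < N.+1) h2 k t); split.
- exact: ccontinuousD.
- rewrite cintD// e1 e2 big1 => [|k _]; last first.
    by rewrite cintZ ?cint_cis ?mulr0 ?cis_2pi ?pnatr_eq0//; exact: ccontinuous_cis.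
  rewrite add0r big_ord_recl big1 => [|k _]; last first.
    by rewrite cintZ ?cint_cisN ?mulr0//; exact: ccontinuous_cis.
  rewrite addr0 cintZ; last exact: ccontinuous_cis.
  by rewrite cint_cisN /= expr0 invr1 mulr1 b0 rmorphM /= rmorph_nat; ring.
- move=> t; have -> : f (c + w t) * ('i * w t) - (\sum_(k < N.+1) h1 k t + \sum_(k < N.+1) h2 k t) =
     (f (c + w t) - (\sum_(k < N.+1) a k * w t ^+ k + \sum_(k < N.+1) b k * w t ^- k.+1)) * ('i * w t).
    rewrite mulrBl mulrDl !mulr_suml; congr (_ - (_ + _)); apply: eq_bigr => k _.
      rewrite /h1 cis_nat /w exprS exprMn [cis 1 t ^+ _]exprS; ring.
    rewrite /h2 cisN cis_nat.
    have E : w t ^- k.+1 * w t = w t ^- k by rewrite exprSr invfM divfK.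
    rewrite (_ : b k * w t ^- k.+1 * ('i * w t) = b k * 'i * (w t ^- k.+1 * w t)).
      by rewrite E -[LHS]mulrA -invfM -exprMn.
    by move: (w t ^- k.+1) (w t) => p q; ring.
  rewrite rnormM rnormM wn (_ : rnorm 'i%C = 1).
    by rewrite mul1r -ler_pdivlMr// hab.
  by rewrite /rnorm normc_def /= expr0n expr1n add0r sqrtr1.
Qed.

End CircleIntegral.

(** * Riesz projections of the clusters *)

Section Expansion.
Variables (R : realType) (H : normedModType R[i]).

Lemma iterate_expansion (S : H -> H) (x g : nat -> H) (b : R[i]) N :
  (forall k, S (x k) = g k + b *: S (x k.+1)) ->
  S (x 0%N) = \sum_(k < N) b ^+ k *: g k + b ^+ N *: S (x N).
Proof.
move=> Sx; elim: N => [|N ->]; first by rewrite big_ord0 add0r expr0 scale1r.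
by rewrite big_ord_recr /= -addrA; congr (_ + _); rewrite {1}Sx scalerDr scalerA exprSr.
Qed.

Lemma iter_opbound (T : H -> H) (M : R) x n : opbound T M -> 0 <= M ->
  rnorm (iter n T x) <= M ^+ n * rnorm x.
Proof.
move=> hT M0; elim: n => [|n IH]; first by rewrite expr0 mul1r.
by rewrite (le_trans (hT _))// exprS -mulrA ler_wpM2l.
Qed.

Lemma geometric_small (k c e : R) : 0 <= k < 1 -> 0 < e -> exists N, c * k ^+ N.+1 <= e.
Proof.
move=> /andP[k0 k1] e0.
have : (fun n => c * k ^+ n : R) @ \oo --> c * 0.
  by apply: cvgMr; apply: cvg_expr; rewrite ger0_norm.
rewrite mulr0 => /cvgrPdist_lt/(_ e e0)[N _ /(_ N.+1 (leqnSn _))].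
rewrite /= sub0r normrN => /ltW h; exists N; exact: le_trans (ler_norm _) h.
Qed.

End Expansion.

Section Riesz.
Variables (R : realType) (H : completeNormedModType R[i]) (dot : {dot H for (@Num.conj R[i])}).
Hypothesis dotP : norm_from_dot dot.
Variable P : int -> H -> H.
Hypothesis resP : resolution_of_identity dot P.
Variables (V : H -> H) (v : R).
Hypotheses (lV : linear V) (hV : opbound V v) (v0 : 0 <= v)
  (PV : forall n x, P n (V x) = V (P n x)).
Variables (mult : int -> nat) (f : forall n, 'I_(mult n) -> H).
Arguments f : clear implicits.
Hypotheses (fo : forall n, orthonormal_family dot (f n))
  (fP : forall n x, P n x = \sum_i dot x (f n i) *: f n i)
  (ft : forall n (i j : 'I_(mult n)), (i < j)%N -> dot (V (f n i)) (f n j) = 0).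
Variables (A : operator H) (lam : int -> R[i]) (d : R).
Hypotheses (linA : linear_operator A) (clA : closed_operator A)
  (normA : normal_operator dot A)
  (AP : forall n x, dom A (P n x) /\ A (P n x) = lam n *: P n x)
  (lam_large : forall L : R, exists F : {fset int}, forall n, n \notin F -> L <= rnorm (lam n))
  (d0 : 0 < d) (lam_sep : forall m n, m != n -> d <= rnorm (lam m - lam n))
  (vd : 3 * v < d).
Variables (B W W' : H -> H).
Hypotheses (sim : similar_by (sub_operator A B) (sub_operator A V) W)
  (invW : inverse_op W W').

Let Plin := proj_linear resP.
Let b n (i : 'I_(mult n)) := block_eig dot V f i.
Let b_le n (i : 'I_(mult n)) : rnorm (b i) <= v := block_eig_le dotP hV (@fo) i.

Lemma lam_far n (z : R[i]) m : rnorm (z - lam n) = d / 2 -> d / 2 <= rnorm (lam m - z).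
Proof.
move=> zn; have [->|mn] := eqVneq m n; first by rewrite crnormBC zn.
have := crnorm_tri z (lam m) (lam n); have := lam_sep mn; rewrite zn; lra.
Qed.

Lemma circle_avoids n (z : R[i]) : rnorm (z - lam n) = d / 2 ->
  forall m (i : 'I_(mult m)), z != lam m - b i.
Proof.
move=> zn m i; apply: contraTneq (b_le i) => zE.
have := lam_far m zn; rewrite zE opprB addrCA subrr addr0 -ltNge => h.
by apply: (lt_le_trans _ h); have := vd; have := v0; lra.
Qed.

(** The shifts have modulus at most [v < d / 3]: the cluster of [lam n] stays
    inside the circle of radius [d / 2], and the others stay outside. *)
Lemma cluster_in_disc n :
  [set lam n - b i | i in [set: 'I_(mult n)]] =
  spectrum (sub_operator A B) `&` [set z : R[i] | rnorm (z - lam n) < d / 2].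
Proof.
have -> : spectrum (sub_operator A B) = spectrum (sub_operator A V).
  by rewrite /spectrum (similar_resolvent_set sim invW).
rewrite (block_spectrum dotP resP lV hV PV (@fo) fP ft linA clA normA AP lam_large).
apply/seteqP; split=> z.
  move=> [i _ <-]; split; first by exists n => //; exists i.
  by rewrite /= addrC addKr rnormN; have := b_le i; have := vd; have := v0; lra.
move=> [[m _ [i _ <-]]] /= h.
have [mn|mn] := eqVneq m n; first by subst m; exists i.
exfalso; have := lam_sep mn; have := b_le i.
have := crnormD (lam m - b i - lam n) (b i).
rewrite (_ : lam m - b i - lam n + b i = lam m - lam n); last by rewrite addrAC subrK.
by have := vd; have := v0; lra.
Qed.

Section Integral.
Variables (n : int) (x y : H).
Let u := W' x.
Let v1 := P n u.
Let v2 := u - P n u.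

Let shifted m := if m == n then d%:C else lam m - lam n.

Let shifted_ge m : d <= rnorm (shifted m).
Proof.
rewrite /shifted; case: eqP => [_|/eqP mn]; last exact: lam_sep.
by rewrite rnorm_real gtr0_norm.
Qed.

Let vd' : v < d. Proof. by have := vd; have := v0; lra. Qed.

(** The inverse of [A - V - lam n] off the range of [P n].  The block [n], which
    need not be invertible, is replaced by [d - V]. *)
Let reduced_resolvent : exists S0, [/\ linear S0, opbound S0 (d - v)^-1,
  forall x, P n x = 0 -> P n (S0 x) = 0
  & forall x m, m != n -> (lam m - lam n) *: P m (S0 x) - V (P m (S0 x)) = P m x].
Proof.
have [F hF] := lam_large (v + 1 + rnorm (lam n)).
have [m i|m|S0 [bS h1 h2]] := @block_diagonal_inverse _ _ _ dotP P resP V v lV hV PV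
  mult f (@fo) fP ft shifted (F `|` [fset n])%fset.
- apply: contraTneq (shifted_ge m) => ->; rewrite -ltNge.
  exact: le_lt_trans (b_le i) vd'.
- rewrite !inE negb_or => /andP[mF mn]; rewrite /shifted (negbTE mn).
  have := crnorm_tri (lam n) (lam m) 0; rewrite !subr0 => h.
  by have h' := hF m mF; lra.
exists S0; split; first by case: bS.
- exact: (block_diagonal_bound dotP resP hV vd' shifted_ge h1).
- move=> w Pw; have := h1 n w; rewrite Pw => E.
  have := block_lower hV (P n (S0 w)) (shifted_ge n); rewrite E rnorm0.
  by rewrite pmulr_rle0 ?subr_gt0// => h; apply/rnorm_eq0/eqP; rewrite eq_le h rnorm_ge0.
- by move=> w m mn; have := h1 m w; rewrite /shifted (negbTE mn).
Qed.

(** On the circle [|w| = d / 2] the resolvent [S] of [A - V] at [lam n + w]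
    satisfies [S p = S0 p + w S (S0 p)] for [p] in the kernel of [P n], and
    [S p = - w^-1 p + w^-1 S (- V p)] for [p] in its range.  Iterating these gives a
    Laurent polynomial with remainders of ratios [(d / 2) / (d - v)] and
    [v / (d / 2)], both at most [3 / 4]; its residue is [- W v1]. *)
Lemma laurent_approx (e : R) : 0 < e -> exists N (a c : nat -> R[i]),
  c 0%N = - dot (W v1) y /\
  forall w, rnorm w = d / 2 ->
    rnorm (dot (resolvent (sub_operator A B) (lam n + w) x) y -
      (\sum_(k < N.+1) a k * w ^+ k + \sum_(k < N.+1) c k * w ^- k.+1)) <= e.
Proof.
move=> e0; have [S0 [lS0 hS0 S0n S0m]] := reduced_resolvent.
have [bW _ _ _] := sim; have [lW [CW CW0 hCW]] := (bounded_opP W).1 bW.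
pose ell z : R[i] := dot (W z) y.
have ell_lin : linear (ell : H -> R[i]^o).
  by move=> s p q; rewrite /ell (linD lW) (linZ lW) dotDl dotZl.
have ell_le z : rnorm (ell z) <= CW * rnorm y * rnorm z.
  rewrite /ell (le_trans (cauchy_schwarz dotP _ _))//.
  by rewrite [leRHS]mulrAC ler_wpM2r ?rnorm_ge0.
pose K := (d / 2 - v)^-1.
have dv : 0 < d / 2 - v by have := vd; have := v0; lra.
pose C := CW * rnorm y * (K * (rnorm v2 + rnorm v1)).
have th : 0 <= (3 / 4 : R) < 1 by apply/andP; split; lra.
have [N hN] := geometric_small C th e0.
pose x2 k := iter k S0 v2; pose x1 k := iter k (fun z => - V z) v1.
exists N, (fun k => ell (x2 k.+1)), (fun k => - ell (x1 k)); split=> // w wn.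
have w0 : w != 0.
  apply/eqP => wE; move: wn; rewrite wE rnorm0 => /eqP.
  by rewrite eq_sym gt_eqF// divr_gt0.
set z := lam n + w; have zn : rnorm (z - lam n) = d / 2 by rewrite /z addrC addKr.
have zm m : lam m - z = lam m - lam n - w by rewrite /z opprD addrA.
clearbody z.
have [S [hS S1]] := block_resolvent dotP resP lV hV PV (@fo) fP ft linA clA normA AP
  lam_large (circle_avoids zn).
have far m : d / 2 <= rnorm (lam m - z) by exact: lam_far zn.
have bS : opbound S K by apply: (block_diagonal_bound dotP resP hV _ far S1); lra.
have lS : linear S by have [[]] := hS.
rewrite (resolvent_eq (similar_resolvent sim invW hS)) /= -/u -/(ell (S u)).
(* [p] is determined by its images under the blocks [lam m - z - V], which are
   bounded below. *)
have inj p q : (forall m, (lam m - z) *: P m p - V (P m p) =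
     (lam m - z) *: P m q - V (P m q)) -> p = q.
  move=> pq; apply: (proj_ext resP) => m; apply/eqP; rewrite -subr_eq0.
  have := block_lower hV (P m p - P m q) (far m).
  rewrite scalerBr (linB lV) (opprD (V _)) opprK addrACA pq addrACA subrr addNr addr0.
  rewrite rnorm0 pmulr_rle0// => h.
  by apply/eqP/rnorm_eq0/eqP; rewrite eq_le h rnorm_ge0.
have x2n k : P n (x2 k) = 0.
  elim: k => [|k IH]; last exact: S0n.
  by rewrite /x2 /= /v2 (linB (Plin n)) (proj_idem resP) subrr.
have x1n k m : P m (x1 k) = if m == n then x1 k else 0.
  elim: k => [|k IH]; first by rewrite /x1 /= (proj_mul resP).
  rewrite /x1 /= (linN (Plin m)) PV IH; case: eqP => // _.
  by rewrite (lin0 lV) oppr0.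
have step2 k : S (x2 k) = x2 k.+1 + w *: S (x2 k.+1).
  apply: inj => m; rewrite S1 (linD (Plin m)) (linZ (Plin m)) scalerDr (linD lV) (linZ lV).
  rewrite opprD addrACA scalerA [_ * w]mulrC -scalerA -scalerBr S1.
  have [->|mn] := eqVneq m n; first by rewrite !x2n scaler0 (lin0 lV) subr0 scaler0 addr0.
  by rewrite zm scalerBl [X in X + _]addrAC subrK S0m.
have step1 k : S (x1 k) = - w^-1 *: x1 k + w^-1 *: S (x1 k.+1).
  apply: inj => m; rewrite S1 (linD (Plin m)) !(linZ (Plin m)) scalerDr (linD lV) !(linZ lV).
  rewrite opprD addrACA !scalerA ![(lam m - z) * _]mulrC -!scalerA -!scalerBr S1.
  rewrite !x1n; case: eqP => [->|_]; last by rewrite (lin0 lV) !scaler0 subr0 scaler0 addr0.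
  have -> : x1 k.+1 = - V (x1 k) by [].
  rewrite zm subrr sub0r (scaleNr w) -opprD scalerN scaleNr opprK -scalerDr addrK.
  by rewrite scalerA mulVf// scale1r.
have Su : S u = S (x2 0%N) + S (x1 0%N) by rewrite -(linD lS) /x1 /x2 /= /v2 subrK.
have ellD p q : ell (p + q) = ell p + ell q by rewrite /ell (linD lW) dotDl.
have ellZ s p : ell (s *: p) = s * ell p by rewrite /ell (linZ lW) dotZl.
have ell_sum M (g : nat -> H) : ell (\sum_(k < M) g k) = \sum_(k < M) ell (g k).
  by rewrite /ell (lin_sum lW) dot_suml.
have -> : ell (S u) - (\sum_(k < N.+1) ell (x2 k.+1) * w ^+ k +
      \sum_(k < N.+1) - ell (x1 k) * w ^- k.+1) =
    ell (w ^+ N.+1 *: S (x2 N.+1)) + ell (w^-1 ^+ N.+1 *: S (x1 N.+1)).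
  rewrite Su ellD (iterate_expansion N.+1 step1) (iterate_expansion N.+1 step2).
  rewrite !ellD (ell_sum _ (fun k => w ^+ k *: x2 k.+1))
    (ell_sum _ (fun k => w^-1 ^+ k *: (- w^-1 *: x1 k))).
  have -> : \sum_(k < N.+1) ell (w ^+ k *: x2 k.+1) = \sum_(k < N.+1) ell (x2 k.+1) * w ^+ k.
    by apply: eq_bigr => k _; rewrite ellZ mulrC.
  have -> : \sum_(k < N.+1) ell (w^-1 ^+ k *: (- w^-1 *: x1 k)) =
      \sum_(k < N.+1) - ell (x1 k) * w ^- k.+1.
    by apply: eq_bigr => k _; rewrite !ellZ exprVn exprS invfM; ring.
  by rewrite addrACA [LHS]addrC addKr.
have dv' : 0 < d - v by rewrite subr_gt0.
have hSx2 : rnorm (x2 N.+1) <= (d - v)^-1 ^+ N.+1 * rnorm v2.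
  by apply: iter_opbound; rewrite ?invr_ge0 ?(ltW dv').
have hSx1 : rnorm (x1 N.+1) <= v ^+ N.+1 * rnorm v1.
  by apply: iter_opbound => // p; rewrite rnormN.
have CWy : 0 <= CW * rnorm y by rewrite mulr_ge0 ?rnorm_ge0.
have K0 : 0 <= K by rewrite invr_ge0 ltW.
have term (s : R[i]) (r : R) p q : rnorm s * r <= 3 / 4 -> 0 <= r ->
    rnorm p <= r ^+ N.+1 * q -> 0 <= q ->
    rnorm (ell (s ^+ N.+1 *: S p)) <= CW * rnorm y * (K * q) * (3 / 4) ^+ N.+1.
  move=> sr r0 pq q0; rewrite (le_trans (ell_le _))// -[leRHS]mulrA ler_wpM2l// rnormZ rnormX.
  apply: (@le_trans _ _ (rnorm s ^+ N.+1 * (K * (r ^+ N.+1 * q)))).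
    by rewrite ler_wpM2l ?exprn_ge0 ?rnorm_ge0// (le_trans (bS _))// ler_wpM2l.
  have -> : rnorm s ^+ N.+1 * (K * (r ^+ N.+1 * q)) = K * q * (rnorm s * r) ^+ N.+1.
    by rewrite exprMn; move: (rnorm s ^+ _) (r ^+ _) => s' r'; ring.
  rewrite ler_wpM2l ?mulr_ge0//.
  by rewrite ler_pXn2r// nnegrE ?mulr_ge0 ?rnorm_ge0//; lra.
apply: (le_trans (crnormD _ _)); apply: le_trans hN.
rewrite /C !mulrDr mulrDl; apply: lerD.
  apply: term hSx2 _; rewrite ?invr_ge0 ?rnorm_ge0 ?(ltW dv')//.
  by rewrite wn ler_pdivrMr//; have := vd; lra.
apply: term hSx1 _; rewrite ?rnorm_ge0//.
rewrite rnormV wn mulrC ler_pdivrMr ?divr_gt0//; have := vd; have := v0; lra.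
Qed.

Lemma riesz_integral :
  dot (W (P n (W' x))) y = - (2%:R * pi%:C * 'i)^-1 *
    circle_integral (lam n) (d / 2) (fun z => dot (resolvent (sub_operator A B) z x) y).
Proof.
rewrite (circle_integral_laurent (rho := - dot (W v1) y)).
- rewrite mulrN mulNr mulrN opprK mulKf//.
  rewrite !mulf_neq0 ?pnatr_eq0//.
    by rewrite -(rmorph0 (real_complex R)) (inj_eq (@complexI R)) gt_eqF// pi_gt0.
  by rewrite eq_complex /= oner_eq0 andbF.
- by rewrite divr_gt0.
- by move=> e /laurent_approx[N [a [c [c0 hc]]]]; exists N, a, c.
Qed.

End Integral.

Lemma riesz_cluster n : riesz_projection dot (sub_operator A B)
  [set lam n - b i | i in [set: 'I_(mult n)]] (W \o P n \o W').
Proof.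
have [bW _ _ _] := sim; have [bW' _ _] := invW.
split.
  apply: bounded_op_comp => //; apply: bounded_op_comp => //.
  exact: (proj_bounded resP n).
exists (lam n), (d / 2); split.
- by rewrite divr_gt0.
- move=> z zn; rewrite (similar_resolvent_set sim invW).
  have [S [hS _]] := block_resolvent dotP resP lV hV PV (@fo) fP ft linA clA normA AP
    lam_large (circle_avoids zn).
  by exists S.
- exact: cluster_in_disc.
- by move=> x y; exact: riesz_integral.
Qed.

End Riesz.

(** * Summability of the shifts, and the similar resolution of the identity *)

Section Shifts.
Variables (R : realType) (H : completeNormedModType R[i]) (dot : {dot H for (@Num.conj R[i])}).
Hypothesis dotP : norm_from_dot dot.
Variable P : int -> H -> H.
Hypothesis resP : resolution_of_identity dot P.
Variables (mult : int -> nat) (f : forall n, 'I_(mult n) -> H).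
Arguments f : clear implicits.
Hypotheses (fo : forall n, orthonormal_family dot (f n))
  (fP : forall n x, P n x = \sum_i dot x (f n i) *: f n i).

Lemma proj_norm_coord n x : rnorm (P n x) ^+ 2 = \sum_i rnorm (dot x (f n i)) ^+ 2.
Proof.
rewrite fP (orth_sum_norm dotP) ?index_enum_uniq//; last first.
  by move=> i j ij; rewrite dotZl dotZr fo (negbTE ij) !mulr0.
apply: eq_bigr => i _; rewrite rnormZ exprMn [rnorm (f n i) ^+ 2](rnorm2E dotP).
by rewrite fo eqxx mulr1.
Qed.

(** Independence of the basis, for the basis [f] adapted to [P]: the two sums are
    exchanged through the adjoint. *)
Lemma hs2_basis T T' : has_adj dot T T' ->
  \esum_(n in setT) (\sum_i rnorm (T (f n i)) ^+ 2)%:E = hs2 dot T.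
Proof.
move=> aT; rewrite -(hs2_adj dotP aT) (hs2_rows dotP resP).
apply: eq_esum => n _; rewrite /hs2 -sumEFin.
under eq_bigr do rewrite -(onb_parseval dotP (hs_basis_onb dotP)).
rewrite -esum_sum; last by move=> e i _ _; rewrite lee_fin sqr_ge0.
apply: eq_esum => e _; rewrite sumEFin /= proj_norm_coord; congr _%:E.
by apply: eq_bigr => i _; rewrite aT dot_conj rnorm_conj.
Qed.

(** The diagonal entries of a product of two Hilbert--Schmidt operators are
    [<U f, B' f>], and both [|U f|^2] and [|B' f|^2] are summable. *)
Lemma diagonal_summable B U c c' (bb : forall n, 'I_(mult n) -> R[i]) :
  HSle dot B c -> HSle dot U c' ->
  (forall n i, bb n i = dot (B (U (f n i))) (f n i)) ->
  (\esum_(n in setT) (\sum_i rnorm (bb n i))%:E < +oo)%E.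
Proof.
move=> hB hU bE; have [B' aB] := HSle_adj dotP hB; have [U' aU] := HSle_adj dotP hU.
have h1 : (\esum_(n in setT) (\sum_i rnorm (U (f n i)) ^+ 2)%:E < +oo)%E.
  by rewrite (hs2_basis aU); have [_ _ h] := hU; exact: le_lt_trans h (ltry _).
have h2 : (\esum_(n in setT) (\sum_i rnorm (B' (f n i)) ^+ 2)%:E < +oo)%E.
  rewrite (hs2_basis (has_adj_sym aB)) (hs2_adj dotP aB); have [_ _ h] := hB.
  exact: le_lt_trans h (ltry _).
apply: le_lt_trans (lte_add_pinfty h1 h2); rewrite -esumD.
- apply: le_esum => n _; rewrite -EFinD lee_fin -big_split; apply: ler_sum => i _ /=.
  rewrite bE aB (le_trans (cauchy_schwarz dotP _ _))//.
  set p := rnorm _; set q := rnorm _.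
  by have := sqr_ge0 (p - q); have := sqr_ge0 (p + q); rewrite !expr2; lra.
- by move=> n _; rewrite lee_fin sumr_ge0// => i _; exact: sqr_ge0.
- by move=> n _; rewrite lee_fin sumr_ge0// => i _; exact: sqr_ge0.
Qed.

End Shifts.

Lemma similar_resolution (R : realType) (H : completeNormedModType R[i])
  (dot : {dot H for (@Num.conj R[i])}) (P : int -> H -> H) (W W' : H -> H) :
  resolution_of_identity dot P -> bounded_op W -> inverse_op W W' ->
  resolution_of_identity (fun x y => dot (W' x) (W' y)) (fun n => W \o P n \o W').
Proof.
move=> resP bW [bW' WK WK']; have [lW [M _ hM]] := (bounded_opP W).1 bW.
split=> [n|m n mn x|x].
- split.
  + apply: bounded_op_comp => //; apply: bounded_op_comp => //.
    exact: (proj_bounded resP n).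
  + by move=> x /=; rewrite WK (proj_idem resP).
  + by move=> x y /=; rewrite !WK (proj_adj resP).
- by rewrite /= WK (proj_mul resP) (negbTE mn) (lin0 lW).
- by have := psum_lin lW hM (@proj_psum _ _ _ _ _ resP (W' x)); rewrite WK'.
Qed.

Lemma gap_le (R : realType) (lam : int -> R[i]) m n :
  m != n -> gap lam <= rnorm (lam m - lam n).
Proof.
move=> mn; apply: ge_inf; last by exists m, n.
by exists 0 => _ [p [q [_ ->]]]; exact: rnorm_ge0.
Qed.

Lemma hs_norm_HSle (R : realType) (H : completeNormedModType R[i])
  (dot : {dot H for (@Num.conj R[i])}) (T : H -> H) (c : R) :
  norm_from_dot dot -> hilbert_schmidt dot T -> (hs_norm dot T < c%:E)%E ->
  exists2 b, b < c & HSle dot T b.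
Proof.
move=> dotP [bT fT] Tc; have T0 : (0 <= hs_norm dot T)%E by exact: sqrte_ge0.
have TE : hs_norm dot T = (fine (hs_norm dot T))%:E by rewrite fineK// ge0_fin_numE.
exists (fine (hs_norm dot T)); first by rewrite -lte_fin -TE.
by apply: (hs_norm_leP dot bT (fine_ge0 T0)).1; rewrite -TE.
Qed.


Theorem theorem4p3 (R : realType) (H : completeNormedModType R[i])
    (dot : {dot H for (@Num.conj R[i])})
    (dotP : norm_from_dot dot) (sepH : separable H)
    (A : operator H) (linA : linear_operator A) (densA : densely_defined A)
    (* (A1) *)
    (clA : closed_operator A) (normA : normal_operator dot A)
    (* (A2), (A3) *)
    (lam : int -> R[i]) (lam_inj : injective lam)
    (mult : int -> nat) (P : int -> H -> H)
    (specA : spectrum A = \bigcup_n [set lam n])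
    (rieszA : forall n, riesz_projection dot A [set lam n] (P n))
    (ssA : forall n, semisimple_eigenvalue A (P n) (lam n) (mult n))
    (resP : resolution_of_identity dot P)
    (* (A4) *)
    (supA : (ereal_sup [set \esum_(n in [set n | n != j])
                (rnorm (lam n - lam j) ^- 2)%:E | j in [set: int]] < +oo)%E)
    (* (A5) *)
    (smallA : forall eps : R, 0 < eps ->
       exists2 z, resolvent_set A z & opnorm (resolvent A z) < eps)
    (B : H -> H) (hsB : hilbert_schmidt dot B)
    (JB : Jtransform P B = (fun=> 0))
    (smallB : (hs_norm dot B < (gap lam / 3)%:E)%E) :
  exists Xs : H -> H,
    [/\ hilbert_schmidt dot Xs,
        (fun k => hs_norm dot (iter k (Phi lam P B) (fun=> 0) \- Xs)) @ \oo
          --> 0%E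
      & let U := Gammatransform lam P Xs in
        let V := Jtransform P Xs in
        let W := idfun \+ U in
        [/\ V = Jtransform P (B \o Gammatransform lam P Xs),
            (* (1) *)
            [/\ hilbert_schmidt dot U, hilbert_schmidt dot V
              & similar_by (sub_operator A B) (sub_operator A V) W]
          & exists (W' : H -> H) (b : forall n : int, 'I_(mult n) -> R[i]),
            let P' n := W \o P n \o W' in
            [/\ inverse_op W W',
                (* (2): the projections P' n are oblique in general; they are
                   orthogonal for the inner product that makes W' isometric *)
                [/\ forall m n, m != n -> forall x, P m (V (P n x)) = 0,
                    forall n, riesz_projection dot (sub_operator A B)
                      [set lam n - b n i | i in [set: 'I_(mult n)]] (P' n)
                  & resolution_of_identity
                      (fun x y => dot (W' x) (W' y)) P']
              & (* (3): each lam n is counted with its multiplicity *)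
                spectrum (sub_operator A B)
                  = \bigcup_n [set lam n - b n i | i in [set: 'I_(mult n)]] /\
                (\esum_(n in [set: int])
                   (\sum_(i < mult n) rnorm (b n i))%:E < +oo)%E]]].
Proof.
pose d := gap lam.
have lam_sep m n : m != n -> d <= rnorm (lam m - lam n) by exact: gap_le.
have AP n x : dom A (P n x) /\ A (P n x) = lam n *: P n x by have [_ + _] := ssA n; apply.
have [b bd hB] := hs_norm_HSle dotP hsB smallB.
have b0 := HSle_ge0 hB.
have b3 : 3 * b < d by move: bd; rewrite -/d; lra.
have d0 : 0 < d by apply: le_lt_trans b3; rewrite mulr_ge0.
pose q := ratio d b.
have q0 : 0 <= q := ratio_ge0 d0 hB.
have q1 : q < 1 := ratio_lt1 d0 b3.
have [Xs [hXs Xlim fixXs]] := Phi_fixed_point dotP resP d0 lam_sep hB b3.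
pose U := Gammatransform lam P Xs; pose V := Jtransform P Xs; pose W := idfun \+ U : H -> H.
have VE : V = Jtransform P (B \o U) := fixed_J dotP resP d0 lam_sep hB JB hXs fixXs.
have hU : HSle dot U q := Gamma_HSle dotP resP d0 lam_sep hXs.
have hV : HSle dot V (b * q) := fixed_J_HSle dotP resP d0 lam_sep hB JB hXs fixXs.
have hBU := HSle_mul dotP hB hU.
have lV := HSle_linear hV.
have PV n x : P n (V x) = V (P n x) := J_comm dotP resP hXs n x.
have vd : 3 * (b * q) < d.
  by apply: le_lt_trans b3; rewrite ler_wpM2l// ler_piMr// ltW.
have hY := HSle_sub dotP hXs hV.
have sim : similar_by (sub_operator A B) (sub_operator A V) W.
  apply: (@similar_by_W _ _ A U V B (Xs \- V) q (3 * b + b * q)) => //.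
  - exact: HSle_linear hU.
  - exact: HSle_opbound hU.
  - by rewrite q0 q1.
  - exact: HSle_linear hY.
  - exact: HSle_opbound hY.
  - exact: HSle_linear hB.
  - by move=> x dx; exact: (Gamma_comm dotP resP linA clA normA AP d0 lam_sep hXs dx).
  - move=> x /=; rewrite subrK.
    exact: (fixed_eq dotP resP d0 lam_sep hB JB hXs fixXs).
have [bW [W' invW] _ _] := sim.
have triang n : exists f : 'I_(mult n) -> H,
    [/\ orthonormal_family dot f, forall x, P n x = \sum_i dot x (f i) *: f i
    & forall i j : 'I_(mult n), (i < j)%N -> dot (V (f i)) (f j) = 0].
  have [_ _ dimP] := ssA n.
  have h := triangular_basis_of_range dotP (proj_idem resP n) (proj_adj resP n) dimP lV.
  exact: h.
pose f n := projT1 (cid (triang n)).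
have fspec n : [/\ orthonormal_family dot (f n), forall x, P n x = \sum_i dot x (f n i) *: f n i
    & forall i j : 'I_(mult n), (i < j)%N -> dot (V (f n i)) (f n j) = 0] := projT2 (cid (triang n)).
have fo n : orthonormal_family dot (f n) by case: (fspec n).
have fP n x : P n x = \sum_i dot x (f n i) *: f n i by case: (fspec n).
have ft n (i j : 'I_(mult n)) : (i < j)%N -> dot (V (f n i)) (f n j) = 0.
  by case: (fspec n) => _ _; apply.
have large := eigenvalues_large lam_inj supA.
have v0 := HSle_ge0 hV; have hV' := HSle_opbound dotP hV.
exists Xs; split.
- by apply/hilbert_schmidtP; exists (3 * b).
- have upper k : (hs_norm dot (phi_iter P lam B k \- Xs)%R <= (3 * b / (1 - q) * q ^+ k)%:E)%E.
    have := HSle_opp (Xlim k); rewrite -/q mulrAC.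
    rewrite (_ : (fun x => - _) = phi_iter P lam B k \- Xs); last first.
      by apply/funext => x; rewrite /= opprB.
    by move=> h; apply/hs_norm_leP => //; [exact: HSle_bounded h|exact: HSle_ge0 h].
  apply: (@squeeze_cvge _ _ _ _ (fun=> 0%E) _ (fun k => (3 * b / (1 - q) * q ^+ k)%:E)).
  + by apply: nearW => k; apply/andP; split; [exact: sqrte_ge0|exact: upper].
  + exact: cvg_cst.
  + apply/fine_cvgP; split; first exact: nearW.
    rewrite -[X in _ --> X](mulr0 (3 * b / (1 - q))); apply: cvgMr; apply: cvg_expr.
    by rewrite ger0_norm.
rewrite -/U -/V -/W; split=> //.
- by split=> //; apply/hilbert_schmidtP; eexists; [exact: hU|exact: hV].
exists W', (fun n i => block_eig dot V f i); split=> //.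
- split=> [m n mn x|n|].
  + exact: (J_offdiag dotP resP x hXs mn).
  + exact: (riesz_cluster dotP resP lV hV' v0 PV fo fP ft linA clA normA AP large
      d0 lam_sep vd sim invW).
  + exact: (similar_resolution resP bW invW).
- split.
    rewrite /spectrum (similar_resolvent_set sim invW).
    exact: (block_spectrum dotP resP lV hV' PV fo fP ft linA clA normA AP large).
  apply: (diagonal_summable dotP resP fo fP hB hU) => n i.
  have fi : P n (f n i) = f n i := basis_proj (fo n) (fP n) i.
  rewrite /block_eig -{2}fi -(proj_adj resP) VE (JE dotP resP hBU) fi.
  by rewrite (proj_adj resP) fi.
Qed.
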